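(* Let $\boldsymbol\alpha=(\alpha_n)_{n\ge1}$ be a sequence compactly included in $\mathbb D$ (i.e. $\sup_n|\alpha_n|<1$), let $\mu$ be a measure on $\mathbb T$, let $(\phi_n)_{n\ge0}$ be the corresponding ORF and $\boldsymbol a=(a_n)_{n\ge1}=\mathcal S_{\boldsymbol\alpha}(\mu)$. Then $\mathcal L$ is invariant under $T_\mu$, and the matrix of the isometric operator $T_\mu\upharpoonright\mathcal L$ with respect to $(\phi_n)_{n\ge0}$ is $$\mathcal V=\tilde\zeta_{\mathcal A}(\mathcal H),\qquad \mathcal A=\mathcal A(\boldsymbol\alpha),\quad \mathcal H=\mathcal H(\boldsymbol a).$$ Moreover, the isometric matrix $\mathcal V$ represents the full operator $T_\mu$ if and only if any of the following equivalent conditions is fulfilled: $$\mathcal L=L^2_\mu\ \Leftrightarrow\ \mathcal P=L^2_\mu\ \Leftrightarrow\ \log\mu'\notin L^1_m\ \Leftrightarrow\ \boldsymbol a\notin\ell^2\ \Leftrightarrow\ \mathcal V\text{ is unitary}.$$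
   Context: $\mathbb T$ is the unit circle, $\mathbb D$ the open unit disk, $m$ the normalized Lebesgue measure on $\mathbb T$. A measure on $\mathbb T$ is a probability Borel measure $\mu$ on $\mathbb T$ whose support $\operatorname{supp}\mu$ is infinite; $\mu'=d\mu/dm$ is the density of its absolutely continuous part. $L^2_\mu$ carries the inner product $\langle f,g\rangle_\mu=\int\overline{f}\,g\,d\mu$, and $T_\mu$ is the unitary operator $f(z)\mapsto zf(z)$ on $L^2_\mu$. ORF. Let $\boldsymbol\alpha=(\alpha_n)_{n\ge1}$ be a sequence in $\mathbb D$ and set $\alpha_0=0$. For $n\ge0$ let $\varpi_n(z)=1-\overline{\alpha_n}z$, $\varpi_n^*(z)=z-\alpha_n$, $\zeta_n=\varpi_n^*/\varpi_n$. Let $B_0=1$, $B_n=\zeta_1\cdots\zeta_n$, and $f_*(z)=\overline{f(1/\overline z)}$. The orthogonal rational functions (ORF) $(\phi_n)_{n\ge0}$ of $\mu$ associated with $\boldsymbol\alpha$ are the result of orthonormalizing $(B_n)_{n\ge0}$ in $L^2_\mu$ (so $\phi_0,\dots,\phi_n$ is an orthonormal basis of $\operatorname{span}\{B_0,\dots,B_n\}$ for every $n$), with unimodular factors chosen so that $\phi_0=1$ and, with $\phi_n^*=B_n\phi_{n*}$, $$\begin{pmatrix}\phi_n\\ \phi_n^*\end{pmatrix}=e_n\frac{\varpi_{n-1}}{\varpi_n}\begin{pmatrix}1&a_n\\ \overline{a_n}&1\end{pmatrix}\begin{pmatrix}\zeta_{n-1}\phi_{n-1}\\ \phi_{n-1}^*\end{pmatrix},\quad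 e_n=\sqrt{\frac{\varpi_n(\alpha_n)}{\varpi_{n-1}(\alpha_{n-1})}\frac1{1-|a_n|^2}},\quad n\ge1,$$ for some $a_n\in\mathbb D$. This normalization exists and both $(\phi_n)$ and $\boldsymbol a=(a_n)_{n\ge1}$ are then uniquely determined; one writes $\boldsymbol a=\mathcal S_{\boldsymbol\alpha}(\mu)$. $\mathcal L$ is the closure of $\operatorname{span}\{B_n\}_{n\ge0}$ in $L^2_\mu$ and $\mathcal P$ is the closure of the polynomials in $L^2_\mu$. Matrices. The matrix of an operator $T$ with respect to an orthonormal basis $(f_n)$ has entries $\langle f_i,Tf_j\rangle_\mu$; infinite bounded matrices are identified with operators on $\ell^2$. $\mathcal A(\boldsymbol\alpha)=\operatorname{diag}(\alpha_0,\alpha_1,\alpha_2,\dots)$. With $\rho_n=\sqrt{1-|a_n|^2}$ and the convention $a_0=1$, $\mathcal H(\boldsymbol a)=(h_{k,n})_{k,n\ge0}$ is the Hessenberg matrix with $h_{k,n}=-a_{n+1}\rho_n\rho_{n-1}\cdots\rho_{k+1}\overline{a_k}$ for $k\le n$ (for $k=n$ the product of $\rho$'s is empty), $h_{n+1,n}=\rho_{n+1}$, and $h_{k,n}=0$ for $k>n+1$. Operator Möbius transformation. For bounded operators $A,T$ on a Hilbert space with $\|A\|<1$, $\|T\|\le1$, set $\eta_A=\sqrt{1-AA^\dag}$ and $\tilde\zeta_A(T)=\eta_A^{-1}(T+A)(1+A^\dag T)^{-1}\eta_{A^\dag}$. *)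

(* Defs.v *)
From HB Require Import structures.
From mathcomp Require Import all_boot all_order all_algebra.
From mathcomp Require Import complex.
From mathcomp Require Import all_classical all_reals all_analysis.
From mathcomp Require Import measurable_realfun.
Set Implicit Arguments.
Unset Strict Implicit.
Unset Printing Implicit Defensive.
Import Order.TTheory GRing.Theory Num.Theory.
Import numFieldNormedType.Exports.
Local Open Scope classical_set_scope.
Local Open Scope ring_scope.
Local Open Scope complex_scope.

Local Notation Re := complex.Re.
Local Notation Im := complex.Im.
Notation cabs := ComplexField.Normc.normc.

Definition circle (R : realType) : Type := {z : R[i] | `|z| == 1}.

Definition circle_val (R : realType) (z : circle R) : R[i] := sval z.
Coercion circle_val : circle >-> complex.

Definition circle_coord (R : realType) (z : circle R) : R * R := (Re z, Im z).

Definition circle_one (R : realType) : circle R :=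
  exist (fun z : R[i] => `|z| == 1) 1 (introT eqP (normr1 R[i])).

HB.instance Definition _ (R : realType) := gen_eqMixin (circle R).
HB.instance Definition _ (R : realType) := gen_choiceMixin (circle R).
HB.instance Definition _ (R : realType) :=
  isPointed.Build (circle R) (circle_one R).
(* The topology induced by the plane [R * R], and its Borel sigma-algebra. *)
HB.instance Definition _ (R : realType) :=
  Topological.copy (circle R) (initial_topology (@circle_coord R)).
HB.instance Definition _ (R : realType) :=
  Measurable.copy (circle R) (g_sigma_algebraType (@open (circle R))).

Section arc.
Context {R : realType}.

Lemma expi_norm (t : R) : `|cos t +i* sin t| == 1 :> R[i].
Proof. by rewrite normc_def /= cos2Dsin2 sqrtr1. Qed.

Definition expi (t : measurableTypeR R) : circle R :=
  exist (fun z : R[i] => `|z| == 1) _ (expi_norm t).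

Lemma continuous_expi : continuous (expi : R -> circle R).
Proof.
apply/continuousP => A [B oB <-].
rewrite -comp_preimage.
have ct : continuous (@circle_coord R \o (expi : R -> circle R)).
  move=> t; apply: (@cvg_pair _ _ _ _ (nbhs (cos t)) (nbhs (sin t))).
  - exact: continuous_cos.
  - exact: continuous_sin.
by move/continuousP : ct => /(_ _ oB).
Qed.

Lemma measurable_expi : measurable_fun [set: measurableTypeR R] expi.
Proof.
apply: (@measurability _ _ _ _ _ _ (@open (circle R))) => // _ [B oB <-].
rewrite setTI; apply: open_measurable.
by move/continuousP : continuous_expi; apply.
Qed.

HB.instance Definition _ :=
  isMeasurableFun.Build _ _ (measurableTypeR R) (circle R) expi measurable_expi.

Lemma two_pi_gt0 : 0 < 2 * pi :> R.
Proof. by rewrite mulr_gt0 ?pi_gt0. Qed.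

(* The normalized Lebesgue measure: law of [e^(it)], [t] uniform on [0, 2 pi]. *)
Definition haar : probability (circle R) R :=
  distribution (uniform_prob two_pi_gt0) expi.

End arc.

Section lebesgue_decomposition.
Context {R : realType} (mu : probability (circle R) R).

(* [mu = w m + mu_s] where [mu_s A = mu (A `&` N)] is carried by the [m]-null
   set [N]. *)
Definition is_ac_density (w : circle R -> R) : Prop :=
  [/\ measurable_fun setT w, forall z, 0 <= w z &
    exists2 N, measurable N /\ haar N = 0%E &
      forall A, measurable A ->
        (mu A = \int[haar]_(z in A) (w z)%:E + mu (A `&` N))%E].

Lemma lebesgue_decomposition : exists w, is_ac_density w.
Proof.
pose S := [set x | exists2 A, measurable A /\ haar A = 0%E & x = mu A].
pose s := ereal_sup S.
have s1 : (s <= 1)%E.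
  by apply: ge_ereal_sup => _ [A [mA _] ->]; exact: probability_le1.
have s0 : (0 <= s)%E.
  by apply: ereal_sup_ubound; exists set0; rewrite ?measure0.
have sfin : s \is a fin_num by rewrite ge0_fin_numE// (le_lt_trans s1) ?ltry.
have /choice[A /all_and2[/all_and2[mA A0] As]] : forall n, exists A,
    (measurable A /\ haar A = 0%E) /\ (s - (n.+1%:R^-1)%:E <= mu A)%E.
  move=> n.
  have [//|_ [A A0 ->] sA] := @ub_ereal_sup_adherent _ S n.+1%:R^-1 _ sfin.
  by exists A; split=> //; exact: ltW.
pose N := \bigcup_n A n.
have mN : measurable N by exact: bigcup_measurable.
have N0 : haar N = 0%E.
  apply/eqP; rewrite eq_le measure_ge0 andbT.
  have := @measure_sigma_subadditive _ _ _ haar N A mA mN (@subset_refl _ N).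
  by move/le_trans; apply; rewrite eseries0// => k _ _; exact: A0.
have sN : (s <= mu N)%E.
  apply/lee_addgt0Pr => e e0.
  have [n ne] : exists n : nat, n.+1%:R^-1 <= e.
    exists (Num.truncn e^-1).
    by rewrite invf_ple ?posrE// ltW// truncnS_gt.
  rewrite -leeBlDr//; apply: (le_trans _ (le_trans (As n) _)).
    by rewrite leeB// lee_fin.
  by apply: le_measure; rewrite ?inE//; exact: bigcup_sup.
have muNoo : (mu (~` N) < +oo)%E.
  by rewrite (le_lt_trans (probability_le1 _ _)) ?ltry//; exact: measurableC.
pose nu : {finite_measure set (circle R) -> \bar R} :=
  mfrestr (measurableC mN) muNoo.
have [|f [f0 ff fi fE]] := @radon_nikodym_sigma_finite _ _ R haar nu.
  apply/null_content_dominatesP => B mB B0.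
  rewrite /nu /= /mfrestr /mrestr.
  have NB0 : haar (N `|` B) = 0%E.
    apply/eqP; rewrite eq_le measure_ge0 andbT.
    apply: le_trans (measureU2 haar mN mB) _.
    by rewrite [X in (X + _)%E]N0 B0 adde0.
  have : (mu (N `|` B) <= mu N)%E.
    apply: le_trans sN; apply: ereal_sup_ubound.
    by exists (N `|` B) => //; split=> //; exact: measurableU.
  have -> : N `|` B = N `|` (B `&` ~` N) by rewrite setUIr setUCr setIT.
  rewrite measureU//; last 2 first.
  - by apply: measurableI => //; exact: measurableC.
  - by rewrite setICA setICr setI0.
  rewrite -[leRHS]adde0 leeD2lE; last exact: fin_num_measure.
  move=> BN0.
  by apply/eqP; rewrite eq_le BN0 measure_ge0.
exists (fine \o f); split.
- apply/measurable_EFinP.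
  rewrite (_ : EFin \o _ = f); first by have /integrableP[] := fi.
  by apply/funext => x /=; rewrite fineK.
- by move=> z /=; exact: fine_ge0.
exists N => // B mB.
under eq_integral do rewrite /= fineK//.
rewrite -fE//= /mfrestr /mrestr -measureU//.
- by rewrite -setIUr setUCl setIT.
- by apply: measurableI => //; exact: measurableC.
- exact: measurableI.
- by rewrite setIACA setICl !setI0.
Qed.

(* A version of the density d mu / d m of the absolutely continuous part. *)
Definition ac_density : circle R -> R := sval (cid lebesgue_decomposition).

(* [lne] rather than [ln], since [ln 0 = 0] whereas [lne 0 = -oo]. *)
Definition log_density_integrable : Prop :=
  haar.-integrable setT (fun z => lne (ac_density z)%:E).

Definition supp : set (circle R) :=
  [set z | forall U : set (circle R), open U -> U z -> (0 < mu U)%E].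

End lebesgue_decomposition.

Section lincomb.
Context {R : realType} {X : Type}.
Implicit Type F : nat -> X -> R[i].

Definition lincomb F (c : nat -> R[i]) (n : nat) : X -> R[i] :=
  fun z => \sum_(k < n) c k * F k z.

Definition spanned_by F (n : nat) : set (X -> R[i]) :=
  [set f | exists c, f = lincomb F c n].

Definition span F : set (X -> R[i]) := \bigcup_n spanned_by F n.

End lincomb.

(* Elements of [L^2_mu] are handled through their representatives; the
   subspaces [rat_closure], [poly_closure] below are saturated for equality
   almost everywhere, so their equality is that of the subspaces of classes. *)
Section L2.
Context {R : realType} (mu : probability (circle R) R).
Implicit Types f g : circle R -> R[i].

Definition norm2sq f : \bar R := (\int[mu]_z (cabs (f z) ^+ 2)%:E)%E.

Definition L2 : set (circle R -> R[i]) :=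
  [set f | [/\ measurable_fun setT (fun z => Re (f z)),
               measurable_fun setT (fun z => Im (f z)) &
               (norm2sq f < +oo)%E]].

Definition integralC f : R[i] :=
  (\int[mu]_z Re (f z)) +i* (\int[mu]_z Im (f z)).

Definition inner f g : R[i] := integralC (fun z => (f z)^* * g z).

Definition L2closure (S : set (circle R -> R[i])) : set (circle R -> R[i]) :=
  [set f | L2 f /\ forall e : R, 0 < e ->
     exists2 g, S g & (norm2sq (fun z => f z - g z)%R < (e ^+ 2)%:E)%E].

Definition orthonormal (F : nat -> circle R -> R[i]) : Prop :=
  (forall n, L2 (F n)) /\ forall i j, inner (F i) (F j) = (i == j)%:R.

Definition orthonormal_basis (M : set (circle R -> R[i]))
    (F : nat -> circle R -> R[i]) : Prop :=
  orthonormal F /\ L2closure (span F) = M.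

(* [V] is the matrix of the restriction of [T] to the closed subspace [M] with
   respect to [F], which has to be an orthonormal basis of the whole of [M]. *)
Definition represents (T : (circle R -> R[i]) -> circle R -> R[i])
    (M : set (circle R -> R[i])) (F : nat -> circle R -> R[i])
    (V : nat -> nat -> R[i]) : Prop :=
  orthonormal_basis M F /\ forall i j, V i j = inner (F i) (T (F j)).

End L2.

Definition mulz (R : realType) (f : circle R -> R[i]) : circle R -> R[i] :=
  fun z => circle_val z * f z.

Definition on_circle (R : realType) (f : R[i] -> R[i]) : circle R -> R[i] :=
  fun z => f z.

(* The index 0 is part of the sequence; the convention [alpha 0 = 0] is not
   built into the definitions below. *)
Section orf.
Context {R : realType}.
Variable alpha : nat -> R[i].

Definition varpi n (z : R[i]) : R[i] := 1 - (alpha n)^* * z.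
Definition varpi_star n (z : R[i]) : R[i] := z - alpha n.
Definition zeta n z := varpi_star n z / varpi n z.
Definition blaschke n z := \prod_(1 <= k < n.+1) zeta k z.

Definition lower_star (f : R[i] -> R[i]) : R[i] -> R[i] :=
  fun z => (f (z^*)^-1)^*.

Definition upper_star n (f : R[i] -> R[i]) : R[i] -> R[i] :=
  fun z => blaschke n z * lower_star f z.

Definition orf_e (a : nat -> R[i]) n : R[i] :=
  sqrtC (varpi n (alpha n) / varpi n.-1 (alpha n.-1) * (1 - `|a n| ^+ 2)^-1).

(* The recurrence, an identity between rational functions, is required at the
   points of the circle only: there are infinitely many of them and they avoid
   all the poles, at which [x / 0 = 0] would break the identity. *)
Definition is_orf (mu : probability (circle R) R)
    (phi : nat -> R[i] -> R[i]) (a : nat -> R[i]) : Prop :=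
  [/\ phi 0 = (fun=> 1),
      forall n, spanned_by phi n.+1 = spanned_by blaschke n.+1,
      orthonormal mu (fun n => on_circle (phi n)),
      forall n, (0 < n)%N -> `|a n| < 1 &
      forall n (z : circle R), (0 < n)%N ->
        phi n z = orf_e a n * (varpi n.-1 z / varpi n z) *
          (zeta n.-1 z * phi n.-1 z + a n * upper_star n.-1 (phi n.-1) z) /\
        upper_star n (phi n) z = orf_e a n * (varpi n.-1 z / varpi n z) *
          ((a n)^* * (zeta n.-1 z * phi n.-1 z)
           + upper_star n.-1 (phi n.-1) z)].

Definition rat_closure (mu : probability (circle R) R) :=
  L2closure mu (span (fun n => on_circle (blaschke n))).

End orf.

Definition poly_closure (R : realType) (mu : probability (circle R) R) :=
  L2closure mu [set f | exists p : {poly R[i]}, f = on_circle (horner p)].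

(* Infinite matrices, and bounded ones as operators on l^2. *)
Section matrices.
Context {R : realType}.
Local Notation seqC := (nat -> R[i]).
Local Notation mxC := (nat -> nat -> R[i]).
Implicit Types A B T : mxC.

Definition l2seq (x : seqC) : Prop :=
  (\sum_(0 <= n <oo) (cabs (x n) ^+ 2)%:E < +oo)%E.

Definition seriesC (u : seqC) : R[i] :=
  limn (fun n => \sum_(0 <= k < n) Re (u k)) +i*
  limn (fun n => \sum_(0 <= k < n) Im (u k)).

Definition imx0 : mxC := fun _ _ => 0.
Definition imx1 : mxC := fun i j => (i == j)%:R.
Definition imxD A B : mxC := fun i j => A i j + B i j.
Definition imxB A B : mxC := fun i j => A i j - B i j.
Definition imxM A B : mxC := fun i j => seriesC (fun k => A i k * B k j).
Definition imx_adj A : mxC := fun i j => (A j i)^*.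
Definition imx_diag (d : seqC) : mxC := fun i j => if i == j then d i else 0.

(* [opnorm_le A c]: the matrix [A] defines, first on the finitely supported
   sequences and then by density on l^2, an operator of norm at most [c]. *)
Definition opnorm_le A (c : R) : Prop :=
  0 <= c /\ forall (n : nat) (x : seqC),
    (\sum_(0 <= i <oo) (cabs (\sum_(j < n) A i j * x j)%R ^+ 2)%:E
     <= (c ^+ 2 * \sum_(j < n) cabs (x j) ^+ 2)%:E)%E.

Definition bounded_imx A : Prop := exists c, opnorm_le A c.

(* The order of [R[i]] makes [0 <= w] mean that [w] is real and nonnegative. *)
Definition positive_imx A : Prop :=
  forall (n : nat) (x : seqC),
    0 <= \sum_(i < n) \sum_(j < n) (x i)^* * A i j * x j.

Definition isometric_imx A : Prop :=
  bounded_imx A /\ imxM (imx_adj A) A = imx1.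

Definition unitary_imx A : Prop :=
  [/\ bounded_imx A, imxM (imx_adj A) A = imx1 & imxM A (imx_adj A) = imx1].

(* Inverse and positive square root in the algebra of bounded operators on l^2,
   with the junk value 0 when they do not exist. *)
Definition imx_inv A : mxC :=
  xget imx0 [set B | [/\ bounded_imx B, imxM A B = imx1 & imxM B A = imx1]].

Definition imx_sqrt A : mxC :=
  xget imx0 [set B | [/\ bounded_imx B, positive_imx B & imxM B B = A]].

Definition eta A : mxC := imx_sqrt (imxB imx1 (imxM A (imx_adj A))).

(* The operators for which [moebius A T] is defined. *)
Definition moebius_dom A T : Prop :=
  (exists2 c, c < 1 & opnorm_le A c) /\ opnorm_le T 1.

Definition moebius A T : mxC :=
  imxM (imxM (imxM (imx_inv (eta A)) (imxD T A))
             (imx_inv (imxD imx1 (imxM (imx_adj A) T))))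
       (eta (imx_adj A)).

Definition rho (a : seqC) n : R[i] := sqrtC (1 - `|a n| ^+ 2).

(* Meant for sequences with the convention [a 0 = 1]. *)
Definition hessenberg (a : seqC) : mxC := fun k n =>
  if (k <= n)%N then
    - a n.+1 * (\prod_(k.+1 <= j < n.+1) rho a j) * (a k)^*
  else if k == n.+1 then rho a n.+1 else 0.

End matrices.

(* Main.v *)
Require Import Defs.
From mathcomp Require Import all_boot all_order all_algebra complex.
From mathcomp Require Import all_classical all_reals all_analysis.
From mathcomp Require Import measurable_realfun zify ring lra.
Set Implicit Arguments.
Unset Strict Implicit.
Unset Printing Implicit Defensive.
Import Order.TTheory GRing.Theory Num.Theory.
Import numFieldNormedType.Exports.
Local Open Scope classical_set_scope.
Local Open Scope ring_scope.
Local Open Scope complex_scope.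

Local Notation Re := complex.Re.
Local Notation Im := complex.Im.

(* Put [psi_n = varpi_n phi_n / eta_n] with [eta_n = sqrt (1 - |alpha_n|^2)]. The
   recurrence becomes [zeta_n psi_n = sum_k h_kn psi_k] on the circle; both sides being
   affine in [z] after multiplication by [varpi_n], the inner products with [phi_i] give
   [V0 eta^-1 (1 + A^* H) = eta^-1 (H + A)] for the matrix [V0] of the multiplication by
   [z] in the basis [phi_n]. As [1 + A^* H] is invertible, [V0] is the operator Moebius
   transform of [H].

   [L = P]: a geometric series approximates [1 / varpi_n] uniformly by polynomials, and
   [z B_n] is, up to an error [r^N], a combination of [B_n, ..., B_(n+N)].

   [V0] is isometric by Parseval, and it is coisometric if and only if [conj z] lies in
   [L = P], that is if [P = L^2]. A vector [y] annihilated by [V0^*] yields [x = eta^-1 y]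
   with [H^* x = - A^* x]. When [a] is not in [l^2], [H^*] is isometric, so that [x = 0];
   when [a] is in [l^2], the kernel of [H^*] is not trivial, and [V0^*] cannot be isometric.

   For Szego's theorem, suppose [d <= int |q|^2 g dnu] for all polynomials [q] with
   [q 0 = 1]. Then [d e^(int v dm) <= int g e^v dnu] for all bounded measurable [v]: for
   [v = Re A] take [q] close to [e^(A/2)], and extend by bounded pointwise limits. With
   [nu = m], [g = |p|^2], [v = log w], this bounds the distance from [conj z] to [P] from
   below when [log w] is integrable; with [nu = mu], [g = 1], [v = - log w] off a null set,
   it bounds [- int log w] when this distance is positive. *)

(** [imx_inv] and [imx_sqrt] are choices, so evaluating [moebius] amounts to uniqueness statements,
    for inverses and for positive square roots of diagonal matrices. In infinite dimension a left
    inverse need not be two-sided: the inverse of [1 + A^* H] read off from [V0] becomes a right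
    inverse through its injectivity.

    Everything concerning [P = L^2] is tested on the single function [conj z]: its distance to [P]
    is the infimum of [|q|] in [L^2] over the polynomials with [q 0 = 1], because
    [|1 - z q| = |conj z - q|] on the circle. Unitarity and Szego's condition both meet there, so
    that the product formula relating the [rho_n] to [int log w] is bypassed.

    In Szego's theorem [v] has to be bounded for limits to pass, whereas [log w] is unbounded or
    infinite; hence the truncations of [w]. The singular part is harmless because [v] may be altered
    on an [m]-null set without changing [int v dm]. The inequality is not linear in [v], which is
    why the extension from trigonometric polynomials uses bounded pointwise limits alone. *)

Section complex_facts.
Context {R : realType}.
Implicit Types z w : R[i].

Lemma ReCD z w : Re (z + w) = Re z + Re w.
Proof. by case: z w => [a b] [c d]. Qed.

Lemma ImCD z w : Im (z + w) = Im z + Im w.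
Proof. by case: z w => [a b] [c d]. Qed.

Lemma ReCN z : Re (- z) = - Re z.
Proof. by case: z. Qed.

Lemma ImCN z : Im (- z) = - Im z.
Proof. by case: z. Qed.

Lemma ReCM z w : Re (z * w) = Re z * Re w - Im z * Im w.
Proof. by case: z w => [a b] [c d]. Qed.

Lemma ImCM z w : Im (z * w) = Re z * Im w + Im z * Re w.
Proof. by case: z w => [a b] [c d]. Qed.

Lemma ReCJ z : Re z^*%C = Re z.
Proof. by case: z. Qed.

Lemma ImCJ z : Im z^*%C = - Im z.
Proof. by case: z. Qed.

(* [^*] is [Num.conj] or [conjc] depending on the scope it is parsed in. *)
Lemma conjCE z : Num.conj z = z^*%C.
Proof. by []. Qed.

Lemma Re_sum (I : Type) (r : seq I) (P : pred I) (F : I -> R[i]) :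
  Re (\sum_(i <- r | P i) F i) = \sum_(i <- r | P i) Re (F i).
Proof. exact: (big_morph _ ReCD). Qed.

Lemma Im_sum (I : Type) (r : seq I) (P : pred I) (F : I -> R[i]) :
  Im (\sum_(i <- r | P i) F i) = \sum_(i <- r | P i) Im (F i).
Proof. exact: (big_morph _ ImCD). Qed.

Lemma ext_complex z w : Re z = Re w -> Im z = Im w -> z = w.
Proof. by case: z w => [a b] [c d] /= -> ->. Qed.

Lemma cabs_ge0 z : 0 <= cabs z.
Proof. by case: z => a b; exact: sqrtr_ge0. Qed.

Lemma cabs2 z : cabs z ^+ 2 = Re z ^+ 2 + Im z ^+ 2.
Proof. by case: z => a b; rewrite sqr_sqrtr// addr_ge0// sqr_ge0. Qed.

Lemma cabsE z : (cabs z)%:C = `|z|.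
Proof. by case: z. Qed.

Lemma cabs2C z : (cabs z ^+ 2)%:C = z^*%C * z.
Proof. by apply: ext_complex; rewrite ?ReCM ?ImCM ?ReCJ ?ImCJ /= ?cabs2; ring. Qed.

Lemma cabsM z w : cabs (z * w) = cabs z * cabs w.
Proof. exact: Normc.normcM. Qed.

Lemma cabs0 : cabs (0 : R[i]) = 0. Proof. exact: Normc.normc0. Qed.
Lemma cabs1 : cabs (1 : R[i]) = 1. Proof. exact: Normc.normc1. Qed.

Lemma cabs_eq0 z : cabs z = 0 -> z = 0.
Proof. exact: Normc.eq0_normc. Qed.

Lemma cabsN z : cabs (- z) = cabs z.
Proof. exact: (normcN (z : Rcomplex R)). Qed.

Lemma cabsB z w : cabs (z - w) = cabs (w - z).
Proof. by rewrite -cabsN opprB. Qed.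

Lemma cabsV z : cabs z^-1 = (cabs z)^-1.
Proof. exact: Normc.normcV. Qed.

Lemma cabsJ z : cabs z^*%C = cabs z.
Proof.
by apply/eqP; rewrite -(eqrXn2 (n := 2)) ?cabs_ge0// !cabs2 ReCJ ImCJ sqrrN.
Qed.

Lemma cabsX z n : cabs (z ^+ n) = cabs z ^+ n.
Proof. by elim: n => [|n IH]; rewrite ?cabs1 // !exprS cabsM IH. Qed.

Lemma cabsR (x : R) : cabs x%:C = `|x|.
Proof. by rewrite /ComplexField.Normc.normc /= expr0n addr0 sqrtr_sqr. Qed.

Lemma cabsD z w : cabs (z + w) <= cabs z + cabs w.
Proof. exact: (le_normcD (z : Rcomplex R) w). Qed.

Lemma cabs_dist z w : `|cabs z - cabs w| <= cabs (z - w).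
Proof.
rewrite ler_norml; apply/andP; split.
- by rewrite lerNl opprB lerBlDl -{1}(subrK z w) addrC (le_trans (cabsD _ _))// cabsB.
- by rewrite lerBlDl -{1}(subrK w z) addrC (le_trans (cabsD _ _)).
Qed.

Lemma Re_le_cabs z : `|Re z| <= cabs z.
Proof.
rewrite -(ler_pXn2r (n := 2)) ?nnegrE ?cabs_ge0//.
by rewrite cabs2 real_normK ?num_real// lerDl sqr_ge0.
Qed.

Lemma Im_le_cabs z : `|Im z| <= cabs z.
Proof.
rewrite -(ler_pXn2r (n := 2)) ?nnegrE ?cabs_ge0//.
by rewrite cabs2 real_normK ?num_real// lerDr sqr_ge0.
Qed.

Lemma cabs_le_ReIm z : cabs z <= `|Re z| + `|Im z|.
Proof.
rewrite -(ler_pXn2r (n := 2)) ?nnegrE ?cabs_ge0 ?addr_ge0//.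
rewrite cabs2 sqrrD !real_normK ?num_real//.
have : 0 <= `|Re z| * `|Im z| by rewrite mulr_ge0.
by lra.
Qed.

Lemma cabs2D z w : cabs (z + w) ^+ 2 <= 2 * (cabs z ^+ 2 + cabs w ^+ 2).
Proof.
rewrite !cabs2 ReCD ImCD.
have : 0 <= (Re z - Re w) ^+ 2 + (Im z - Im w) ^+ 2 by rewrite addr_ge0 ?sqr_ge0.
by lra.
Qed.

Lemma ler_cabs_sqr z (M : R) : 0 <= M -> (cabs z <= M) = (cabs z ^+ 2 <= M ^+ 2).
Proof. by move=> M0; rewrite ler_pXn2r// nnegrE cabs_ge0. Qed.

(** Stated through the real number [cabs (u n - s)], so that squeezing and comparison take place in
    [R]. *)
Definition cvgC (u : nat -> R[i]) (s : R[i]) : Prop :=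
  cabs (u n - s) @[n --> \oo] --> (0 : R).

Lemma cvgC_Re u s : cvgC u s -> Re (u n) @[n --> \oo] --> Re s.
Proof.
move=> us; apply/cvgrPdist_le => e e0.
move/cvgrPdist_le : us => /(_ _ e0); apply: filterS => n.
rewrite sub0r normrN ger0_norm ?cabs_ge0//; apply: le_trans.
by rewrite cabsB -ReCN -ReCD Re_le_cabs.
Qed.

Lemma cvgC_Im u s : cvgC u s -> Im (u n) @[n --> \oo] --> Im s.
Proof.
move=> us; apply/cvgrPdist_le => e e0.
move/cvgrPdist_le : us => /(_ _ e0); apply: filterS => n.
rewrite sub0r normrN ger0_norm ?cabs_ge0//; apply: le_trans.
by rewrite cabsB -ImCN -ImCD Im_le_cabs.
Qed.

Lemma cvgC_ReIm u s : Re (u n) @[n --> \oo] --> Re s ->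
  Im (u n) @[n --> \oo] --> Im s -> cvgC u s.
Proof.
move=> ur ui; apply: (@squeeze_cvgr _ _ _ _ (fun=> 0)
  (fun n => `|Re (u n) - Re s| + `|Im (u n) - Im s|)).
- by apply: nearW => n; rewrite cabs_ge0 -!ReCN -!ImCN -ReCD -ImCD cabs_le_ReIm.
- exact: cvg_cst.
- rewrite -[X in _ --> X]addr0; apply: cvgD.
  + by rewrite -(normr0 R); apply: cvg_norm; rewrite -(subrr (Re s)); apply: cvgB => //; exact: cvg_cst.
  + by rewrite -(normr0 R); apply: cvg_norm; rewrite -(subrr (Im s)); apply: cvgB => //; exact: cvg_cst.
Qed.

Lemma cvgC_unique u s t : cvgC u s -> cvgC u t -> s = t.
Proof.
move=> us ut; apply: ext_complex.
- exact: (cvg_unique _ (cvgC_Re us) (cvgC_Re ut)).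
- exact: (cvg_unique _ (cvgC_Im us) (cvgC_Im ut)).
Qed.

Lemma cvgC_cst s : cvgC (fun=> s) s.
Proof. by rewrite /cvgC subrr cabs0; exact: cvg_cst. Qed.

Lemma cvgCD u v s t : cvgC u s -> cvgC v t -> cvgC (fun n => u n + v n) (s + t).
Proof.
move=> us vt; apply: (@squeeze_cvgr _ _ _ _ (fun=> 0)
  (fun n => cabs (u n - s) + cabs (v n - t))).
- by apply: nearW => n; rewrite cabs_ge0 opprD addrACA cabsD.
- exact: cvg_cst.
- by rewrite -[X in _ --> X]addr0; exact: cvgD.
Qed.

End complex_facts.

Arguments ComplexField.Normc.normc : simpl never.

(** * Bounded matrices on l^2 *)

Section square_summable.
Context {R : realType}.
Local Notation seqC := (nat -> R[i]).
Local Notation mxC := (nat -> nat -> R[i]).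
Implicit Types (x y : seqC) (A B : mxC) (M c : R).

(** A bound on all partial sums rather than on the value of a series: truncations and entrywise
    limits inherit the same [M]. *)
Definition l2le x M : Prop := forall n, \sum_(k < n) cabs (x k) ^+ 2 <= M.

Definition ell2 x : Prop := exists M, l2le x M.

Definition hsum (u : seqC) (s : R[i]) : Prop :=
  cvgC (fun n => \sum_(k < n) u k) s.

(** [opnorm_le] with the outer series replaced by its partial sums ([opnorm_leP]): only finite real
    sums occur. *)
Definition opb A c : Prop := 0 <= c /\ forall m n x,
  \sum_(i < m) cabs (\sum_(j < n) A i j * x j) ^+ 2 <=
  c ^+ 2 * \sum_(j < n) cabs (x j) ^+ 2.

Lemma sum_cabs2_ge0 n x : 0 <= \sum_(k < n) cabs (x k) ^+ 2.
Proof. by apply: sumr_ge0 => i _; exact: sqr_ge0. Qed.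

Lemma l2le_ge0 x M : l2le x M -> 0 <= M.
Proof. by move/(_ 0); rewrite big_ord0. Qed.

Lemma sum_cabs2_mono x m n : (m <= n)%N ->
  \sum_(k < m) cabs (x k) ^+ 2 <= \sum_(k < n) cabs (x k) ^+ 2.
Proof.
move=> mn; rewrite -(subnKC mn) big_split_ord /= lerDl.
by apply: sumr_ge0 => i _; exact: sqr_ge0.
Qed.

Lemma bigC_conj (I : Type) (r : seq I) (P : pred I) (F : I -> R[i]) :
  (\sum_(i <- r | P i) F i)^*%C = \sum_(i <- r | P i) (F i)^*%C.
Proof. exact: rmorph_sum. Qed.

Lemma conjM (u v : R[i]) : (u * v)^*%C = u^*%C * v^*%C.
Proof. exact: rmorphM. Qed.

Lemma conjD (u v : R[i]) : (u + v)^*%C = u^*%C + v^*%C.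
Proof. exact: rmorphD. Qed.

Lemma conjN (u : R[i]) : (- u)^*%C = - u^*%C.
Proof. exact: rmorphN. Qed.

Lemma conjB (u v : R[i]) : (u - v)^*%C = u^*%C - v^*%C.
Proof. exact: rmorphB. Qed.

Lemma quad_disc (a b c : R) : 0 <= a -> 0 <= c ->
  (forall t : R, 0 <= t ^+ 2 * a - 2 * t * b + c) -> b ^+ 2 <= a * c.
Proof.
move=> a0 c0 H; have [a_eq0|aneq0] := eqVneq a 0.
  have [->|b0] := eqVneq b 0; first by rewrite expr0n /= mulr_ge0.
  (* For [a = 0] the form is affine in [t], and at this point it would equal -1. *)
  have := H ((c + 1) / (2 * b)).
  rewrite a_eq0 mulr0 add0r.
  have -> : 2 * ((c + 1) / (2 * b)) * b = c + 1.
    by field; rewrite b0.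
  by lra.
have ap : 0 < a by rewrite lt_neqAle eq_sym aneq0.
have := H (b / a).
have -> : (b / a) ^+ 2 * a - 2 * (b / a) * b + c = (a * c - b ^+ 2) / a.
  by field; rewrite aneq0.
by rewrite pmulr_lge0 ?invr_gt0// subr_ge0.
Qed.

(** The sum of the [|t x_k - u conj(y_k)|^2] is a nonnegative quadratic in the real [t]; the phase
    [u] of the sum [s] makes its middle coefficient [|s|]. The product is bilinear, whence the
    conjugate on [y]. *)
Lemma CauchySchwarz_sum n x y :
  cabs (\sum_(k < n) x k * y k) ^+ 2 <=
  (\sum_(k < n) cabs (x k) ^+ 2) * (\sum_(k < n) cabs (y k) ^+ 2).
Proof.
set s := \sum_(k < n) x k * y k.
have [->|s0] := eqVneq s 0.
  by rewrite cabs0 expr0n mulr_ge0 ?sum_cabs2_ge0.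
apply: quad_disc; rewrite ?sum_cabs2_ge0// => t.
pose u := s / (cabs s)%:C.
have cs0 : cabs s != 0 by apply: contra_neq s0; exact: cabs_eq0.
have u1 : cabs u = 1.
  by rewrite cabsM cabsV cabsR ger0_norm ?cabs_ge0// divff.
have ssu : s * u^*%C = (cabs s)%:C.
  have : s = (cabs s)%:C * u.
    by rewrite /u mulrCA divff ?mulr1// fmorph_eq0.
  move=> {1}->; rewrite -mulrA [u * _]mulrC -cabs2C u1 expr1n mulr1 //.
clearbody u; suff -> : t ^+ 2 * \sum_(k < n) cabs (x k) ^+ 2 - 2 * t * cabs s +
    \sum_(k < n) cabs (y k) ^+ 2 =
  \sum_(k < n) cabs (t%:C * (x k) - (u * (y k)^*%C)) ^+ 2.
  by apply: sumr_ge0 => i _; exact: sqr_ge0.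
have -> : cabs s = \sum_(k < n) Re (x k * y k * u^*%C).
  by rewrite -Re_sum -mulr_suml -/s ssu.
rewrite !mulr_sumr -sumrB -big_split /=; apply: eq_bigr => k _.
have u1' : Re u ^+ 2 + Im u ^+ 2 = 1 by rewrite -cabs2 u1 expr1n.
rewrite !cabs2 !(ReCD,ImCD,ReCN,ImCN) !ReCM !ImCM !(ReCJ,ImCJ) /=.
move: (Re (x k)) (Im (x k)) (Re (y k)) (Im (y k)) (Re u) (Im u) u1' => a b c d e f ef.
have -> : c ^+ 2 + d ^+ 2 = (e ^+ 2 + f ^+ 2) * (c ^+ 2 + d ^+ 2) by rewrite ef mul1r.
ring.
Qed.

Lemma tail_sum_cvg x M : l2le x M ->
  forall e : R, 0 < e -> exists N, forall n,
    \sum_(k < n) cabs (if (k < N)%N then 0 else x k) ^+ 2 <= e.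
Proof.
move=> xM e e0.
pose S := [set \sum_(k < n) cabs (x k) ^+ 2 | n in setT].
have hS : has_sup S.
  split; first by exists (\sum_(k < 0) cabs (x k) ^+ 2), 0.
  by exists M => _ [n _ <-].
have [_ [N _ <-] hN] := sup_adherent e0 hS.
exists N => n.
have [nN|Nn] := leqP n N.
  rewrite big1 ?ltW// => k _.
  by rewrite (leq_trans (ltn_ord k) nN) cabs0 expr0n.
rewrite -(subnKC (ltnW Nn)) big_split_ord /= big1 ?add0r; last first.
  by move=> k _; rewrite ltn_ord cabs0 expr0n.
have : \sum_(k < n) cabs (x k) ^+ 2 <= sup S by apply: ub_le_sup; [case: hS|exists n].
have -> : \sum_(k < n) cabs (x k) ^+ 2 = \sum_(k < N + (n - N)) cabs (x k) ^+ 2 by rewrite subnKC// ltnW.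
rewrite big_split_ord /= => H.
under eq_bigr do rewrite ltnNge leq_addr /=.
by move: H hN; lra.
Qed.

Lemma hsum_unique (u : seqC) s t : hsum u s -> hsum u t -> s = t.
Proof. exact: cvgC_unique. Qed.

Lemma seriesC_hsum (u : seqC) s : hsum u s -> seriesC u = s.
Proof.
move=> us; rewrite /seriesC; apply: ext_complex => /=.
- apply/cvg_lim => //; have := cvgC_Re us.
  by under eq_fun do rewrite Re_sum -(big_mkord xpredT (fun k => Re (u k))).
- apply/cvg_lim => //; have := cvgC_Im us.
  by under eq_fun do rewrite Im_sum -(big_mkord xpredT (fun k => Im (u k))).
Qed.

Lemma cvg_series_l2 (a : nat -> R) (M : R) :
  (forall n, \sum_(k < n) `|a k| <= M) ->
  exists s : R, (\sum_(k < n) a k) @[n --> \oo] --> s.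
Proof.
move=> aM.
have : cvgn (series a).
  apply: normed_cvg; apply: nondecreasing_is_cvgn.
  - by apply: nondecreasing_series => n _ _; exact: normr_ge0.
  - by exists M => _ [n _ <-]; have := aM n; rewrite -(big_mkord xpredT (fun k => `|a k|)).
move=> /cvg_ex[/= s as_]; exists s.
rewrite (_ : (fun n => _) = series a)//.
by apply/funext => n; rewrite /series /= big_mkord.
Qed.

Lemma hsumM x y Mx My : l2le x Mx -> l2le y My ->
  exists s, hsum (fun k => x k * y k) s.
Proof.
move=> xM yM.
have B n : \sum_(k < n) cabs (x k * y k) <= Mx + My.
  apply: (@le_trans _ _ (\sum_(k < n) (cabs (x k) ^+ 2 + cabs (y k) ^+ 2))).
    apply: ler_sum => k _; rewrite cabsM.
    have := sqr_ge0 (cabs (x k) - cabs (y k)).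
    have := mulr_ge0 (cabs_ge0 (x k)) (cabs_ge0 (y k)).
    rewrite sqrrB; lra.
  by rewrite big_split /=; apply: lerD; [exact: xM|exact: yM].
have [|r hr] := @cvg_series_l2 (fun k => Re (x k * y k)) (Mx + My).
  by move=> n; apply: le_trans (B n); apply: ler_sum => k _; exact: Re_le_cabs.
have [|i hi] := @cvg_series_l2 (fun k => Im (x k * y k)) (Mx + My).
  by move=> n; apply: le_trans (B n); apply: ler_sum => k _; exact: Im_le_cabs.
exists (r +i* i); apply: cvgC_ReIm => /=.
- by under eq_fun do rewrite Re_sum.
- by under eq_fun do rewrite Im_sum.
Qed.

Lemma cvgC_cabs (u : nat -> R[i]) s :
  cvgC u s -> cabs (u n) @[n --> \oo] --> cabs s.
Proof.
move=> us; apply/cvgrPdist_le => e e0.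
move/cvgrPdist_le : us => /(_ _ e0); apply: filterS => n.
rewrite sub0r normrN ger0_norm ?cabs_ge0//; apply: le_trans.
by rewrite distrC cabs_dist.
Qed.

Lemma cvgC_shift_le (u : nat -> R[i]) s (M : R) : cvgC u s ->
  (forall n, cabs (u n) ^+ 2 <= M) -> cabs s ^+ 2 <= M.
Proof.
move=> us uM.
have h : (cabs (u n) ^+ 2) @[n --> \oo] --> cabs s ^+ 2.
  have := cvgC_cabs us; move=> h; under eq_fun do rewrite expr2.
  by rewrite expr2; exact: cvgM.
by apply: (ler_cvg_to h (@cvg_cst _ M _ _ _)); exact: nearW.
Qed.

Lemma hsumD (u v : seqC) s t :
  hsum u s -> hsum v t -> hsum (fun k => u k + v k) (s + t).
Proof.
move=> us vt; rewrite /hsum.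
under [X in cvgC X]eq_fun do rewrite big_split /=.
exact: cvgCD.
Qed.

Lemma cvgCZ (c : R[i]) u s : cvgC u s -> cvgC (fun n => c * u n) (c * s).
Proof.
move=> us; rewrite /cvgC.
under eq_fun do rewrite -mulrBr cabsM.
have -> : 0 = cabs c * 0 by rewrite mulr0.
by apply: cvgM => //; exact: cvg_cst.
Qed.

Lemma hsumZ (c : R[i]) (u : seqC) s : hsum u s -> hsum (fun k => c * u k) (c * s).
Proof.
move=> us; rewrite /hsum.
under [X in cvgC X]eq_fun do rewrite -mulr_sumr.
exact: cvgCZ.
Qed.

Lemma hsumB (u v : seqC) s t :
  hsum u s -> hsum v t -> hsum (fun k => u k - v k) (s - t).
Proof.
move=> us vt; rewrite -mulN1r.
have -> : (fun k => u k - v k) = (fun k => u k + (-1) * v k).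
  by apply/funext => k; rewrite mulN1r.
by apply: hsumD => //; exact: hsumZ.
Qed.

Lemma hsum_fin (u : seqC) N : (forall k, (N <= k)%N -> u k = 0) ->
  hsum u (\sum_(k < N) u k).
Proof.
move=> uN; apply: cvg_near_cst; exists N => // n /= Nn.
rewrite -(subnKC Nn) big_split_ord /= [X in _ + X - _]big1 ?addr0 ?subrr ?cabs0//.
by move=> k _; rewrite uN ?leq_addr.
Qed.

Lemma hsum_sum (N : nat) (F : nat -> seqC) (s : seqC) :
  (forall k, hsum (F k) (s k)) ->
  hsum (fun i => \sum_(k < N) F k i) (\sum_(k < N) s k).
Proof.
move=> Fs; elim: N => [|N IH].
  rewrite big_ord0; under [X in hsum X]eq_fun do rewrite big_ord0.
  by have := @hsum_fin (fun=> 0) 0 (fun _ _ => erefl); rewrite big_ord0.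
rewrite big_ord_recr /=; under [X in hsum X]eq_fun do rewrite big_ord_recr /=.
by have := hsumD IH (Fs N).
Qed.


Lemma mul_if_l2 N x n : \sum_(k < n) cabs (if (k < N)%N then x k else 0) ^+ 2
  <= \sum_(k < n) cabs (x k) ^+ 2.
Proof.
by apply: ler_sum => k _; case: ifP => // _; rewrite cabs0 expr0n sqr_ge0.
Qed.

Lemma sum_trunc_le x m n :
  \sum_(k < m) cabs (if (k < n)%N then x k else 0) ^+ 2 <=
  \sum_(k < n) cabs (x k) ^+ 2.
Proof.
have [mn|nm] := leqP m n.
  apply: le_trans (mul_if_l2 _ _ _) _; exact: sum_cabs2_mono.
rewrite -(subnKC (ltnW nm)) big_split_ord /= [X in _ + X]big1 ?addr0.
  by apply: ler_sum => l _; rewrite ltn_ord.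
by move=> l _; rewrite ltnNge leq_addr cabs0 expr0n.
Qed.

(** Duality: with [z = A^* y] and [S = |z|^2], one has [S = <y, A z>], hence [S^2 <= |y|^2 c^2 S],
    and [S] is divided out. *)
Lemma opb_adj A c : opb A c -> opb (imx_adj A) c.
Proof.
move=> [c0 Ac]; split=> // m n y.
pose z k := \sum_(j < n) imx_adj A k j * y j.
set S := \sum_(i < m) _.
have SE : S = \sum_(i < m) cabs (z i) ^+ 2 by [].
have : S ^+ 2 <= (\sum_(j < n) cabs (y j) ^+ 2) * (c ^+ 2 * S).
  have HS : S = cabs (\sum_(j < n) (y j)^*%C * (\sum_(i < m) A j i * z i)).
    rewrite (_ : \sum_(j < n) _ = S%:C).
      by rewrite cabsR ger0_norm// SE sum_cabs2_ge0.
    rewrite SE rmorph_sum /=.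
    under eq_bigr do rewrite mulr_sumr.
    rewrite exchange_big /=; apply: eq_bigr => i _.
    have zJ : (z i)^*%C = \sum_(j < n) A j i * (y j)^*%C.
      rewrite /z bigC_conj; apply: eq_bigr => j _.
      by rewrite conjM /imx_adj conjcK.
    rewrite cabs2C zJ mulr_suml; apply: eq_bigr => j _.
    by rewrite mulrCA mulrA.
  rewrite {1}HS; apply: le_trans (CauchySchwarz_sum n (fun j => (y j)^*%C) (fun j => \sum_(i < m) A j i * z i)) _.
  under eq_bigr do rewrite cabsJ.
  apply: ler_wpM2l; first exact: sum_cabs2_ge0.
  by rewrite SE; exact: Ac.
have S0 : 0 <= S by rewrite SE; exact: sum_cabs2_ge0.
have [->|Sn0] := eqVneq S 0.
  by move=> _; rewrite mulr_ge0 ?sqr_ge0 ?sum_cabs2_ge0.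
have Sp : 0 < S by rewrite lt_neqAle eq_sym Sn0.
rewrite expr2 mulrA ler_pM2r// => /le_trans; apply.
by rewrite mulrC.
Qed.

Lemma col_l2 A c j : opb A c -> l2le (A ^~ j) (c ^+ 2).
Proof.
move=> [c0 Ac] m; have := Ac m j.+1 (fun k => (k == j)%:R).
have E (f : nat -> R[i]) : \sum_(k < j.+1) f k * (val k == j)%:R = f j.
  rewrite big_ord_recr /= eqxx mulr1 big1 ?add0r// => k _.
  by rewrite (ltn_eqF (ltn_ord k)) mulr0.
under eq_bigr do rewrite E.
rewrite [X in _ * X]big_ord_recr /= [X in X + _]big1 => [|k _].
  by rewrite add0r eqxx cabs1 expr1n mulr1.
by rewrite (ltn_eqF (ltn_ord k)) cabs0 expr0n.
Qed.

Lemma row_l2 A c i : opb A c -> l2le (A i) (c ^+ 2).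
Proof.
move=> /opb_adj/(@col_l2 _ _ i) h n; have := h n.
by under eq_bigr do rewrite cabsJ.
Qed.

Definition mulv A x : seqC := fun i => seriesC (fun k => A i k * x k).

Lemma mulvE A c x M i : opb A c -> l2le x M ->
  hsum (fun k => A i k * x k) (mulv A x i).
Proof.
move=> Ac xM; have [s hs] := hsumM (row_l2 i Ac) xM.
by rewrite /mulv (seriesC_hsum hs).
Qed.

Lemma mulv_eq A x i s : hsum (fun k => A i k * x k) s -> mulv A x i = s.
Proof. exact: seriesC_hsum. Qed.

Lemma cvg_sum_cabs2 (m : nat) (u : nat -> seqC) (s : seqC) (M : R) :
  (forall i, cvgC (fun n => u n i) (s i)) ->
  (forall n, \sum_(i < m) cabs (u n i) ^+ 2 <= M) ->
  \sum_(i < m) cabs (s i) ^+ 2 <= M.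
Proof.
move=> us uM.
have h : (\sum_(i < m) cabs (u n i) ^+ 2) @[n --> \oo] -->
    (\sum_(i < m) cabs (s i) ^+ 2 : R).
  elim: (m) => [|k IH].
    rewrite big_ord0; under eq_fun do rewrite big_ord0; exact: cvg_cst.
  rewrite big_ord_recr /=; under eq_fun do rewrite big_ord_recr /=.
  apply: cvgD => //; have h := cvgC_cabs (us k).
  by under eq_fun do rewrite expr2; rewrite expr2; exact: cvgM.
by apply: (ler_cvg_to h (@cvg_cst _ M _ _ _)); exact: nearW.
Qed.

(** The truncated products satisfy the bound uniformly and converge entrywise; finite sums of
    squares pass to the limit. *)
Lemma mulv_l2 A c x M : opb A c -> l2le x M -> l2le (mulv A x) (c ^+ 2 * M).
Proof.
move=> Ac xM m.
apply: (@cvg_sum_cabs2 m (fun n i => \sum_(k < n) A i k * x k)).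
- by move=> i; exact: (mulvE i Ac xM).
- move=> n; case: Ac => c0 Ac; apply: le_trans (Ac m n x) _.
  by apply: ler_wpM2l; rewrite ?sqr_ge0//; exact: xM.
Qed.

Lemma l2leB x y Mx My : l2le x Mx -> l2le y My ->
  l2le (fun k => x k - y k) (2 * (Mx + My)).
Proof.
move=> xM yM n; apply: (@le_trans _ _ (\sum_(k < n) 2 * (cabs (x k) ^+ 2 + cabs (y k) ^+ 2))).
  by apply: ler_sum => k _; rewrite -(cabsN (y k)) cabs2D.
by rewrite -mulr_sumr big_split /= ler_pM2l//; apply: lerD; [exact: xM|exact: yM].
Qed.

Lemma mulvB A c x y Mx My i : opb A c -> l2le x Mx -> l2le y My ->
  mulv A (fun k => x k - y k) i = mulv A x i - mulv A y i.
Proof.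
move=> Ac xM yM; apply: mulv_eq.
have := hsumB (mulvE i Ac xM) (mulvE i Ac yM).
by under [X in hsum X]eq_fun do rewrite -mulrBr.
Qed.

Lemma l2le_trunc x M N : l2le x M ->
  l2le (fun k => if (k < N)%N then x k else 0) M.
Proof. by move=> xM n; apply: le_trans (mul_if_l2 _ _ _) _. Qed.

Lemma mulv_trunc A x N i :
  mulv A (fun k => if (k < N)%N then x k else 0) i = \sum_(k < N) A i k * x k.
Proof.
apply: mulv_eq.
have := @hsum_fin (fun k => A i k * (if (k < N)%N then x k else 0)) N.
rewrite (eq_bigr (fun k : 'I_N => A i k * x k)); last by move=> k _; rewrite ltn_ord.
by apply=> k Nk; rewrite ltnNge Nk mulr0.
Qed.

Lemma imxME A B i j : imxM A B i j = mulv A (B ^~ j) i.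
Proof. by []. Qed.

(** On truncated vectors associativity only exchanges a series with a finite sum; [mulvA] extends it
    by density. *)
Lemma mulv_sum_trunc A B cA cB x N i : opb A cA -> opb B cB ->
  \sum_(k < N) imxM A B i k * x k =
  mulv A (mulv B (fun k => if (k < N)%N then x k else 0)) i.
Proof.
move=> Aa Bb; apply/esym/mulv_eq.
under [X in hsum X]eq_fun do rewrite mulv_trunc mulr_sumr.
apply: (@hsum_sum N (fun k i0 => A i i0 * (B i0 k * x k))
  (fun k => imxM A B i k * x k)) => k.
under [X in hsum X]eq_fun do rewrite mulrA mulrC.
by rewrite mulrC; exact: (hsumZ _ (mulvE i Aa (col_l2 k Bb))).
Qed.

(** The partial sum is [A (B x_n)] for the truncation [x_n] of [x], so the error is an entry of
    [A (B (x - x_n))], controlled by the tail of [x]. *)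
Lemma mulvA A B cA cB x M i : opb A cA -> opb B cB -> l2le x M ->
  hsum (fun k => imxM A B i k * x k) (mulv A (mulv B x) i).
Proof.
move=> Aa Bb xM; apply/cvgrPdist_le => e e0.
pose d := e ^+ 2 / (cA ^+ 2 * cB ^+ 2 + 1).
have cc0 : 0 <= cA ^+ 2 * cB ^+ 2 by rewrite mulr_ge0 ?sqr_ge0.
have d0 : 0 < d by rewrite divr_gt0 ?exprn_gt0// ltr_wpDl.
have [N hN] := tail_sum_cvg xM d0.
exists N => // n /= Nn.
rewrite sub0r normrN ger0_norm ?cabs_ge0// (mulv_sum_trunc _ _ _ Aa Bb).
have xt := l2le_trunc n xM.
rewrite cabsB -(mulvB _ Aa (mulv_l2 Bb xM) (mulv_l2 Bb xt)).
rewrite (_ : (fun k => _) =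
    mulv B (fun k => x k - (if (k < n)%N then x k else 0))); last first.
  by apply/funext => k; rewrite (mulvB _ Bb xM xt).
rewrite ler_cabs_sqr ?(ltW e0)//.
have tl : l2le (fun k => x k - (if (k < n)%N then x k else 0)) d.
  move=> m; apply: le_trans (hN m); apply: ler_sum => k _.
  have [kN|Nk] := ltnP k N; first by rewrite (leq_trans kN Nn) subrr.
  by case: ifP => _; rewrite ?subr0// subrr cabs0 expr0n sqr_ge0.
have := mulv_l2 Aa (mulv_l2 Bb tl) i.+1.
rewrite big_ord_recr /= => h.
have {h} : cabs (mulv A (mulv B (fun k => x k - (if (k < n)%N then x k else 0))) i) ^+ 2
   <= cA ^+ 2 * (cB ^+ 2 * d).
  apply: le_trans h; rewrite lerDr.
  by apply: sumr_ge0 => ? _; exact: sqr_ge0.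
move/le_trans; apply.
rewrite mulrA /d mulrCA ler_piMr ?sqr_ge0// ler_pdivrMr ?mul1r ?lerDl//.
by rewrite ltr_wpDl.
Qed.

Lemma mulv_imxM A B cA cB x M : opb A cA -> opb B cB -> l2le x M ->
  mulv (imxM A B) x = mulv A (mulv B x).
Proof.
by move=> Aa Bb xM; apply/funext => i; apply: mulv_eq; exact: mulvA Aa Bb xM.
Qed.

Lemma opbM A B cA cB : opb A cA -> opb B cB -> opb (imxM A B) (cA * cB).
Proof.
move=> Aa Bb; split; first by rewrite mulr_ge0 //; [case: Aa|case: Bb].
move=> m n x.
under eq_bigr do rewrite (mulv_sum_trunc _ _ _ Aa Bb).
rewrite exprMn -mulrA; apply: (mulv_l2 Aa); apply: (mulv_l2 Bb) => k.
exact: sum_trunc_le.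
Qed.

Lemma imxMA A B C cA cB cC : opb A cA -> opb B cB -> opb C cC ->
  imxM A (imxM B C) = imxM (imxM A B) C.
Proof.
move=> Aa Bb Cc; apply/funext => i; apply/funext => j.
by rewrite [RHS]imxME (mulv_imxM Aa Bb (col_l2 j Cc)).
Qed.

(** The crude constant comes from [|u + v|^2 <= 2 (|u|^2 + |v|^2)]; it serves only to establish
    boundedness. *)
Lemma opbD A B cA cB : opb A cA -> opb B cB ->
  opb (imxD A B) (2 * (cA + cB)).
Proof.
move=> [a0 Aa] [b0 Bb]; split; first by rewrite mulr_ge0// addr_ge0.
move=> m n x.
apply: (@le_trans _ _ (\sum_(i < m) 2 * (cabs (\sum_(j < n) A i j * x j) ^+ 2 +
    cabs (\sum_(j < n) B i j * x j) ^+ 2))).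
  apply: ler_sum => i _; rewrite (eq_bigr (fun j : 'I_n => A i j * x j + B i j * x j)).
    by rewrite big_split /= cabs2D.
  by move=> j _; rewrite mulrDl.
rewrite -mulr_sumr big_split /=.
apply: (@le_trans _ _ (2 * (cA ^+ 2 * \sum_(j < n) cabs (x j) ^+ 2 + cB ^+ 2 * \sum_(j < n) cabs (x j) ^+ 2))).
  by rewrite ler_pM2l//; apply: lerD; [exact: Aa|exact: Bb].
rewrite -mulrDl mulrA; apply: ler_wpM2r; first exact: sum_cabs2_ge0.
nra.
Qed.

Lemma opb_diag (d : seqC) c : 0 <= c -> (forall n, cabs (d n) <= c) -> opb (imx_diag d) c.
Proof.
move=> c0 dc; split=> // m n x.
rewrite mulr_sumr.
apply: (@le_trans _ _ (\sum_(i < m) if (i < n)%N then c ^+ 2 * cabs (x i) ^+ 2 else 0)).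
  apply: ler_sum => i _; case: ifPn => ni.
    rewrite (bigD1 (Ordinal ni)) //= big1 ?addr0 => [|j].
      rewrite /imx_diag eqxx cabsM exprMn; apply: ler_wpM2r; first exact: sqr_ge0.
      by rewrite lerXn2r// ?nnegrE// cabs_ge0.
    by rewrite /imx_diag -val_eqE /= eq_sym => /negbTE ->; rewrite mul0r.
  rewrite big1 ?cabs0 ?expr0n// => j _; rewrite /imx_diag.
  rewrite gtn_eqF ?mul0r//; by rewrite (leq_trans (ltn_ord j))// leqNgt.
pose F k := if (k < n)%N then c ^+ 2 * cabs (x k) ^+ 2 else 0.
have F0 k : 0 <= F k by rewrite /F; case: ifP => // _; rewrite mulr_ge0 ?sqr_ge0.
rewrite (_ : \sum_(i < n) _ = \sum_(i < n) F i); last first.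
  by apply: eq_bigr => i _; rewrite /F ltn_ord.
have [mn|nm] := leqP m n.
  have -> : \sum_(i < n) F i = \sum_(i < m + (n - m)) F i by rewrite subnKC.
  by rewrite big_split_ord /= lerDl sumr_ge0// => i _; exact: F0.
rewrite -(subnKC (ltnW nm)) [leLHS]big_split_ord /= [X in _ + X]big1 ?addr0//.
by move=> i _; rewrite ltnNge leq_addr.
Qed.

Lemma imxM_diagl (d : seqC) B i j : imxM (imx_diag d) B i j = d i * B i j.
Proof.
rewrite imxME; apply: mulv_eq.
have := @hsum_fin (fun k => imx_diag d i k * B k j) i.+1.
rewrite big_ord_recr /= [X in X + _]big1 ?add0r => [|k _]; last first.
  by rewrite /imx_diag (gtn_eqF (ltn_ord k)) mul0r.
rewrite [imx_diag d i i]/imx_diag eqxx; apply=> k ik.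
by rewrite /imx_diag (ltn_eqF ik) mul0r.
Qed.

Lemma imxM_diagr (d : seqC) B i j : imxM B (imx_diag d) i j = B i j * d j.
Proof.
rewrite imxME; apply: mulv_eq.
have := @hsum_fin (fun k => B i k * imx_diag d k j) j.+1.
rewrite big_ord_recr /= [X in X + _]big1 ?add0r => [|k _]; last first.
  by rewrite /imx_diag (ltn_eqF (ltn_ord k)) mulr0.
rewrite [imx_diag d j j]/imx_diag eqxx; apply=> k jk.
by rewrite /imx_diag (gtn_eqF jk) mulr0.
Qed.

Lemma opnorm_leP A c : opnorm_le A c <-> opb A c.
Proof.
split=> -[c0 Ac]; split=> //.
- move=> m n x; rewrite -lee_fin; apply: le_trans (Ac n x).
  rewrite -sumEFin -(big_mkord xpredT (fun i => (cabs (\sum_(j < n) A i j * x j) ^+ 2)%:E)).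
  by apply: nneseries_lim_ge => k _ _; rewrite lee_fin sqr_ge0.
- move=> n x; apply: lime_le.
    by apply: is_cvg_ereal_nneg_natsum => k _; rewrite lee_fin sqr_ge0.
  by apply: nearW => m; rewrite big_mkord sumEFin lee_fin; exact: Ac.
Qed.

Lemma bounded_imxP A : bounded_imx A <-> exists c, opb A c.
Proof. by split=> -[c /opnorm_leP]; exists c => //; exact/opnorm_leP. Qed.

Lemma l2seqP x : l2seq x <-> ell2 x.
Proof.
have nn (k : nat) : true -> (0 <= (cabs (x k) ^+ 2)%:E)%E by rewrite lee_fin sqr_ge0.
split.
- move=> h; pose s := fine (\sum_(0 <= n <oo) (cabs (x n) ^+ 2)%:E)%E.
  exists s => n; rewrite -lee_fin /s fineK; last first.
    by rewrite ge0_fin_numE//; apply: nneseries_ge0 => k _; exact: nn.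
  rewrite -sumEFin -(big_mkord xpredT (fun i => (cabs (x i) ^+ 2)%:E)).
  by apply: nneseries_lim_ge => k _; exact: nn.
- move=> [M xM]; apply: (@le_lt_trans _ _ M%:E); last exact: ltry.
  apply: lime_le; first by apply: is_cvg_ereal_nneg_natsum => k _; exact: nn.
  by apply: nearW => m; rewrite big_mkord sumEFin lee_fin; exact: xM.
Qed.

End square_summable.

(** * Moebius transforms with a diagonal parameter *)

Section moebius_evaluation.
Context {R : realType}.
Local Notation seqC := (nat -> R[i]).
Local Notation mxC := (nat -> nat -> R[i]).
Implicit Types (x y : seqC) (A B : mxC) (M c : R).

Lemma sqrtCR (t : R) : 0 <= t -> sqrtC (t%:C) = (Num.sqrt t)%:C.
Proof.
move=> t0; rewrite -[in LHS](sqr_sqrtr t0) rmorphXn /= sqrCK//.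
by rewrite lecR sqrtr_ge0.
Qed.

(** The least bound [S], the supremum of the partial sums, satisfies [S <= q S] and so vanishes. The
    injectivity arguments below all end here. *)
Lemma l2_contraction0 x (q : R) : q < 1 -> ell2 x ->
  (forall M, l2le x M -> l2le x (q * M)) -> forall n, x n = 0.
Proof.
move=> q1 [M xM] xq n.
pose S := [set \sum_(k < m) cabs (x k) ^+ 2 | m in setT].
have hS : has_sup S.
  split; first by exists (\sum_(k < 0) cabs (x k) ^+ 2), 0.
  by exists M => _ [m _ <-].
have xS : l2le x (sup S) by move=> m; apply: ub_le_sup; [case: hS|exists m].
have Sq : sup S <= q * sup S.
  apply: ge_sup; first by case: hS.
  by move=> _ [m _ <-]; exact: xq.
have S0 : sup S <= 0.
  rewrite leNgt; apply/negP => Sp; have := l2le_ge0 xS.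
  by move: Sq; rewrite -subr_ge0 -{2}[sup S]mul1r -mulrBl pmulr_lge0// subr_ge0 leNgt q1.
apply: cabs_eq0; apply/eqP; rewrite -sqrf_eq0 eq_le sqr_ge0 andbT.
apply: le_trans S0; apply: le_trans (xS n.+1).
by rewrite big_ord_recr /= lerDr sum_cabs2_ge0.
Qed.

Lemma mulv1 x : mulv imx1 x = x.
Proof.
apply/funext => i; apply: mulv_eq.
have := @hsum_fin R (fun k => (i == k)%:R * x k) i.+1.
rewrite big_ord_recr /= big1 ?add0r ?eqxx ?mul1r => [|k _]; last first.
  by rewrite (gtn_eqF (ltn_ord k)) mul0r.
by apply=> k ik; rewrite (ltn_eqF ik) mul0r.
Qed.

Lemma imx1_diag : @imx1 R = imx_diag (fun=> 1).
Proof. by apply/funext => i; apply/funext => j; rewrite /imx1 /imx_diag; case: eqP. Qed.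

Lemma imxM1 A : imxM A imx1 = A.
Proof.
by apply/funext => i; apply/funext => j; rewrite imx1_diag imxM_diagr mulr1.
Qed.

Lemma imx1M A : imxM imx1 A = A.
Proof.
by apply/funext => i; apply/funext => j; rewrite imx1_diag imxM_diagl mul1r.
Qed.

Lemma opb1 : opb (@imx1 R) 1.
Proof. by rewrite imx1_diag; apply: opb_diag => // n; rewrite cabs1. Qed.

(** Whatever inverse [C] the choice returns, [C = (B A) C = B (A C) = B]. *)
Lemma imx_inv_unique A B : bounded_imx A -> bounded_imx B ->
  imxM A B = imx1 -> imxM B A = imx1 -> imx_inv A = B.
Proof.
move=> /bounded_imxP[cA Aa] bB AB BA; rewrite /imx_inv.
case: xgetP => [C _ [/bounded_imxP[cC Cc] AC _]|/(_ B)/= []//].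
case/bounded_imxP: bB => cB Bb.
by rewrite -[C]imx1M -BA -(imxMA Bb Aa Cc) AC imxM1.
Qed.

Section sqrt_diag.
Variables (d : nat -> R) (c : R).
Hypotheses (d_gt0 : forall n, 0 < d n) (d_le : forall n, d n <= c).

Let D := imx_diag (fun n => (d n ^+ 2)%:C).
Let S := imx_diag (fun n => (d n)%:C).

Let c_ge0 : 0 <= c. Proof. exact: le_trans (ltW (d_gt0 0)) (d_le 0). Qed.

Lemma opb_sqrt_diag : opb S c.
Proof. by apply: opb_diag => // n; rewrite cabsR gtr0_norm. Qed.

Lemma diag_sqr : imxM S S = D.
Proof.
apply/funext => i; apply/funext => j; rewrite imxM_diagl /S /D /imx_diag.
by case: eqP => [->|_]; rewrite ?mulr0// expr2 rmorphM.
Qed.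

Lemma diag_positive : positive_imx S.
Proof.
move=> n x; apply: sumr_ge0 => i _; rewrite (bigD1 i)//= big1 ?addr0 => [|j ji].
  rewrite /S /imx_diag eqxx conjCE mulrC mulrA -[_ * _^*%C]mulrC -cabs2C -rmorphM lecR.
  by rewrite mulr_ge0 ?sqr_ge0// ltW.
by rewrite /S /imx_diag val_eqE eq_sym (negbTE ji) mulr0 mul0r.
Qed.

(** [B] commutes with [S], so [(B + S) (B - S) = 0]. A column [y] of [B - S] then satisfies
    [B y = - S y], and [0 <= <y, B y> = - <y, S y>] forces [y = 0] since [S] is strictly
    positive. *)
Lemma sqrt_diag_unique B : bounded_imx B -> positive_imx B -> imxM B B = D -> B = S.
Proof.
move=> /bounded_imxP[cB Bb] B0 BB.
(* [B] commutes with [D = B B], that is [d_i^2 B_ij = B_ij d_j^2]; where [B_ij] is not 0, positivity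
   of [d] removes the squares. *)
have comm i j : (d i)%:C * B i j = B i j * (d j)%:C.
  have : imxM D B i j = imxM B D i j by rewrite -BB (imxMA Bb Bb Bb).
  rewrite imxM_diagl imxM_diagr.
  have [->|Bn0] := eqVneq (B i j) 0; first by rewrite !(mulr0,mul0r).
  rewrite mulrC => /(mulfI Bn0)/(congr1 (@complex.Re R))/= /eqP.
  by rewrite eqrXn2// ?ltW// => /eqP ->; rewrite mulrC.
apply/funext => i0; apply/funext => j; apply/eqP; rewrite -subr_eq0; apply/eqP.
pose y i := B i j - S i j.
have yM := l2leB (col_l2 j Bb) (col_l2 j opb_sqrt_diag).
rewrite -/y in yM; set My := 2 * _ in yM.
have By i : mulv B y i = - ((d i)%:C * y i).
  rewrite /y (mulvB _ Bb (col_l2 j Bb) (col_l2 j opb_sqrt_diag)).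
  rewrite -!imxME BB imxM_diagr -comm mulrBr opprB; congr (_ - _).
  have := congr1 (fun F => F i j) diag_sqr.
  by rewrite imxM_diagl => <-.
suff : y i0 = 0 by [].
apply: cabs_eq0.
(* [positive_imx] tests finitely supported vectors only. Cutting [y] at [N], past both [i0] and the
   point where the tail is below [e], leaves an error [<y, B (y - yN)>] that Cauchy-Schwarz
   bounds. *)
have K e : 0 < e -> (d i0 * cabs (y i0) ^+ 2) ^+ 2 <= My * (cB ^+ 2 * e).
  move=> e0; have [N0 hN] := tail_sum_cvg yM e0.
  pose N := maxn N0 i0.+1.
  pose yN k := if (k < N)%N then y k else 0.
  have yNM : l2le yN My by exact: l2le_trunc.
  have tl : l2le (fun k => y k - yN k) e.
    move=> m; apply: le_trans (hN m); apply: ler_sum => k _; rewrite /yN.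
    have [kN|Nk] := ltnP k N0; first by rewrite (leq_trans kN (leq_maxl _ _)) subrr.
    by case: ifP => _; rewrite ?subr0// subrr cabs0 expr0n sqr_ge0.
  have := B0 N y.
  under eq_bigr => i _ do under eq_bigr => k _ do rewrite -mulrA.
  under eq_bigr => i _ do rewrite -mulr_sumr conjCE -(mulv_trunc B y) -/yN.
  set q := \sum_(i < N) _; move=> q0.
  have Req : 0 <= Re q by move: q0; rewrite lecE => /andP[].
  pose p := \sum_(i < N) d i * cabs (y i) ^+ 2.
  have dE : \sum_(i < N) (y i)^*%C * mulv B (fun k => y k - yN k) i = - p%:C - q.
    rewrite /p /q rmorph_sum -sumrN -sumrB; apply: eq_bigr => i _.
    rewrite (mulvB _ Bb yM yNM) By mulrBr rmorphM /= cabs2C; congr (_ - _).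
    by rewrite mulrN mulrCA.
  have p_ge : d i0 * cabs (y i0) ^+ 2 <= p.
    have iN : (i0 < N)%N by rewrite leq_max leqnn orbT.
    rewrite /p (bigD1 (Ordinal iN))//= lerDl.
    by apply: sumr_ge0 => k _; rewrite mulr_ge0 ?sqr_ge0// ltW.
  have ge0 : 0 <= d i0 * cabs (y i0) ^+ 2 by rewrite mulr_ge0 ?sqr_ge0// ltW.
  apply: (@le_trans _ _ (cabs (- p%:C - q) ^+ 2)).
    rewrite ler_sqr ?nnegrE ?cabs_ge0//.
    apply: le_trans (Re_le_cabs _).
    rewrite ReCD !ReCN /= -opprD normrN ger0_norm; first by rewrite (le_trans p_ge)// lerDl.
    by rewrite addr_ge0// (le_trans ge0).
  rewrite -dE; apply: le_trans (CauchySchwarz_sum N (fun i => (y i)^*%C) _) _.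
  apply: ler_pM; rewrite ?sum_cabs2_ge0//.
  - exact: (sum_cabs2_ge0 N (fun i => (y i)^*%C)).
  - by under eq_bigr do rewrite cabsJ; exact: yM.
  - exact: (mulv_l2 Bb tl).
have z0 : (d i0 * cabs (y i0) ^+ 2) ^+ 2 <= 0.
  apply/ler_addgt0Pl => e e0; rewrite addr0.
  have My0 := l2le_ge0 yM.
  have q0 : 0 < My * cB ^+ 2 + 1 by rewrite ltr_wpDl// mulr_ge0// sqr_ge0.
  apply: le_trans (K (e / (My * cB ^+ 2 + 1)) (divr_gt0 e0 q0)) _.
  rewrite mulrA mulrA ler_pdivrMr// mulrC ler_pM2l// lerDl//.
move: z0; rewrite le_eqVlt ltNge sqr_ge0 orbF sqrf_eq0 mulf_eq0 (gt_eqF (d_gt0 i0)) /=.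
by rewrite sqrf_eq0 => /eqP.
Qed.

Lemma imx_sqrt_diag : imx_sqrt D = S.
Proof.
rewrite /imx_sqrt; case: xgetP => [B -> [bB B0 BB]|/(_ S)/= []].
  exact: sqrt_diag_unique.
split; [|exact: diag_positive|exact: diag_sqr].
by apply/bounded_imxP; exists c; exact: opb_sqrt_diag.
Qed.

End sqrt_diag.

Variables (alpha : seqC) (r : R).
Hypotheses (r_lt1 : r < 1) (alpha_le : forall n, cabs (alpha n) <= r).

Definition etaR n : R := Num.sqrt (1 - cabs (alpha n) ^+ 2).

Let r_ge0 : 0 <= r. Proof. exact: le_trans (cabs_ge0 _) (alpha_le 0). Qed.

Lemma cabs_alpha2_lt1 n : cabs (alpha n) ^+ 2 <= r ^+ 2 < 1.
Proof.
rewrite lerXn2r ?nnegrE ?cabs_ge0//=.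
by rewrite expr_lt1.
Qed.

Lemma etaR_gt0 n : 0 < etaR n.
Proof.
by rewrite sqrtr_gt0 subr_gt0; case/andP: (cabs_alpha2_lt1 n); exact: le_lt_trans.
Qed.

Lemma etaR2 n : etaR n ^+ 2 = 1 - cabs (alpha n) ^+ 2.
Proof. by rewrite sqr_sqrtr// ltW// -sqrtr_gt0 etaR_gt0. Qed.


Let A := imx_diag alpha.
Let E := imx_diag (fun n => (etaR n)%:C).
Let iE := imx_diag (fun n => ((etaR n)^-1)%:C).

Lemma etaR_le1 n : etaR n <= 1.
Proof. by rewrite -sqrtr1 ler_wsqrtr// gerBl sqr_ge0. Qed.

Lemma etaR_ge n : Num.sqrt (1 - r ^+ 2) <= etaR n.
Proof. by rewrite ler_wsqrtr// lerB//; case/andP: (cabs_alpha2_lt1 n). Qed.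

Lemma sqrt1r2_gt0 : 0 < Num.sqrt (1 - r ^+ 2).
Proof. by rewrite sqrtr_gt0 subr_gt0; case/andP: (cabs_alpha2_lt1 0). Qed.

Lemma imx_adj_diag (d : seqC) : imx_adj (imx_diag d) = imx_diag (fun n => (d n)^*%C).
Proof.
apply/funext => i; apply/funext => j; rewrite /imx_adj /imx_diag eq_sym.
by case: eqP => [->|_] //; apply: ext_complex; rewrite /= ?oppr0.
Qed.

(** Only the moduli matter, so one statement serves both [eta A] and [eta (imx_adj A)]. *)
Lemma eta_diag (d : seqC) : (forall n, cabs (d n) = cabs (alpha n)) ->
  Defs.eta (imx_diag d) = E.
Proof.
move=> dE; transitivity (imx_sqrt (imx_diag (fun n => (etaR n ^+ 2)%:C))); last first.
  exact: imx_sqrt_diag etaR_gt0 etaR_le1.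
rewrite /Defs.eta; congr imx_sqrt.
apply/funext => i; apply/funext => j; rewrite /imxB imx_adj_diag imxM_diagl.
rewrite /imx1 /imx_diag; case: eqP => _; last by rewrite mulr0 subrr.
by rewrite mulrC -cabs2C dE etaR2 rmorphB rmorph1.
Qed.

Lemma etaR_eq0 n : etaR n == 0 = false.
Proof. by rewrite (gt_eqF (etaR_gt0 n)). Qed.

Lemma EiE : imxM E iE = imx1.
Proof.
apply/funext => i; apply/funext => j; rewrite imxM_diagl /iE /imx_diag /imx1.
by case: eqP => [->|_]; rewrite ?mulr0// -rmorphM divff// etaR_eq0.
Qed.

Lemma iEE : imxM iE E = imx1.
Proof.
apply/funext => i; apply/funext => j; rewrite imxM_diagl /E /imx_diag /imx1.
by case: eqP => [->|_]; rewrite ?mulr0// -rmorphM mulVf// etaR_eq0.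
Qed.

Lemma opbE : opb E 1.
Proof. by apply: opb_diag => // n; rewrite cabsR gtr0_norm ?etaR_gt0// etaR_le1. Qed.

Lemma opbiE : opb iE (Num.sqrt (1 - r ^+ 2))^-1.
Proof.
apply: opb_diag => [|n]; first by rewrite invr_ge0 ltW// sqrt1r2_gt0.
rewrite cabsR gtr0_norm ?invr_gt0 ?etaR_gt0//.
by rewrite lef_pV2 ?posrE ?etaR_gt0 ?sqrt1r2_gt0// etaR_ge.
Qed.

Lemma opbA : opb A r. Proof. exact: opb_diag. Qed.

Lemma imx_inv_eta : imx_inv E = iE.
Proof.
apply: imx_inv_unique; [..|exact: EiE|exact: iEE]; apply/bounded_imxP.
- by exists 1; exact: opbE.
- by eexists; exact: opbiE.
Qed.

Variables (H V : mxC).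
Hypotheses (H_op : opb H 1) (V_op : opb V 1).
Hypothesis H_hess : forall k n, (n.+1 < k)%N -> H k n = 0.

Let G := imxD imx1 (imxM (imx_adj A) H).

Let GE k n : G k n = (k == n)%:R + (alpha k)^*%C * H k n.
Proof. by rewrite /G /imxD /A imx_adj_diag imxM_diagl. Qed.

Let G_hess k n : (n.+1 < k)%N -> G k n = 0.
Proof. by move=> nk; rewrite GE H_hess// mulr0 addr0 gtn_eqF// ltnW. Qed.

(** Entrywise, [V eta^-1 (1 + A^* H) = eta^-1 (H + A)]. Column [n] of [H] stops at row [n + 1],
    which leaves [n + 2] terms. *)
Hypothesis V_rel : forall i n,
  \sum_(k < n.+2) V i k * ((etaR k)^-1)%:C * (((k : nat) == n)%:R + (alpha k)^*%C * H k n) =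
  ((etaR i)^-1)%:C * (H i n + A i n).

Let X i k := V i k * ((etaR k)^-1)%:C.

Let XG : imxM X G = imxM iE (imxD H A).
Proof.
apply/funext => i; apply/funext => n; rewrite imxM_diagl [imxD _ _ _ _]/imxD -V_rel imxME.
apply: mulv_eq; rewrite (eq_bigr (fun k : 'I_n.+2 => X i k * G k n)); last first.
  by move=> k _; rewrite GE.
by apply: hsum_fin => k nk; rewrite G_hess ?mulr0.
Qed.

Let opbG : exists c, opb G c.
Proof.
eexists; apply: opbD; first exact: opb1.
by apply: opbM; [apply: opb_adj; exact: opbA|exact: H_op].
Qed.

Let XE : X = imxM V iE.
Proof. by apply/funext => i; apply/funext => j; rewrite imxM_diagr. Qed.

(* The inverse of [1 + A^* H], read off from [V = zeta_A(H)]. *)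
Let K i j := ((etaR i)^-1)%:C * ((i == j)%:R - (alpha i)^*%C * V i j) * ((etaR j)^-1)%:C.

Let opbK : exists c, opb K c.
Proof.
have -> : K = imxM (imxM iE (imxD imx1 (imxM (imx_diag (fun n => - (alpha n)^*%C)) V))) iE.
  apply/funext => i; apply/funext => j; rewrite imxM_diagr imxM_diagl /imxD imxM_diagl.
  by rewrite /K mulNr.
eexists; apply: opbM opbiE; apply: opbM; first exact: opbiE.
apply: opbD; first exact: opb1.
apply: opbM V_op; apply: opb_diag r_ge0 _ => n; by rewrite cabsN cabsJ.
Qed.

Let eta_alpha i : ((etaR i)^-1)%:C * (1 - (alpha i)^*%C * alpha i) * ((etaR i)^-1)%:C = 1.
Proof.
rewrite -cabs2C -(rmorph1 (real_complex R)) -rmorphB -etaR2 -!rmorphM.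
by congr (_%:C); field; rewrite etaR_eq0.
Qed.

(** By [V_rel], and since diagonal matrices commute, [K G = eta^-2 (1 + A^* H - A^* (H + A)) =
    eta^-2 (1 - A^* A) = 1]. *)
Let KG : imxM K G = imx1.
Proof.
apply/funext => i; apply/funext => n; rewrite imxME; apply: mulv_eq.
(* The range has to contain the support of column [n] of [G] and the index [i], where the unit part
   of [K] sits. *)
have -> : imx1 i n = \sum_(k < maxn n.+2 i.+1) K i k * G k n; last first.
  by apply: hsum_fin => k; rewrite geq_max => /andP[nk _]; rewrite G_hess ?mulr0.
set N := maxn _ _.
have iN : (i < N)%N by rewrite leq_max leqnn orbT.
have nN : (n.+2 <= N)%N by rewrite leq_max leqnn.
have e1 : \sum_(k < N) (i == k)%:R * (((etaR k)^-1)%:C * G k n) = ((etaR i)^-1)%:C * G i n.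
  rewrite (bigD1 (Ordinal iN))//= eqxx mul1r big1 ?addr0// => k.
  by rewrite -val_eqE /= eq_sym => /negbTE ->; rewrite mul0r.
have e2 : \sum_(k < N) X i k * G k n = ((etaR i)^-1)%:C * (H i n + A i n).
  rewrite -V_rel -(subnKC nN) big_split_ord /= [X in _ + X]big1 ?addr0.
    by apply: eq_bigr => k _; rewrite GE.
  by move=> k _; rewrite G_hess ?mulr0// leq_addr.
transitivity (((etaR i)^-1)%:C * (\sum_(k < N) (i == k)%:R * (((etaR k)^-1)%:C * G k n) -
    (alpha i)^*%C * \sum_(k < N) X i k * G k n)).
  rewrite e1 e2 GE /A /imx1 /imx_diag.
  have [<-|_] := eqVneq i n; last by rewrite /=; ring.
  transitivity (((etaR i)^-1)%:C * (1 - (alpha i)^*%C * alpha i) * ((etaR i)^-1)%:C).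
    by rewrite eta_alpha.
  by rewrite /=; ring.
rewrite mulr_sumr -sumrB mulr_sumr; apply: eq_bigr => k _.
by rewrite /K /X; ring.
Qed.

(* [K y = 0] means [w = A^* V w] for [w = eta^-1 y]; the right-hand side has norm at most
   [r |w|]. *)
Let K_inj y : ell2 y -> (forall i, mulv K y i = 0) -> forall i, y i = 0.
Proof.
move=> [M yM] Ky.
pose w k := ((etaR k)^-1)%:C * y k.
have wE k : y k = (etaR k)%:C * w k by rewrite /w mulrA -rmorphM divff ?mul1r// etaR_eq0.
have wM : exists M', l2le w M'.
  exists ((Num.sqrt (1 - r ^+ 2))^-1 ^+ 2 * M) => n.
  apply: (@le_trans _ _ (\sum_(k < n) (Num.sqrt (1 - r ^+ 2))^-1 ^+ 2 * cabs (y k) ^+ 2)).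
    apply: ler_sum => k _; rewrite cabsM exprMn; apply: ler_wpM2r; first exact: sqr_ge0.
    rewrite lerXn2r ?nnegrE ?cabs_ge0 ?invr_ge0 ?(ltW sqrt1r2_gt0)//.
    rewrite cabsR gtr0_norm ?invr_gt0 ?etaR_gt0//.
    by rewrite lef_pV2 ?posrE ?etaR_gt0 ?sqrt1r2_gt0// etaR_ge.
  by rewrite -mulr_sumr; apply: ler_wpM2l; rewrite ?sqr_ge0//; exact: yM.
have wV i : w i = (alpha i)^*%C * mulv V w i.
  case: wM => M' wM.
  have h1 : hsum (fun k => (i == k)%:R * w k) (w i).
    have := @hsum_fin R (fun k => (i == k)%:R * w k) i.+1.
    rewrite big_ord_recr /= big1 ?add0r ?eqxx ?mul1r => [|k _]; last first.
      by rewrite (gtn_eqF (ltn_ord k)) mul0r.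
    by apply=> k ik; rewrite (ltn_eqF ik) mul0r.
  have h2 := hsumZ (alpha i)^*%C (mulvE i V_op wM).
  have h3 := hsumZ ((etaR i)^-1)%:C (hsumB h1 h2).
  have : mulv K y i = ((etaR i)^-1)%:C * (w i - (alpha i)^*%C * mulv V w i).
    apply: mulv_eq.
    rewrite (_ : (fun k => K i k * y k) =
      (fun k => ((etaR i)^-1)%:C * ((i == k)%:R * w k - (alpha i)^*%C * (V i k * w k))))//.
    by apply/funext => k; rewrite /K /w; ring.
  rewrite Ky => /esym/eqP; rewrite mulf_eq0 fmorph_eq0 invr_eq0 etaR_eq0/= subr_eq0.
  by move/eqP.
move=> i; rewrite wE (l2_contraction0 (q := r ^+ 2) _ wM) ?mulr0//.
  by case/andP: (cabs_alpha2_lt1 0).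
move=> M' wM' n.
apply: (@le_trans _ _ (\sum_(k < n) r ^+ 2 * cabs (mulv V w k) ^+ 2)).
  apply: ler_sum => k _; rewrite wV cabsM exprMn; apply: ler_wpM2r; first exact: sqr_ge0.
  by rewrite cabsJ; case/andP: (cabs_alpha2_lt1 k).
rewrite -mulr_sumr; apply: ler_wpM2l; first exact: sqr_ge0.
by have := mulv_l2 V_op wM'; rewrite expr1n mul1r; exact.
Qed.

(** [K (G K - 1) = (K G) K - K = 0], and [K] is injective on the square-summable columns. *)
Let GK : imxM G K = imx1.
Proof.
have [cG Gb] := opbG; have [cK Kb] := opbK.
apply/funext => i; apply/funext => j.
apply/eqP; rewrite -subr_eq0; apply/eqP.
have GKb := opbM Gb Kb.
apply: (K_inj (y := fun i => imxM G K i j - imx1 i j)).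
  by eexists; exact: (l2leB (col_l2 j GKb) (col_l2 j opb1)).
move=> k; rewrite (mulvB _ Kb (col_l2 j GKb) (col_l2 j opb1)).
rewrite -!imxME (imxMA Kb Gb Kb) KG imx1M imxM1 subrr //.
Qed.

(** With [X = V eta^-1] and [X G = eta^-1 (H + A)], the transform is
    [X G G^-1 eta = V eta^-1 eta]. *)
Lemma moebius_eval : moebius A H = V.
Proof.
have [cG Gb] := opbG; have [cK Kb] := opbK.
rewrite /moebius /A imx_adj_diag !eta_diag// => [|n]; last by rewrite cabsJ.
rewrite imx_inv_eta -imx_adj_diag -/A -/G.
have -> : imx_inv G = K.
  by apply: imx_inv_unique; [apply/bounded_imxP; eexists; eassumption..|exact: GK|exact: KG].
have Xb : opb X (1 * (Num.sqrt (1 - r ^+ 2))^-1) by rewrite XE; exact: opbM V_op opbiE.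
rewrite -XG -(imxMA Xb Gb Kb) GK imxM1 XE -(imxMA V_op opbiE opbE) iEE.
exact: imxM1.
Qed.

Lemma moebius_domP : moebius_dom A H.
Proof. by split; [exists r => //|]; apply/opnorm_leP => //; exact: opbA. Qed.

End moebius_evaluation.

(** * The Hessenberg matrix *)

Section hessenberg_facts.
Context {R : realType}.
Local Notation seqC := (nat -> R[i]).
Local Notation mxC := (nat -> nat -> R[i]).
Implicit Types (x y : seqC) (A B : mxC) (M c : R).

Variable a : seqC.
Hypotheses (a_lt1 : forall n, (0 < n)%N -> `|a n| < 1) (a_0 : a 0%N = 1).

Definition rhoR n : R := Num.sqrt (1 - cabs (a n) ^+ 2).

Lemma cabs_a_lt1 n : cabs (a n.+1) ^+ 2 < 1.
Proof.
have := a_lt1 (ltn0Sn n); rewrite -cabsE -(rmorph1 (real_complex R)) ltcR.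
by move=> h; rewrite expr_lt1 ?cabs_ge0.
Qed.

Lemma rhoR_gt0 n : 0 < rhoR n.+1.
Proof. by rewrite sqrtr_gt0 subr_gt0 cabs_a_lt1. Qed.

Lemma rhoR2 n : rhoR n.+1 ^+ 2 = 1 - cabs (a n.+1) ^+ 2.
Proof. by rewrite sqr_sqrtr// subr_ge0 ltW// cabs_a_lt1. Qed.

Lemma rhoE n : rho a n.+1 = (rhoR n.+1)%:C.
Proof.
rewrite /rho -sqrtCR; last by rewrite subr_ge0 ltW// cabs_a_lt1.
by rewrite -cabsE -rmorphXn rmorphB rmorph1.
Qed.

Lemma hessenberg_hess k n : (n.+1 < k)%N -> hessenberg a k n = 0.
Proof.
move=> nk; rewrite /hessenberg leqNgt (ltn_trans _ nk)//= gtn_eqF//.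
Qed.

(** A finite sum, hence meaningful for arbitrary sequences: it is also used for values of functions
    at a fixed point of the circle, and for [u] before that vector is known to be square
    summable. *)
Definition hadj x n : R[i] := \sum_(k < n.+2) (hessenberg a k n)^*%C * x k.

(** The entries of column [n] on and above the diagonal enter [H^* x] only through this number
    ([hadjE]), which obeys a two-term recursion. For the ORF it is the conjugate of [psi*_n]. *)
Fixpoint hstate x n : R[i] :=
  if n is m.+1 then rho a m.+1 * hstate x m + a m.+1 * x m.+1 else x 0%N.

Lemma hstateE x n :
  hstate x n = \sum_(k < n.+1) (\prod_(k.+1 <= j < n.+1) rho a j) * a k * x k.
Proof.
elim: n => [|n IH] /=; first by rewrite big_ord1 big_nil a_0 !mul1r.
rewrite big_ord_recr /= big_geq// mul1r IH mulr_sumr; congr (_ + _).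
apply: eq_bigr => k _; rewrite [in RHS]big_nat_recr//=.
by ring.
Qed.

Lemma conj_prod_rho k n : (\prod_(k.+1 <= j < n.+1) rho a j)^*%C = \prod_(k.+1 <= j < n.+1) rho a j.
Proof.
rewrite rmorph_prod; apply: eq_big_nat => -[//|j] _.
by rewrite rhoE; apply: ext_complex; rewrite /= ?oppr0.
Qed.

Lemma hadjE x n : hadj x n = rho a n.+1 * x n.+1 - (a n.+1)^*%C * hstate x n.
Proof.
rewrite /hadj big_ord_recr /= addrC; congr (_ + _).
  rewrite /hessenberg ltnn eqxx rhoE; congr (_ * _).
  by apply: ext_complex; rewrite /= ?oppr0.
rewrite hstateE mulr_sumr -sumrN; apply: eq_bigr => k _.
rewrite /hessenberg -ltnS ltn_ord !conjM conjN conj_prod_rho conjcK.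
by ring.
Qed.

(* A step of the recursion for [H^* x] rotates [(s_n, x_(n+1))] to [(s_(n+1), (H^* x)_n)]. *)
Lemma hadj_rotation x n :
  cabs (hstate x n.+1) ^+ 2 + cabs (hadj x n) ^+ 2 =
  cabs (hstate x n) ^+ 2 + cabs (x n.+1) ^+ 2.
Proof.
rewrite hadjE /= rhoE; have := rhoR2 n; rewrite !cabs2.
rewrite !(ReCD,ImCD,ReCN,ImCN) !ReCM !ImCM !(ReCJ,ImCJ) /=.
move: (rhoR n.+1) (Re (a n.+1)) (Im (a n.+1)) (Re (x n.+1)) (Im (x n.+1)).
move: (Re (hstate x n)) (Im (hstate x n)) => s t p b c d e h.
have h1 : p ^+ 2 + b ^+ 2 + c ^+ 2 = 1 by rewrite h; ring.
transitivity ((p ^+ 2 + b ^+ 2 + c ^+ 2) * (s ^+ 2 + t ^+ 2 + d ^+ 2 + e ^+ 2)).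
  by ring.
by rewrite h1; ring.
Qed.

(** The rotations telescope. The norm lost by [H^*] at a square-summable [x] is therefore the limit
    of [|s_n|^2], with [s = hstate x]. *)
Lemma hadj_energy x n :
  \sum_(k < n) cabs (hadj x k) ^+ 2 + cabs (hstate x n) ^+ 2 =
  \sum_(k < n.+1) cabs (x k) ^+ 2.
Proof.
elim: n => [|n IH]; first by rewrite big_ord0 big_ord1 add0r.
rewrite [RHS]big_ord_recr /= -IH -addrA -hadj_rotation [LHS]addrC.
by rewrite big_ord_recr /=; ring.
Qed.

Lemma hadj_le x n :
  \sum_(k < n) cabs (hadj x k) ^+ 2 <= \sum_(k < n.+1) cabs (x k) ^+ 2.
Proof. by rewrite -hadj_energy lerDl sqr_ge0. Qed.

Lemma mulv_hadj x n : mulv (imx_adj (hessenberg a)) x n = hadj x n.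
Proof.
apply: mulv_eq; apply: hsum_fin => k nk.
by rewrite /imx_adj hessenberg_hess//; apply: ext_complex; rewrite ?ReCM ?ImCM /=; ring.
Qed.

(** The energy identity concerns the adjoint; the bound returns to [H] by taking adjoints once
    more. *)
Lemma opb_hessenberg : opb (hessenberg a) 1.
Proof.
suff h : opb (imx_adj (hessenberg a)) 1.
  have := opb_adj h; congr (opb _ _).
  by apply/funext => i; apply/funext => j; rewrite /imx_adj conjcK.
split=> // m n x.
under eq_bigr do rewrite -mulv_trunc mulv_hadj.
apply: le_trans (hadj_le _ _) _; rewrite expr1n mul1r.
exact: sum_trunc_le.
Qed.

Lemma hadjB x y n : hadj (fun k => x k - y k) n = hadj x n - hadj y n.
Proof. by rewrite /hadj -sumrB; apply: eq_bigr => k _; rewrite mulrBr. Qed.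

Variables (alpha : seqC) (r : R).
Hypotheses (r_lt1 : r < 1) (alpha_le : forall n, cabs (alpha n) <= r).
Variable V : mxC.
Hypothesis V_op : opb V 1.
Local Notation et := (etaR alpha).
Local Notation H := (hessenberg a).
Hypothesis V_rel : forall i n,
  \sum_(k < n.+2) V i k * ((et k)^-1)%:C * (((k : nat) == n)%:R + (alpha k)^*%C * H k n) =
  ((et i)^-1)%:C * (H i n + imx_diag alpha i n).

Let conjR (t : R) : (t%:C)^*%C = t%:C :> R[i].
Proof. by apply: ext_complex; rewrite /= ?oppr0. Qed.

Let conj_bool (b : bool) : (b%:R)^*%C = b%:R :> R[i].
Proof. by case: b; apply: ext_complex; rewrite /= ?oppr0. Qed.

Lemma adj_rel y M n : l2le y M ->
  \sum_(k < n.+2) (((k : nat) == n)%:R + alpha k * (H k n)^*%C) * ((et k)^-1)%:C *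
     mulv (imx_adj V) y k =
  hadj (fun k => ((et k)^-1)%:C * y k) n + (alpha n)^*%C * (((et n)^-1)%:C * y n).
Proof.
move=> yM.
pose F k i := ((k == n)%:R + alpha k * (H k n)^*%C) * ((et k)^-1)%:C * (imx_adj V k i * y i).
have h1 : hsum (fun i => \sum_(k < n.+2) F k i)
  (\sum_(k < n.+2) ((k == n :> nat)%:R + alpha k * (H k n)^*%C) * ((et k)^-1)%:C *
     mulv (imx_adj V) y k).
  apply: (@hsum_sum R n.+2 F (fun k => ((k == n)%:R + alpha k * (H k n)^*%C) * ((et k)^-1)%:C *
     mulv (imx_adj V) y k)) => k.
  by apply: hsumZ; exact: (mulvE k (opb_adj V_op) yM).
apply: (hsum_unique h1).
have FE i : \sum_(k < n.+2) F k i = ((et i)^-1)%:C * ((H i n)^*%C + (imx_diag alpha i n)^*%C) * y i.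
  rewrite -conjD -(conjR (et i)^-1) -conjM -V_rel bigC_conj mulr_suml.
  apply: eq_bigr => k _; rewrite /F /imx_adj !conjM conjD conjM conjcK conjR conj_bool.
  by ring.
rewrite (_ : (fun i => _) = (fun i => ((et i)^-1)%:C * ((H i n)^*%C + (imx_diag alpha i n)^*%C) * y i)); last first.
  by apply/funext => i; exact: FE.
rewrite (_ : _ + _ = \sum_(i < n.+2) ((et i)^-1)%:C * ((H i n)^*%C + (imx_diag alpha i n)^*%C) * y i).
  apply: hsum_fin => k nk; rewrite hessenberg_hess// /imx_diag gtn_eqF ?(ltnW nk)//.
  by apply: ext_complex; rewrite !(ReCM,ImCM,ReCD,ImCD,ReCJ,ImCJ) /=; ring.
have -> : (alpha n)^*%C * (((et n)^-1)%:C * y n) =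
    \sum_(i < n.+2) ((et i)^-1)%:C * (imx_diag alpha i n)^*%C * y i.
  rewrite (bigD1 (Ordinal (leqnSn n.+1)))//= big1 ?addr0 => [|k].
    by rewrite /imx_diag eqxx; ring.
  rewrite -val_eqE /= /imx_diag => /negbTE ->.
  by apply: ext_complex; rewrite !(ReCM,ImCM,ReCD,ImCD,ReCJ,ImCJ) /=; ring.
by rewrite /hadj -big_split /=; apply: eq_bigr => k _; ring.
Qed.

Let r_ge0 : 0 <= r. Proof. exact: le_trans (cabs_ge0 _) (alpha_le 0). Qed.

Let iet_le k : cabs ((et k)^-1)%:C <= (Num.sqrt (1 - r ^+ 2))^-1.
Proof.
rewrite cabsR gtr0_norm ?invr_gt0 ?(etaR_gt0 r_lt1 alpha_le)//.
rewrite lef_pV2 ?posrE ?(etaR_gt0 r_lt1 alpha_le) ?(sqrt1r2_gt0 r_lt1 alpha_le)//.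
exact: (etaR_ge r_lt1 alpha_le).
Qed.

Lemma l2leZ (f : seqC) c x M : 0 <= c -> (forall k, cabs (f k) <= c) -> l2le x M ->
  l2le (fun k => f k * x k) (c ^+ 2 * M).
Proof.
move=> c0 fc xM n.
apply: (@le_trans _ _ (\sum_(k < n) c ^+ 2 * cabs (x k) ^+ 2)).
  apply: ler_sum => k _; rewrite cabsM exprMn; apply: ler_wpM2r; first exact: sqr_ge0.
  by rewrite lerXn2r ?nnegrE ?cabs_ge0.
by rewrite -mulr_sumr; apply: ler_wpM2l; rewrite ?sqr_ge0//; exact: xM.
Qed.

Let l2_iet x M : l2le x M -> exists M', l2le (fun k => ((et k)^-1)%:C * x k) M'.
Proof.
move=> xM; eexists; apply: (l2leZ _ iet_le xM).
by rewrite invr_ge0 ltW// (sqrt1r2_gt0 r_lt1 alpha_le).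
Qed.

Let ietK k z : ((et k)^-1)%:C * z = 0 -> z = 0.
Proof.
by move=> /eqP; rewrite mulf_eq0 fmorph_eq0 invr_eq0 (gt_eqF (etaR_gt0 r_lt1 alpha_le k)) => /eqP.
Qed.

Lemma sum_ltn (m n : nat) : (\sum_(k < m) (k < n)%N = minn m n)%N.
Proof.
elim: m => [|m IH]; first by rewrite big_ord0 min0n.
rewrite big_ord_recr /= IH /minn; case: (ltnP m n) => mn; case: ifP; lia.
Qed.

(* [conj(a_(n+1)) s_n = rho_(n+1) x_(n+1) - (H^* x)_n] is square summable in [n], so that
   [s_n] cannot stay away from 0. *)
Lemma hstate_small x M (e : R) N : ~ ell2 (fun n => a n.+1) -> l2le x M -> 0 < e ->
  exists2 n, (N <= n)%N & cabs (hstate x n) ^+ 2 <= e.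
Proof.
move=> na xM e0; apply: contrapT => h; apply: na.
have sn n : (N <= n)%N -> e <= cabs (hstate x n) ^+ 2.
  by move=> Nn; rewrite leNgt; apply/negP => sne; apply: h; exists n => //; exact: ltW.
have aB n : (N <= n)%N -> e * cabs (a n.+1) ^+ 2 <=
    2 * (cabs (x n.+1) ^+ 2 + cabs (hadj x n) ^+ 2).
  move=> Nn; have : (a n.+1)^*%C * hstate x n = rho a n.+1 * x n.+1 + - hadj x n.
    by rewrite hadjE; ring.
  move=> /(congr1 (fun z => cabs z ^+ 2)); rewrite cabsM cabsJ exprMn mulrC => E.
  apply: (@le_trans _ _ (cabs (hstate x n) ^+ 2 * cabs (a n.+1) ^+ 2)).
    by apply: ler_wpM2r; rewrite ?sqr_ge0// sn.
  rewrite E; apply: le_trans (cabs2D _ _) _; rewrite cabsN ler_pM2l// lerD2r.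
  rewrite rhoE cabsM exprMn cabsR real_normK ?num_real// rhoR2 ler_piMl ?sqr_ge0//.
  by rewrite gerBl sqr_ge0.
(* The first [N] terms are below 1. The others are at most [(2 / e) (|x_(k+1)|^2 + |(H^* x)_k|^2)],
   and each of the two sums is at most [M]. *)
exists (N%:R + 4 * M / e) => n.
apply: (@le_trans _ _ (\sum_(k < n) ((k < N)%N%:R + 2 / e * (cabs (x k.+1) ^+ 2 + cabs (hadj x k) ^+ 2)))).
  apply: ler_sum => k _; have [kN|Nk] := ltnP k N.
    rewrite (le_trans (ltW (cabs_a_lt1 _)))// lerDl mulr_ge0 ?divr_ge0 ?addr_ge0 ?sqr_ge0// ltW//.
  rewrite add0r mulrAC ler_pdivlMr// mulrC; exact: aB.
rewrite big_split /= lerD//.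
  by rewrite -natr_sum ler_nat sum_ltn geq_minr.
rewrite -mulr_sumr big_split /=.
have -> : 4 * M / e = 2 / e * (M + M) by field; rewrite gt_eqF.
rewrite ler_pM2l ?divr_gt0//.
have h1 : \sum_(k < n) cabs (x k.+1) ^+ 2 <= M.
  by apply: le_trans (xM n.+1); rewrite big_ord_recl lerDr sqr_ge0.
have h2 := le_trans (hadj_le x n) (xM n.+1).
by lra.
Qed.

(** For [x = eta^-1 y], [adj_rel] becomes [H^* x = - A^* x]. At arbitrarily large indices where the
    state is small, the energy identity bounds [|x|^2] by [r^2 |x|^2] up to [e]. *)
Lemma adj_inj : ~ ell2 (fun n => a n.+1) -> forall y, ell2 y ->
  (forall i, mulv (imx_adj V) y i = 0) -> forall i, y i = 0.
Proof.
move=> na y [M yM] Vy.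
pose x k := ((et k)^-1)%:C * y k.
have [M' xM'] := l2_iet yM.
have xE n : hadj x n = - ((alpha n)^*%C * x n).
  apply/eqP; rewrite -addr_eq0 -(adj_rel n yM) big1// => k _.
  by rewrite Vy mulr0.
suff x0 : forall n, x n = 0 by move=> i; apply: (@ietK i); exact: x0.
apply: (l2_contraction0 (q := r ^+ 2)); first by case/andP: (cabs_alpha2_lt1 r_lt1 alpha_le 0).
  by exists M'.
move=> B xB n; apply/ler_addgt0Pl => e e0.
have [m nm sm] := hstate_small n na xB e0.
apply: le_trans (sum_cabs2_mono x (leq_trans nm (leqnSn m))) _.
rewrite -hadj_energy addrC lerD//.
apply: (@le_trans _ _ (\sum_(k < m) r ^+ 2 * cabs (x k) ^+ 2)).
  apply: ler_sum => k _; rewrite xE cabsN cabsM cabsJ exprMn.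
  apply: ler_wpM2r; first exact: sqr_ge0.
  by case/andP: (cabs_alpha2_lt1 r_lt1 alpha_le k).
by rewrite -mulr_sumr; apply: ler_wpM2l; rewrite ?sqr_ge0//; exact: xB.
Qed.

(** Since [V^* V = 1], the adjoint of [V] annihilates every column of [V V^* - 1]. *)
Lemma coisometry_of_not_l2 : ~ ell2 (fun n => a n.+1) ->
  imxM (imx_adj V) V = imx1 -> imxM V (imx_adj V) = imx1.
Proof.
move=> na VV; have aV := opb_adj V_op; have VVb := opbM V_op aV.
apply/funext => i; apply/funext => j; apply/eqP; rewrite -subr_eq0; apply/eqP.
apply: (adj_inj na (y := fun i => imxM V (imx_adj V) i j - imx1 i j)).
  by eexists; exact: (l2leB (col_l2 j VVb) (col_l2 j (@opb1 R))).
move=> k; rewrite (mulvB _ aV (col_l2 j VVb) (col_l2 j (@opb1 R))).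
by rewrite -!imxME (imxMA aV V_op aV) VV imx1M imxM1 subrr.
Qed.

Let t n : R := \prod_(k < n) (rhoR k.+1)^-1.

Let tS n : t n.+1 = t n / rhoR n.+1. Proof. by rewrite /t big_ord_recr. Qed.

(* The vector annihilated by the adjoint of [H], unnormalized. *)
Let u n : R[i] := (a n)^*%C * (t n)%:C.

Let u0 : u 0%N = 1.
Proof.
by rewrite /u a_0 /t big_ord0; apply: ext_complex; rewrite /= ?ReCM ?ImCM /=; ring.
Qed.

Let rho_t n : rhoR n.+1 * t n.+1 = t n.
Proof. by rewrite tS mulrC divfK// (gt_eqF (rhoR_gt0 n)). Qed.

Let u_state n : hstate u n = (t n)%:C.
Proof.
elim: n => [|n IH] /=; first by rewrite u0 /t big_ord0.
rewrite IH rhoE /u -{1}rho_t mulrA [a _ * _]mulrC -cabs2C -!rmorphM -rmorphD.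
by congr (_%:C); rewrite mulrA -mulrDl -expr2 rhoR2; ring.
Qed.

Let u_adj n : hadj u n = 0.
Proof.
by rewrite hadjE u_state rhoE /u -(rho_t n) rmorphM /=; ring.
Qed.

Let t_ge0 n : 0 <= t n.
Proof. by apply: prodr_ge0 => k _; rewrite invr_ge0 ltW// rhoR_gt0. Qed.

Let u_sum n : \sum_(k < n.+1) cabs (u k) ^+ 2 = t n ^+ 2.
Proof.
rewrite -hadj_energy u_state cabsR ger0_norm// big1 ?add0r// => k _.
by rewrite u_adj cabs0 expr0n.
Qed.

Let t_mono m n : (m <= n)%N -> t m ^+ 2 <= t n ^+ 2.
Proof. by move=> mn; rewrite -!u_sum; exact: sum_cabs2_mono. Qed.

(** The partial sums of [|u|^2] are the [t_n^2], so [t] has to be bounded. Past an [N] where the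
    tail of [|a|^2] is at most 1/2, [t_n^2 - t_N^2 <= t_n^2 / 2]. *)
Let u_l2 : ell2 (fun n => a n.+1) -> ell2 u.
Proof.
move=> [M aM].
have half0 : 0 < 2^-1 :> R by rewrite invr_gt0.
have [N hN] := tail_sum_cvg aM half0.
exists (2 * t N ^+ 2) => n; have [nN|Nn] := leqP n N.+1.
  apply: le_trans (sum_cabs2_mono u nN) _; rewrite u_sum ler_peMl ?sqr_ge0//.
  by rewrite ler1n.
case: n Nn => // n; rewrite ltnS => Nn; rewrite u_sum.
have : t n ^+ 2 - t N ^+ 2 <= 2^-1 * t n ^+ 2; last by lra.
have := hN n.
have -> : t n ^+ 2 - t N ^+ 2 = \sum_(N <= k < n) cabs (u k.+1) ^+ 2.
  rewrite -(telescope_sumr (fun k => t k ^+ 2) (ltnW Nn)); apply: eq_bigr => k _.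
  by rewrite -!u_sum [X in X - _]big_ord_recr /= addrAC subrr add0r.
rewrite -(big_mkord xpredT (fun k => cabs (if (k < N)%N then 0 else a k.+1) ^+ 2)).
rewrite (@big_cat_nat _ _ _ N)//= 1?ltnW// big1_seq ?add0r; last first.
  by move=> k; rewrite mem_index_iota => /andP[_ /= ->]; rewrite cabs0 expr0n.
move=> S2; apply: (@le_trans _ _ (\sum_(N <= k < n) cabs (if (k < N)%N then 0 else a k.+1) ^+ 2 * t n ^+ 2)).
  rewrite big_nat [leRHS]big_nat; apply: ler_sum => k /andP[Nk kn].
  rewrite ltnNge Nk /= /u cabsM cabsJ exprMn cabsR real_normK ?num_real//.
  by apply: ler_wpM2l; [exact: sqr_ge0|exact: t_mono].
by rewrite -mulr_suml; apply: ler_wpM2r => //; exact: sqr_ge0.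
Qed.

(** If [u] is square summable, [H^* u = 0] makes [y = eta^-1 u] satisfy [V^* y = A^* y]. Then
    [|y| = |V V^* y| <= |V^* y| <= r |y|], so [y = 0], against [u_0 = 1]. *)
Lemma not_l2_of_coisometry :
  imxM V (imx_adj V) = imx1 -> ~ ell2 (fun n => a n.+1).
Proof.
move=> VV /u_l2 uM; case: (uM) => M uM'.
have aV := opb_adj V_op.
pose y k := ((et k)^-1)%:C * u k.
have [My yM] := l2_iet uM'.
have Vy k : mulv (imx_adj V) y k = (alpha k)^*%C * y k.
  have [M1 d1] : exists M1, l2le (fun k => (alpha k)^*%C * y k) M1.
    by eexists; apply: (l2leZ r_ge0 _ yM) => j; rewrite cabsJ.
  pose d k := ((et k)^-1)%:C * (mulv (imx_adj V) y k - (alpha k)^*%C * y k).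
  have [Md dM] := l2_iet (l2leB (mulv_l2 aV yM) d1).
  suff d0 : forall n, d n = 0.
    by apply/eqP; rewrite -subr_eq0; apply/eqP; apply: (@ietK k); exact: d0.
  (* By [adj_rel], [(1 + H^* A) d = H^* (1 - A A^* ) eta^-1 y = H^* u = 0]; as [H^* A] contracts by
     [r], this forces [d = 0]. *)
  have dE n : d n = - hadj (fun k => alpha k * d k) n.
    apply/eqP; rewrite -addr_eq0; apply/eqP.
    pose x k := ((et k)^-1)%:C * y k.
    have e1 := adj_rel n yM.
    have e2 : \sum_(k < n.+2) (((k : nat) == n)%:R + alpha k * (H k n)^*%C) * ((et k)^-1)%:C *
       ((alpha k)^*%C * y k) = hadj (fun k => alpha k * (alpha k)^*%C * x k) n + (alpha n)^*%C * x n.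
      have -> : (alpha n)^*%C * x n = \sum_(k < n.+2) ((k : nat) == n)%:R * ((alpha k)^*%C * x k).
        rewrite (bigD1 (Ordinal (leqnSn n.+1)))//= eqxx mul1r big1 ?addr0// => j.
        by rewrite -val_eqE /= => /negbTE ->; rewrite mul0r.
      by rewrite /hadj -big_split /=; apply: eq_bigr => j _; rewrite /x; ring.
    have -> : d n = \sum_(k < n.+2) ((k : nat) == n)%:R * d k.
      rewrite (bigD1 (Ordinal (leqnSn n.+1)))//= eqxx mul1r big1 ?addr0// => j.
      by rewrite -val_eqE /= => /negbTE ->; rewrite mul0r.
    rewrite /hadj -big_split /=.
    transitivity (hadj (fun k => x k - alpha k * (alpha k)^*%C * x k) n).
      rewrite hadjB; transitivity ((hadj x n + (alpha n)^*%C * x n) -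
          (hadj (fun k => alpha k * (alpha k)^*%C * x k) n + (alpha n)^*%C * x n)); last by ring.
      rewrite -e2 -e1 -sumrB; apply: eq_bigr => j _; rewrite /d; ring.
    rewrite -[RHS](u_adj n) /hadj; apply: eq_bigr => j _; congr (_ * _).
    rewrite -{1}[x j]mul1r -mulrBl [alpha j * _]mulrC -cabs2C -(rmorph1 (real_complex R)) -rmorphB.
    rewrite -(etaR2 r_lt1 alpha_le) /x /y !mulrA -!rmorphM.
    rewrite (_ : _ / _ / _ = 1) ?rmorph1 ?mul1r//.
    by field; rewrite (gt_eqF (etaR_gt0 r_lt1 alpha_le j)).
  apply: (l2_contraction0 (q := r ^+ 2)); first by case/andP: (cabs_alpha2_lt1 r_lt1 alpha_le 0).
    by exists Md.
  move=> B dB n.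
  under eq_bigr do rewrite dE cabsN.
  apply: le_trans (hadj_le _ _) _; exact: (l2leZ r_ge0 alpha_le dB).
have : y 0%N = 0.
  apply: (l2_contraction0 (q := r ^+ 2)); first by case/andP: (cabs_alpha2_lt1 r_lt1 alpha_le 0).
    by exists My.
  move=> B yB.
  have : l2le (mulv V (mulv (imx_adj V) y)) (1 ^+ 2 * (r ^+ 2 * B)).
    apply: (mulv_l2 V_op); rewrite (_ : mulv _ _ = fun k => (alpha k)^*%C * y k).
      by apply: (l2leZ r_ge0 _ yB) => j; rewrite cabsJ.
    by apply/funext.
  rewrite -(mulv_imxM V_op aV yB) VV mulv1 expr1n mul1r; exact.
by move=> /(@ietK 0%N)/eqP; rewrite u0 oner_eq0.
Qed.

End hessenberg_facts.

(** * The space L^2 of the circle *)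

Section hilbert.
Context {R : realType} (mu : probability (circle R) R).
Implicit Types f g h : circle R -> R[i].

Definition measC f := measurable_fun setT (fun z => Re (f z)) /\
  measurable_fun setT (fun z => Im (f z)).

Definition rintegrable (f : circle R -> R) : Prop :=
  mu.-integrable setT (EFin \o f).

(** Agrees with [norm2sq] on [L2] ([norm2sqE]); where the integral is infinite its value is 0, so it
    carries information only together with membership in [L2]. *)
Definition nsq f : R := (\int[mu]_z (cabs (f z) ^+ 2))%R.

Lemma measC_cst (c : R[i]) : measC (fun=> c).
Proof. by split; exact: measurable_cst. Qed.

Lemma measCD f g : measC f -> measC g -> measC (fun z => f z + g z).
Proof.
move=> [fr fi] [gr gi]; split.
- by under eq_fun do rewrite ReCD; exact: measurable_funD.
- by under eq_fun do rewrite ImCD; exact: measurable_funD.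
Qed.

Lemma measCM f g : measC f -> measC g -> measC (fun z => f z * g z).
Proof.
move=> [fr fi] [gr gi]; split.
- by under eq_fun do rewrite ReCM; apply: measurable_funB; exact: measurable_funM.
- by under eq_fun do rewrite ImCM; apply: measurable_funD; exact: measurable_funM.
Qed.

Lemma measCJ f : measC f -> measC (fun z => (f z)^*%C).
Proof.
move=> [fr fi]; split.
- by under eq_fun do rewrite ReCJ.
- by under eq_fun do rewrite ImCJ; exact: measurableT_comp.
Qed.

Lemma measCZ (c : R[i]) f : measC f -> measC (fun z => c * f z).
Proof. by apply: measCM; exact: measC_cst. Qed.

Lemma measCB f g : measC f -> measC g -> measC (fun z => f z - g z).
Proof.
move=> mf mg; rewrite (_ : (fun z => _) = fun z => f z + (-1) * g z).
  by apply: measCD => //; exact: measCZ.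
by apply/funext => z; rewrite mulN1r.
Qed.

Lemma measC_cabs2 f : measC f -> measurable_fun setT (fun z => cabs (f z) ^+ 2).
Proof.
move=> [fr fi]; under eq_fun do rewrite cabs2.
by apply: measurable_funD; exact: measurable_funX.
Qed.

Lemma measC_cabs f : measC f -> measurable_fun setT (fun z => cabs (f z)).
Proof.
move=> mf; rewrite (_ : (fun z => _) = Num.sqrt \o (fun z => cabs (f z) ^+ 2)).
  apply: measurableT_comp; last exact: measC_cabs2.
  by apply: continuous_measurable_fun; exact: sqrt_continuous.
by apply/funext => z /=; rewrite sqrtr_sqr ger0_norm ?cabs_ge0.
Qed.

Lemma rintegrable_le (f g : circle R -> R) : measurable_fun setT f ->
  (forall z, `|f z| <= g z) -> rintegrable g -> rintegrable f.
Proof.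
move=> mf fg ig; apply: le_integrable ig => //; first exact/measurable_EFinP.
by move=> z _ /=; rewrite lee_fin (le_trans (fg z))// ler_norm.
Qed.

Lemma rintegrableD (f g : circle R -> R) : rintegrable f -> rintegrable g ->
  rintegrable (fun z => f z + g z).
Proof. by move=> fi gi; exact: (integrableD measurableT fi gi). Qed.

Lemma rintegrableZ (c : R) (f : circle R -> R) : rintegrable f ->
  rintegrable (fun z => c * f z).
Proof. by move=> fi; exact: (integrableZl measurableT c fi). Qed.

Lemma rintegrable_cst (c : R) : rintegrable (fun=> c).
Proof. exact: finite_measure_integrable_cst. Qed.

Lemma rintegrable_bounded (f : circle R -> R) (M : R) : measurable_fun setT f ->
  (forall z, `|f z| <= M) -> rintegrable f.
Proof. by move=> mf fM; apply: rintegrable_le mf fM (rintegrable_cst M). Qed.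

Lemma L2P f : L2 mu f <-> measC f /\ rintegrable (fun z => cabs (f z) ^+ 2).
Proof.
split=> [[mr mi fi]|[[mr mi] /integrableP[_ fi]]]; split=> //.
- apply/integrableP; split; first by apply/measurable_EFinP; apply: measC_cabs2; split.
  under eq_integral do rewrite /= ger0_norm ?sqr_ge0//.
  exact: fi.
- move: fi; under eq_integral do rewrite /= ger0_norm ?sqr_ge0//.
  exact.
Qed.

Lemma norm2sqE f : L2 mu f -> norm2sq mu f = (nsq f)%:E.
Proof.
move=> /L2P[mf fi]; rewrite /nsq /Rintegral fineK//.
exact: integrable_fin_num fi.
Qed.

Lemma nsq_ge0 f : 0 <= nsq f.
Proof. by apply: Rintegral_ge0 => z _; exact: sqr_ge0. Qed.

Lemma L2_meas f : L2 mu f -> measC f. Proof. by case/L2P. Qed.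

Lemma L2_bounded f (M : R) : measC f -> (forall z, cabs (f z) <= M) -> L2 mu f.
Proof.
move=> mf fM; apply/L2P; split=> //.
apply: (@rintegrable_bounded _ (M ^+ 2)); first exact: measC_cabs2.
move=> z; rewrite ger0_norm ?sqr_ge0// -ler_cabs_sqr//.
exact: le_trans (cabs_ge0 _) (fM z).
Qed.

Lemma L2D f g : L2 mu f -> L2 mu g -> L2 mu (fun z => f z + g z).
Proof.
move=> /L2P[mf fi] /L2P[mg gi]; apply/L2P; split; first exact: measCD.
apply: rintegrable_le (rintegrableZ 2 (rintegrableD fi gi)).
- by apply: measC_cabs2; exact: measCD.
- by move=> z; rewrite ger0_norm ?sqr_ge0// cabs2D.
Qed.

Lemma L2M_bounded f g (M : R) : measC g -> (forall z, cabs (g z) <= M) ->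
  L2 mu f -> L2 mu (fun z => g z * f z).
Proof.
move=> mg gM /L2P[mf fi]; apply/L2P; split; first exact: measCM.
apply: rintegrable_le (rintegrableZ (M ^+ 2) fi).
- by apply: measC_cabs2; exact: measCM.
- move=> z; rewrite ger0_norm ?sqr_ge0// cabsM exprMn.
  apply: ler_wpM2r; rewrite ?sqr_ge0// -ler_cabs_sqr//.
  exact: le_trans (cabs_ge0 _) (gM z).
Qed.

Lemma L2Z (c : R[i]) f : L2 mu f -> L2 mu (fun z => c * f z).
Proof. by apply: (@L2M_bounded _ _ (cabs c)) => //; exact: measC_cst. Qed.

Lemma L2B f g : L2 mu f -> L2 mu g -> L2 mu (fun z => f z - g z).
Proof.
move=> lf lg; rewrite (_ : (fun z => _) = fun z => f z + (-1) * g z).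
  by apply: L2D => //; exact: L2Z.
by apply/funext => z; rewrite mulN1r.
Qed.

Lemma L2_cst (c : R[i]) : L2 mu (fun=> c).
Proof. by apply: (@L2_bounded _ (cabs c)) => //; exact: measC_cst. Qed.

Lemma L2_lincomb F (c : nat -> R[i]) n : (forall k, L2 mu (F k)) -> L2 mu (lincomb F c n).
Proof.
move=> LF; elim: n => [|n IH].
  by rewrite /lincomb; under eq_fun do rewrite big_ord0; exact: L2_cst.
rewrite (_ : lincomb F c n.+1 = fun z => lincomb F c n z + c n * F n z).
  by apply: L2D => //; exact: L2Z.
by apply/funext => z; rewrite /lincomb big_ord_recr.
Qed.

Lemma cabs_mul_le (z w : R[i]) : cabs z * cabs w <= 2^-1 * (cabs z ^+ 2 + cabs w ^+ 2).
Proof. by have := sqr_ge0 (cabs z - cabs w); rewrite sqrrB; lra. Qed.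

Definition integrableC f := rintegrable (fun z => Re (f z)) /\
  rintegrable (fun z => Im (f z)).

Lemma integrableC_le f (g : circle R -> R) : measC f ->
  (forall z, cabs (f z) <= g z) -> rintegrable g -> integrableC f.
Proof.
move=> [mr mi] fg ig; split; apply: rintegrable_le ig => // z.
- exact: le_trans (Re_le_cabs _) (fg z).
- exact: le_trans (Im_le_cabs _) (fg z).
Qed.

Lemma integrable_inner f g : L2 mu f -> L2 mu g -> integrableC (fun z => (f z)^*%C * g z).
Proof.
move=> /L2P[mf fi] /L2P[mg gi].
apply: (@integrableC_le _ (fun z => 2^-1 * (cabs (f z) ^+ 2 + cabs (g z) ^+ 2))).
- by apply: measCM => //; exact: measCJ.
- by move=> z; rewrite cabsM cabsJ cabs_mul_le.
- by apply: rintegrableZ; exact: rintegrableD.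
Qed.

Lemma integralCD f g : integrableC f -> integrableC g ->
  integralC mu (fun z => f z + g z) = integralC mu f + integralC mu g.
Proof.
move=> [fr fi] [gr gi]; apply: ext_complex; rewrite /integralC ?ReCD ?ImCD /=.
- by rewrite -RintegralD//; apply: eq_Rintegral => z _; rewrite ReCD.
- by rewrite -RintegralD//; apply: eq_Rintegral => z _; rewrite ImCD.
Qed.

Lemma integralCZ (c : R[i]) f : integrableC f ->
  integralC mu (fun z => c * f z) = c * integralC mu f.
Proof.
move=> [fr fi]; apply: ext_complex; rewrite /integralC ?ReCM ?ImCM /=.
- rewrite -!RintegralZl// -RintegralB//; [|exact: rintegrableZ..].
  by apply: eq_Rintegral => z _; rewrite ReCM.
- rewrite -!RintegralZl// -RintegralD//; [|exact: rintegrableZ..].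
  by apply: eq_Rintegral => z _; rewrite ImCM.
Qed.

Lemma integralCJ f : integrableC f ->
  integralC mu (fun z => (f z)^*%C) = (integralC mu f)^*%C.
Proof.
move=> [fr fi]; apply: ext_complex; rewrite /integralC ?ReCJ ?ImCJ /=.
- by apply: eq_Rintegral => z _; rewrite ReCJ.
- rewrite -mulN1r -RintegralZl//; apply: eq_Rintegral => z _.
  by rewrite ImCJ mulN1r.
Qed.

Lemma innerE f g : inner mu f g = integralC mu (fun z => (f z)^*%C * g z).
Proof. by []. Qed.

Lemma inner_conj f g : L2 mu f -> L2 mu g -> inner mu g f = (inner mu f g)^*%C.
Proof.
move=> lf lg; rewrite !innerE -integralCJ; last exact: integrable_inner.
by congr integralC; apply/funext => z; rewrite conjM conjcK mulrC.
Qed.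

Lemma innerDr f g h : L2 mu f -> L2 mu g -> L2 mu h ->
  inner mu f (fun z => g z + h z) = inner mu f g + inner mu f h.
Proof.
move=> lf lg lh; rewrite !innerE -integralCD; [|exact: integrable_inner..].
by congr integralC; apply/funext => z; rewrite mulrDr.
Qed.

Lemma innerZr (c : R[i]) f g : L2 mu f -> L2 mu g ->
  inner mu f (fun z => c * g z) = c * inner mu f g.
Proof.
move=> lf lg; rewrite !innerE -integralCZ; last exact: integrable_inner.
by congr integralC; apply/funext => z; rewrite mulrCA.
Qed.

Lemma innerBr f g h : L2 mu f -> L2 mu g -> L2 mu h ->
  inner mu f (fun z => g z - h z) = inner mu f g - inner mu f h.
Proof.
move=> lf lg lh; rewrite -mulN1r -innerZr// -innerDr//; last exact: L2Z.
by congr inner; apply/funext => z; rewrite mulN1r.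
Qed.

Lemma innerBl f g h : L2 mu f -> L2 mu g -> L2 mu h ->
  inner mu (fun z => g z - h z) f = inner mu g f - inner mu h f.
Proof.
move=> lf lg lh; rewrite inner_conj//; last exact: L2B.
by rewrite innerBr// conjB -!inner_conj.
Qed.

Lemma innerZl (c : R[i]) f g : L2 mu f -> L2 mu g ->
  inner mu (fun z => c * g z) f = c^*%C * inner mu g f.
Proof.
move=> lf lg; rewrite inner_conj//; last exact: L2Z.
by rewrite innerZr// conjM -inner_conj.
Qed.

Lemma inner_self f : L2 mu f -> inner mu f f = (nsq f)%:C.
Proof.
move=> lf; rewrite innerE /integralC /nsq; apply: ext_complex => /=.
- by apply: eq_Rintegral => z _; rewrite -cabs2C.
- rewrite (_ : (fun z => _) = fun=> 0); last by apply/funext => z; rewrite -cabs2C.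
  by rewrite Rintegral_cst// mul0r.
Qed.

Lemma nsqE f : L2 mu f -> nsq f = Re (inner mu f f).
Proof. by move=> lf; rewrite inner_self. Qed.

Lemma nsqB f g : L2 mu f -> L2 mu g ->
  nsq (fun z => f z - g z) = nsq f - 2 * Re (inner mu f g) + nsq g.
Proof.
move=> lf lg; have lfg := L2B lf lg.
rewrite nsqE// innerBr// !innerBl// (inner_conj lf lg) !inner_self//.
by rewrite !(ReCD,ReCN,ReCJ) /=; ring.
Qed.

Lemma nsqD_le f g : L2 mu f -> L2 mu g ->
  nsq (fun z => f z + g z) <= 2 * (nsq f + nsq g).
Proof.
move=> lf lg; have /L2P[_ h] := L2D lf lg.
move/L2P: lf => [_ fi]; move/L2P: lg => [_ gi].
rewrite /nsq -RintegralD// -RintegralZl//; last exact: rintegrableD.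
apply: le_Rintegral => //; first by apply: rintegrableZ; exact: rintegrableD.
by move=> z _; exact: cabs2D.
Qed.

Lemma nsqZ (c : R[i]) f : L2 mu f -> nsq (fun z => c * f z) = cabs c ^+ 2 * nsq f.
Proof.
move=> /L2P[_ fi]; rewrite /nsq -RintegralZl//.
by apply: eq_Rintegral => z _; rewrite cabsM exprMn.
Qed.

Lemma nsqC f g : nsq (fun z => f z - g z) = nsq (fun z => g z - f z).
Proof. by apply: eq_Rintegral => z _; rewrite cabsB. Qed.

Lemma nsq_triangle f g h : L2 mu f -> L2 mu g -> L2 mu h ->
  nsq (fun z => f z - h z) <= 2 * (nsq (fun z => f z - g z) + nsq (fun z => g z - h z)).
Proof.
move=> lf lg lh; apply: le_trans (nsqD_le (L2B lf lg) (L2B lg lh)).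
by rewrite le_eqVlt; apply/orP; left; apply/eqP; apply: eq_Rintegral => z _; rewrite addrA subrK.
Qed.

Lemma inner_CS f g : L2 mu f -> L2 mu g ->
  cabs (inner mu f g) ^+ 2 <= nsq f * nsq g.
Proof.
move=> lf lg; set s := inner mu f g.
have [->|s0] := eqVneq s 0.
  by rewrite cabs0 expr0n mulr_ge0 ?nsq_ge0.
apply: quad_disc; rewrite ?nsq_ge0// => t.
have cs0 : cabs s != 0 by apply: contra_neq s0; exact: cabs_eq0.
pose u := s^*%C / (cabs s)%:C.
have u1 : cabs u = 1.
  by rewrite cabsM cabsV cabsR cabsJ ger0_norm ?cabs_ge0// divff.
have us : u * s = (cabs s)%:C.
  rewrite /u mulrAC -cabs2C expr2 rmorphM mulfK// fmorph_eq0//.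
have : 0 <= nsq (fun z => t%:C * f z - u * g z) by exact: nsq_ge0.
rewrite nsqB; [|exact: L2Z..].
rewrite !nsqZ// u1 cabsR real_normK ?num_real// expr1n mul1r.
rewrite innerZr//; last exact: L2Z.
rewrite innerZl// mulrCA -/s us.
suff -> : Re ((t%:C)^*%C * (cabs s)%:C) = t * cabs s by rewrite mulrA.
by rewrite ReCM ReCJ ImCJ /=; ring.
Qed.

Section orthonormal_system.
Variable F : nat -> circle R -> R[i].
Hypothesis oF : Defs.orthonormal mu F.

Definition coef f k := inner mu (F k) f.

Lemma L2F k : L2 mu (F k). Proof. by case: oF. Qed.

Lemma inner_lincomb f (c : nat -> R[i]) n : L2 mu f ->
  inner mu f (lincomb F c n) = \sum_(k < n) c k * inner mu f (F k).
Proof.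
move=> lf; elim: n => [|n IH].
  rewrite big_ord0 /lincomb (_ : (fun z => _) = fun z => 0 * f z).
    by rewrite innerZr// mul0r.
  by apply/funext => z; rewrite big_ord0 mul0r.
rewrite (_ : lincomb F c n.+1 = fun z => lincomb F c n z + c n * F n z).
  rewrite innerDr//; [|exact: L2_lincomb L2F|by apply: L2Z; exact: L2F].
  by rewrite IH innerZr ?big_ord_recr//; exact: L2F.
by apply/funext => z; rewrite /lincomb big_ord_recr.
Qed.

Lemma inner_F_lincomb (c : nat -> R[i]) n k : (k < n)%N ->
  inner mu (F k) (lincomb F c n) = c k.
Proof.
move=> kn; rewrite inner_lincomb; last exact: L2F.
rewrite (bigD1 (Ordinal kn))//= big1 ?addr0 => [|j].
  by case: oF => _ ->; rewrite eqxx mulr1.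
rewrite -val_eqE /= => jk; case: oF => _ ->.
by rewrite eq_sym (negbTE jk) mulr0.
Qed.

Lemma nsq_lincomb (c : nat -> R[i]) n :
  nsq (lincomb F c n) = \sum_(k < n) cabs (c k) ^+ 2.
Proof.
have lF := L2_lincomb c n L2F.
rewrite nsqE// inner_lincomb//.
rewrite (_ : \sum_(k < n) _ = (\sum_(k < n) cabs (c k) ^+ 2)%:C)//.
rewrite rmorph_sum; apply: eq_bigr => k _.
by rewrite inner_conj//; [rewrite inner_F_lincomb// mulrC -cabs2C|exact: L2F].
Qed.

(** Completing the square: [d = coef f] gives Bessel's inequality, and any other [d] shows that the
    Fourier sum is the best approximation of its length. *)
Lemma nsq_approx f (d : nat -> R[i]) n : L2 mu f ->
  nsq (fun z => f z - lincomb F d n z) =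
  nsq f - \sum_(k < n) cabs (coef f k) ^+ 2 + \sum_(k < n) cabs (coef f k - d k) ^+ 2.
Proof.
move=> lf; rewrite nsqB ?nsq_lincomb//; last exact: L2_lincomb L2F.
rewrite inner_lincomb// Re_sum mulr_sumr -!addrA; congr (_ + _).
rewrite -!sumrN -!big_split /=; apply: eq_bigr => k _.
rewrite [inner mu f _]inner_conj//; last exact: L2F.
rewrite -/(coef f k) !cabs2 ReCM !(ReCD,ImCD,ReCN,ImCN,ReCJ,ImCJ).
by ring.
Qed.

Lemma bessel f : L2 mu f -> l2le (coef f) (nsq f).
Proof.
move=> lf n; have := nsq_approx (coef f) n lf.
rewrite [X in _ + X]big1 ?addr0 => [|k _]; last by rewrite subrr cabs0 expr0n.
by move=> e; rewrite -subr_ge0 -e nsq_ge0.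
Qed.

Lemma nsq_proj f n : L2 mu f -> nsq (fun z => f z - lincomb F (coef f) n z) =
  nsq f - \sum_(k < n) cabs (coef f k) ^+ 2.
Proof.
move=> lf; rewrite nsq_approx// [X in _ + X]big1 ?addr0// => k _.
by rewrite subrr cabs0 expr0n.
Qed.

Lemma closure_proj f : L2closure mu (Defs.span F) f -> forall e : R, 0 < e ->
  exists N, forall n, (N <= n)%N ->
    nsq (fun z => f z - lincomb F (coef f) n z) <= e.
Proof.
move=> [lf h] e e0.
have s0 : 0 < Num.sqrt e by rewrite sqrtr_gt0.
have [_ [N _ [c ->]]] := h _ s0.
rewrite norm2sqE; last by apply: L2B => //; exact: L2_lincomb L2F.
rewrite lte_fin sqr_sqrtr ?(ltW e0)// nsq_approx// => hc.
exists N => n Nn; rewrite nsq_proj//.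
have h1 := sum_cabs2_mono (coef f) Nn.
have h2 := sum_cabs2_ge0 N (fun k => coef f k - c k).
by lra.
Qed.

Lemma closure_of_coef f : L2 mu f ->
  (forall e : R, 0 < e -> exists n, nsq f - \sum_(k < n) cabs (coef f k) ^+ 2 < e) ->
  L2closure mu (Defs.span F) f.
Proof.
move=> lf h; split=> // e e0.
have [n hn] := h _ (exprn_gt0 2 e0).
exists (lincomb F (coef f) n); first by exists n => //; exists (coef f).
rewrite norm2sqE; last by apply: L2B => //; exact: L2_lincomb L2F.
by rewrite lte_fin nsq_proj.
Qed.

(** The partial sums are the inner products of the Fourier sums of [f] with [g], and these Fourier
    sums converge to [f] in norm. *)
Lemma parseval f g : L2closure mu (Defs.span F) f -> L2 mu g ->
  hsum (fun k => (coef f k)^*%C * coef g k) (inner mu f g).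
Proof.
move=> cf lg; have lf : L2 mu f by case: cf.
apply/cvgrPdist_le => e e0.
pose d := e ^+ 2 / (nsq g + 1).
have d0 : 0 < d by rewrite divr_gt0 ?exprn_gt0// ltr_wpDl ?nsq_ge0.
have [N hN] := closure_proj cf d0.
exists N => // n /= Nn.
rewrite sub0r normrN ger0_norm ?cabs_ge0// cabsB.
have -> : \sum_(k < n) (coef f k)^*%C * coef g k = inner mu (lincomb F (coef f) n) g.
  have lF := L2_lincomb (coef f) n L2F.
  rewrite inner_conj// inner_lincomb// bigC_conj; apply: eq_bigr => k _.
  by rewrite conjM -inner_conj//; exact: L2F.
have lF := L2_lincomb (coef f) n L2F.
rewrite -innerBl// ler_cabs_sqr ?(ltW e0)//.
apply: le_trans (inner_CS (L2B lf lF) lg) _.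
apply: (@le_trans _ _ (d * nsq g)); first by apply: ler_wpM2r; rewrite ?nsq_ge0// hN.
rewrite /d mulrAC ler_pdivrMr ?ltr_wpDl ?nsq_ge0// ler_wpM2l ?sqr_ge0//.
by rewrite lerDl.
Qed.

End orthonormal_system.

Lemma L2closureP S f : (forall g, S g -> L2 mu g) -> L2closure mu S f <->
  L2 mu f /\ forall e : R, 0 < e -> exists2 g, S g & nsq (fun z => f z - g z) < e.
Proof.
move=> SL; split=> -[lf h]; split=> // e e0.
- have s0 : 0 < Num.sqrt e by rewrite sqrtr_gt0.
  have [g Sg] := h _ s0.
  rewrite norm2sqE; last by apply: L2B => //; exact: SL.
  by rewrite lte_fin sqr_sqrtr ?(ltW e0)//; exists g.
- have [g Sg hg] := h _ (exprn_gt0 2 e0); exists g => //.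
  rewrite norm2sqE; last by apply: L2B => //; exact: SL.
  by rewrite lte_fin.
Qed.

End hilbert.

(** * Bounded Borel functions on the circle *)

Section borel_circle.
Context {R : realType}.
Implicit Types (f g h : circle R -> R[i]) (A : set (circle R)).

Lemma measurable_circle_open A : open A -> measurable A.
Proof. by move=> oA; exact: sub_sigma_algebra. Qed.

Lemma open_circleP A : open A <->
  exists2 B : set (R * R), open B & A = [set z : circle R | B (Re z, Im z)].
Proof. by split=> [[B oB <-]|[B oB ->]]; exists B. Qed.

Lemma measurable_Re : measurable_fun setT (fun z : circle R => Re z).
Proof.
apply: (measurability (@RGenOpens.G R)); first exact: RGenOpens.measurableE.
move=> _ [_ [x [y ->]] <-]; rewrite setTI; apply: measurable_circle_open.
apply/open_circleP; exists (fst @^-1` `]x, y[%classic) => //.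
by apply: open_comp; [move=> -[? ?] _; exact: cvg_fst|exact: interval_open].
Qed.

Lemma measurable_Im : measurable_fun setT (fun z : circle R => Im z).
Proof.
apply: (measurability (@RGenOpens.G R)); first exact: RGenOpens.measurableE.
move=> _ [_ [x [y ->]] <-]; rewrite setTI; apply: measurable_circle_open.
apply/open_circleP; exists (snd @^-1` `]x, y[%classic) => //.
by apply: open_comp; [move=> -[? ?] _; exact: cvg_snd|exact: interval_open].
Qed.

Lemma measC_id : measC (fun z : circle R => z : R[i]).
Proof. by split; [exact: measurable_Re|exact: measurable_Im]. Qed.

Lemma cabs_circle (z : circle R) : cabs z = 1.
Proof.
have /eqP := valP z; rewrite -cabsE -[1]/((1 : R)%:C) => /(congr1 (@complex.Re R)).
exact.
Qed.

Definition indC A : circle R -> R[i] := fun z => (\1_A z : R)%:C.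

Lemma measC_indC A : measurable A -> measC (indC A).
Proof.
move=> mA; split; last exact: measurable_cst.
exact: measurable_indic.
Qed.

(** The common bound supplies the dominating constant, so that integrals against any probability
    follow the limit. *)
Definition bplim (F : nat -> circle R -> R[i]) f : Prop :=
  (exists M : R, forall n z, cabs (F n z) <= M) /\
  forall z, cvgC (F ^~ z) (f z).

(** By Bernoulli the distance to 1 is at most [n (2 g)^n]. The exponent [n 2^n] is tuned so that
    this quantity tends to 0 below 1/2 and is at least [n] from 1/2 on. *)
Lemma pow_step_lt (g : R) : 0 <= g -> g < 2^-1 ->
  ((1 - g ^+ n) ^+ (n * 2 ^ n)%N) @[n --> \oo] --> (1 : R).
Proof.
(* Writing [(2 g)^n = p^n p^n], one factor absorbs [n], because [n p^n] is at most the geometric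
   sum, and the other tends to 0. *)
move=> g0 g1; pose q := 2 * g; pose p := Num.sqrt q.
have q0 : 0 <= q by rewrite mulr_ge0.
have q1 : q < 1 by rewrite /q; lra.
have p0 : 0 <= p by exact: sqrtr_ge0.
have p1 : p < 1 by rewrite -sqrtr1 ltr_sqrt.
have np n : n%:R * p ^+ n <= (1 - p)^-1.
  have h : n%:R * p ^+ n <= \sum_(k < n) p ^+ k.
    rewrite mulr_natl -[n in p ^+ _ *+ n]card_ord -sumr_const.
    by apply: ler_sum => k _; apply: ler_wiXn2l; rewrite ?(ltW p1)// ltnW.
  apply: le_trans h _; rewrite -[leRHS]mul1r ler_pdivlMr ?subr_gt0//.
  rewrite mulrC -[1 - p]opprB mulNr -subrX1 opprB.
  by rewrite gerBl exprn_ge0.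
apply: (@squeeze_cvgr _ _ _ _ (fun n => 1 - (1 - p)^-1 * p ^+ n) (fun=> 1)).
- apply: nearW => n; apply/andP; split; last first.
    rewrite exprn_ile1 ?gerBl ?exprn_ge0// subr_ge0 exprn_ile1//; lra.
  apply: (@le_trans _ _ (1 - (n * 2 ^ n)%:R * g ^+ n)).
    rewrite lerB// natrM natrX -mulrA -exprMn -/q -(sqr_sqrtr q0) -/p exprAC expr2 mulrA.
    by apply: ler_wpM2r; rewrite ?exprn_ge0.
  have gn1 : g ^+ n <= 1 by apply: exprn_ile1 => //; lra.
  elim: (n * 2 ^ n)%N => [|m IH]; first by rewrite mul0r subr0.
  rewrite exprS -natr1 mulrDl mul1r.
  have := ler_wpM2l (_ : 0 <= 1 - g ^+ n) IH; rewrite subr_ge0 => /(_ gn1); apply: le_trans.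
  have : 0 <= m%:R * g ^+ n * g ^+ n by rewrite !mulr_ge0 ?exprn_ge0.
  lra.
- rewrite -[X in _ --> X]subr0; apply: cvgB; first exact: cvg_cst.
  rewrite -(mulr0 (1 - p)^-1); apply: cvgM; first exact: cvg_cst.
  by apply: cvg_expr; rewrite ger0_norm.
- exact: cvg_cst.
Qed.

(** Here [(1 - x)^m (1 + m x) <= 1] is used with [m x = n (2 g)^n >= n], whence the bound
    [1 / (n + 1)]. *)
Lemma pow_step_ge (g : R) : 2^-1 <= g -> g <= 1 ->
  ((1 - g ^+ n) ^+ (n * 2 ^ n)%N) @[n --> \oo] --> (0 : R).
Proof.
move=> g0 g1; have gp : 0 <= g by rewrite (le_trans _ g0).
apply: (@squeeze_cvgr _ _ _ _ (fun=> 0) (@harmonic R)).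
- apply: nearW => n.
  have gn0 : 0 <= g ^+ n by rewrite exprn_ge0.
  have gn1 : g ^+ n <= 1 by rewrite exprn_ile1.
  rewrite exprn_ge0 ?subr_ge0//=.
  have bern m : (1 - g ^+ n) ^+ m * (1 + m%:R * g ^+ n) <= 1.
    elim: m => [|m IH]; first by rewrite mul0r addr0 mulr1.
    rewrite exprS mulrAC -natr1.
    have h : (1 - g ^+ n) * (1 + (m%:R + 1) * g ^+ n) <= 1 + m%:R * g ^+ n.
      have : 0 <= (m%:R + 1) * g ^+ n * g ^+ n by rewrite !mulr_ge0 ?addr_ge0.
      lra.
    rewrite mulrC; apply: le_trans IH.
    by apply: ler_wpM2l => //; rewrite exprn_ge0 ?subr_ge0.
  have := bern (n * 2 ^ n)%N.
  have h : n.+1%:R <= 1 + (n * 2 ^ n)%:R * g ^+ n.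
    rewrite -natr1 addrC lerD2l natrM natrX -mulrA -exprMn ler_peMr//.
    by rewrite exprn_ege1//; lra.
  move=> b; rewrite /harmonic/= -[leRHS]mul1r ler_pdivlMr ?ltr0n//.
  apply: le_trans b; apply: ler_wpM2l => //.
  by rewrite exprn_ge0 ?subr_ge0.
- exact: cvg_cst.
- exact: cvg_harmonic.
Qed.

Section multiplicative_system.
Variable H : set (circle R -> R[i]).
Hypotheses (H_bnd : forall f, H f -> exists M : R, forall z, cabs (f z) <= M)
  (H_lim : forall (F : nat -> circle R -> R[i]) f, (forall n, H (F n)) -> bplim F f -> H f)
  (H_add : forall f g, H f -> H g -> H (fun z => f z + g z))
  (H_scale : forall c f, H f -> H (fun z => c * f z))
  (H_1 : H (fun=> 1))
  (H_z : forall f, H f -> H (fun z => circle_val z * f z))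
  (H_zJ : forall f, H f -> H (fun z => (circle_val z)^*%C * f z)).

(* The multipliers of [H] form an algebra that is closed under bounded
   pointwise limits. *)
Let Mu f := forall g, H g -> H (fun z => f z * g z).

Let Mu_H f : Mu f -> H f.
Proof. by move=> /(_ _ H_1); under eq_fun do rewrite mulr1. Qed.

Let Mu_add f g : Mu f -> Mu g -> Mu (fun z => f z + g z).
Proof.
move=> mf mg h Hh; under eq_fun do rewrite mulrDl.
by apply: H_add; [exact: mf|exact: mg].
Qed.

Let Mu_mul f g : Mu f -> Mu g -> Mu (fun z => f z * g z).
Proof.
move=> mf mg h Hh; under eq_fun do rewrite -mulrA.
by apply: mf; exact: mg.
Qed.

Let Mu_scale c f : Mu f -> Mu (fun z => c * f z).
Proof.
move=> mf h Hh; under eq_fun do rewrite -mulrA.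
by apply: H_scale; exact: mf.
Qed.

Let Mu_1 : Mu (fun=> 1).
Proof. by move=> h Hh; under eq_fun do rewrite mul1r. Qed.

Let Mu_cst c : Mu (fun=> c).
Proof. by have := Mu_scale c Mu_1; under eq_fun do rewrite mulr1. Qed.

Let Mu_sub f g : Mu f -> Mu g -> Mu (fun z => f z - g z).
Proof.
move=> mf mg; rewrite (_ : (fun z => _) = fun z => f z + (-1) * g z).
  by apply: Mu_add => //; exact: Mu_scale.
by apply/funext => z; rewrite mulN1r.
Qed.

Let Mu_exp f n : Mu f -> Mu (fun z => f z ^+ n).
Proof.
move=> mf; elim: n => [|n IH]; first exact: Mu_1.
by under eq_fun do rewrite exprS; exact: Mu_mul.
Qed.

Let Mu_lim (F : nat -> circle R -> R[i]) f :
  (forall n, Mu (F n)) -> bplim F f -> Mu f.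
Proof.
move=> mf [[M fM] ff] g Hg; apply: (H_lim (F := fun n z => F n z * g z)).
  by move=> n; exact: mf.
have [N gN] := H_bnd Hg; split.
  exists (M * N) => n z; rewrite cabsM; apply: ler_pM; rewrite ?cabs_ge0//.
by move=> z; under eq_fun do rewrite mulrC; rewrite mulrC; exact: cvgCZ.
Qed.

Let Mu_Re : Mu (fun z => (Re z)%:C).
Proof.
have h : Mu (fun z : circle R => 2^-1 * (circle_val z + (circle_val z)^*%C)).
  by apply: Mu_scale; apply: Mu_add => g Hg; [exact: H_z|exact: H_zJ].
rewrite (_ : (fun z => _) = fun z : circle R => 2^-1 * (circle_val z + (circle_val z)^*%C))//.
by apply/funext => z; rewrite addcJ mulrA mulVf ?mul1r// pnatr_eq0.
Qed.

Let Mu_Im : Mu (fun z => (Im z)%:C).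
Proof.
have h : Mu (fun z : circle R => (- 2^-1 * 'i%C) * (circle_val z - (circle_val z)^*%C)).
  by apply: Mu_scale; apply: Mu_sub => g Hg; [exact: H_z|exact: H_zJ].
rewrite (_ : (fun z => _) = fun z : circle R => (- 2^-1 * 'i%C) * (circle_val z - (circle_val z)^*%C))//.
apply/funext => z; case: (circle_val z) => x y /=.
rewrite (_ : _ - _ = 2 * ('i%C * y%:C)).
  transitivity (- (2^-1 * 2) * ('i%C * 'i%C) * y%:C); last by ring.
  rewrite mulVf ?pnatr_eq0//.
  by apply: ext_complex; rewrite !(ReCM,ImCM,ReCN,ImCN) /=; ring.
apply: ext_complex; rewrite !(ReCM,ImCM,ReCN,ImCN,ReCD,ImCD) /=; ring.
Qed.

(* [1_{x < c}] is the pointwise limit of [(1 - g^n)^(n 2^n)] with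
   [g = 1/2 + (x - c)/4], which takes its values in [0, 1] when [-1 <= x, c <= 1]. *)
Let Mu_lt (x : circle R -> R) (c : R) : Mu (fun z => (x z)%:C) ->
  (forall z, `|x z| <= 1) -> Mu (indC [set z | x z < c]).
Proof.
move=> mx x1; have [c1|c1] := ltP 1 c.
  rewrite (_ : indC _ = fun=> 1)//; apply/funext => z; rewrite /indC indicE mem_set//=.
  by apply: le_lt_trans c1; have := x1 z; rewrite ler_norml => /andP[].
have [c2|c2] := leP c (-1).
  rewrite (_ : indC _ = fun=> 0); first exact: Mu_cst.
  apply/funext => z; rewrite /indC indicE memNset//=; apply/negP; rewrite -leNgt.
  by apply: le_trans c2 _; have := x1 z; rewrite ler_norml => /andP[].
pose g z : R := 2^-1 + (x z - c) / 4.
have g01 z : 0 <= g z <= 1.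
  by have := x1 z; rewrite ler_norml /g => /andP[? ?]; apply/andP; split; lra.
have mg : Mu (fun z => (g z)%:C).
  rewrite (_ : (fun z => _) = fun z => (2^-1 - c / 4)%:C + (4^-1)%:C * (x z)%:C).
    by apply: Mu_add; [exact: Mu_cst|exact: Mu_scale].
  by apply/funext => z; rewrite -rmorphM -rmorphD /g; congr (_%:C); field.
apply: (Mu_lim (F := fun n z => (1 - (g z)%:C ^+ n) ^+ (n * 2 ^ n)%N)).
  by move=> n; apply: Mu_exp; apply: Mu_sub; [exact: Mu_1|exact: Mu_exp].
have E n z : (1 - (g z)%:C ^+ n) ^+ (n * 2 ^ n)%N = ((1 - g z ^+ n) ^+ (n * 2 ^ n)%N)%:C.
  by rewrite rmorphXn rmorphB rmorph1 rmorphXn.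
split.
  exists 1 => n z; rewrite E cabsR; have /andP[h0 h1] := g01 z.
  by rewrite ger0_norm ?exprn_ge0 ?exprn_ile1 ?subr_ge0 ?gerBl ?exprn_ge0 ?exprn_ile1.
move=> z; apply: cvgC_ReIm; under eq_fun do rewrite E /=; last first.
  exact: cvg_cst.
have /andP[h0 h1] := g01 z.
rewrite /indC /= indicE; have [xc|cx] := ltP (x z) c.
  rewrite mem_set//; apply: pow_step_lt => //; rewrite /g; lra.
rewrite memNset/=; last by apply/negP; rewrite -leNgt.
apply: pow_step_ge => //; rewrite /g; lra.
Qed.

Let S := [set A : set (circle R) | Mu (indC A)].

Let SC A : S A -> S (~` A).
Proof.
rewrite /S /=; move=> SA; rewrite (_ : indC (~` A) = fun z => 1 - indC A z).
  by apply: Mu_sub => //; exact: Mu_1.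
apply/funext => z; rewrite /indC indicC indicE.
by case: (_ \in A); rewrite /= ?subrr ?subr0.
Qed.

Let SI A B : S A -> S B -> S (A `&` B).
Proof.
rewrite /S /=; move=> SA SB; rewrite (_ : indC (A `&` B) = fun z => indC A z * indC B z).
  exact: Mu_mul.
by apply/funext => z; rewrite /indC indicI rmorphM.
Qed.

Let SU A B : S A -> S B -> S (A `|` B).
Proof. by move=> SA SB; rewrite -[A `|` B]setCK setCU; apply: SC; apply: SI; exact: SC. Qed.

Let S0 : S set0.
Proof.
rewrite /S /= (_ : indC set0 = fun=> 0); first exact: Mu_cst.
by apply/funext => z; rewrite /indC indic0.
Qed.

Let S_bigcup (F : nat -> set (circle R)) : (forall n, S (F n)) -> S (\bigcup_n F n).
Proof.
move=> SF; rewrite /S /=.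
apply: (Mu_lim (F := fun n => indC (\big[setU/set0]_(k < n) F k))).
  move=> n; suff : S (\big[setU/set0]_(k < n) F k) by [].
  elim: n => [|n IH]; first by rewrite big_ord0; exact: S0.
  by rewrite big_ord_recr /=; exact: SU.
split.
  exists 1 => n z; rewrite cabsR indicE; case: (_ \in _); rewrite ?normr1 ?normr0//.
move=> z; apply: cvg_near_cst.
have [[n _ Fnz]|nF] := pselect ((\bigcup_n F n) z).
  exists n.+1 => // m /= nm; rewrite /indC !indicE !mem_set ?subrr ?cabs0//.
    by exists n.
  by rewrite -bigcup_mkord; exists n.
apply: nearW => m; rewrite /indC !indicE !memNset ?subrr ?cabs0//.
by rewrite -bigcup_mkord => -[k _ Fkz]; apply: nF; exists k.
Qed.

Let norm_Re (z : circle R) : `|Re z| <= 1.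
Proof. by rewrite -(cabs_circle z) Re_le_cabs. Qed.

Let norm_Im (z : circle R) : `|Im z| <= 1.
Proof. by rewrite -(cabs_circle z) Im_le_cabs. Qed.

(** [Mu_lt] gives strict upper bounds; [a < x] is the union over [n] of the complements of
    [x < a + 1/(n+1)]. *)
Let S_itv (x : circle R -> R) (a b : R) : Mu (fun z => (x z)%:C) ->
  (forall z, `|x z| <= 1) -> S [set z | a < x z < b].
Proof.
move=> mx x1.
rewrite (_ : [set z | _] = \bigcup_n (~` [set z | x z < a + n.+1%:R^-1] `&` [set z | x z < b])).
  by apply: S_bigcup => n; apply: SI; [apply: SC; exact: Mu_lt|exact: Mu_lt].
apply/seteqP; split=> z /=.
- move=> /andP[az zb]; exists (Num.truncn (x z - a)^-1) => //=; split=> //.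
  apply/negP; rewrite -leNgt -lerBrDl invf_ple ?posrE ?subr_gt0//.
  by rewrite ltW// truncnS_gt.
- move=> [n _ /= [/negP]]; rewrite -leNgt => h zb; rewrite zb andbT.
  by apply: lt_le_trans h; rewrite ltrDl invr_gt0.
Qed.

(** [A] is the union of the rational boxes that it contains. They are enumerated by [unpickle], the
    remaining indices contributing the empty set. *)
Let S_open A : open A -> S A.
Proof.
move=> /open_circleP[B oB AB].
pose box (r : rat * rat * rat * rat) := [set z : circle R |
  ratr r.1.1.1 < Re z < ratr r.1.1.2] `&` [set z : circle R | ratr r.1.2 < Im z < ratr r.2].
pose F n := if unpickle n is Some r then
  (if `[< box r `<=` A >] then box r else set0) else set0.
rewrite (_ : A = \bigcup_n F n).
  apply: S_bigcup => n; rewrite /F; case: unpickle => [r|]; last exact: S0.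
  case: ifP => _; last exact: S0.
  by apply: SI; apply: S_itv; [exact: Mu_Re|exact: norm_Re|exact: Mu_Im|exact: norm_Im].
apply/seteqP; split=> z; last first.
  by move=> [n _]; rewrite /F; case: unpickle => // r; case: asboolP => // h; exact: h.
move=> Az; have Bz : B (Re z, Im z) by move: Az; rewrite AB.
have [e e0 eB] : exists2 e : R, 0 < e & forall x y : R, `|Re z - x| < e -> `|Im z - y| < e -> B (x, y).
  have := open_nbhs_nbhs (conj oB Bz); move=> /nbhs_ballP[e e0 eB]; exists e => // x y xe ye.
  by apply: eB; split.
have near_rat (t : R) : exists p q : rat, t - e < ratr p /\ ratr p < t /\ t < ratr q /\ ratr q < t + e.
  have [|p] := @rat_in_itvoo R (t - e) t; first by lra.
  rewrite in_itv /= => /andP[p1 p2].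
  have [|q] := @rat_in_itvoo R t (t + e); first by lra.
  by rewrite in_itv /= => /andP[q1 q2]; exists p, q.
have [p1 [q1 [h1 [h2 [h3 h4]]]]] := near_rat (Re z).
have [p2 [q2 [k1 [k2 [k3 k4]]]]] := near_rat (Im z).
pose r : rat * rat * rat * rat := (p1, q1, p2, q2).
move: (pickle r) (pickleK r) => m mK; exists m; first exact: I.
rewrite /F mK.
rewrite asboolT; first by split=> /=; apply/andP; split.
move=> w [/= /andP[w1 w2] /andP[w3 w4]]; rewrite AB; apply: eB.
- by rewrite ltr_norml; apply/andP; split; lra.
- by rewrite ltr_norml; apply/andP; split; lra.
Qed.

Lemma indC_in_system A : measurable A -> H (indC A).
Proof.
move=> mA; apply: Mu_H; suff : S A by [].
(* Borel measurability is membership in every sigma-algebra that contains the open sets; [S] is one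
   of them. *)
apply: mA; split; last by move=> B /= oB; exact: S_open.
split; first exact: S0.
- by move=> B SB; rewrite setTD; exact: SC.
- by move=> F SF; exact: S_bigcup.
Qed.

End multiplicative_system.

Section bounded_functions.
Variable H : set (circle R -> R[i]).
Hypotheses (H_lim : forall (F : nat -> circle R -> R[i]) f, (forall n, H (F n)) -> bplim F f -> H f)
  (H_add : forall f g, H f -> H g -> H (fun z => f z + g z))
  (H_scale : forall c f, H f -> H (fun z => c * f z))
  (H_ind : forall A, measurable A -> H (indC A)).

(** The sum counts the integers from 1 to [n] that do not exceed [x], which is the integer part of
    [x]. *)
Lemma count_dist (x : R) n : 0 <= x <= n%:R ->
  `|\sum_(k < n) (k.+1%:R <= x :> R)%:R - x| <= 1.
Proof.
elim: n => [|n IH] /andP[x0 xn].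
  have -> : x = 0 by apply/eqP; rewrite eq_le x0 andbT.
  by rewrite big_ord0 subrr normr0.
rewrite big_ord_recr /=; have [xn'|nx] := leP x n%:R.
  rewrite [_ <= x]leNgt (le_lt_trans xn') ?ltr_nat// addr0.
  by apply: IH; rewrite x0.
rewrite (eq_bigr (fun=> 1)) => [|k _]; last first.
  by rewrite (le_trans _ (ltW nx))// ler_nat.
rewrite sumr_const card_ord.
have [nx'|_] := leP n.+1%:R x.
  have -> : x = n.+1%:R by apply/eqP; rewrite eq_le nx' xn.
  by rewrite natr1 subrr normr0.
rewrite addr0 ler_norml; apply/andP; split; first by rewrite -natr1 in xn; lra.
by rewrite lerBlDr; lra.
Qed.

Let H_sum n (F : nat -> circle R -> R[i]) : (forall k, H (F k)) ->
  H (fun z => \sum_(k < n) F k z).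
Proof.
move=> HF; elim: n => [|n IH].
  under eq_fun do rewrite big_ord0; have := H_scale 0 (HF 0%N).
  by under eq_fun do rewrite mul0r.
by under eq_fun do rewrite big_ord_recr /=; exact: H_add.
Qed.

(* [f] is the uniform limit of its layer-cake sums
   [(1/n) sum_(1 <= k <= n) 1_{n f >= k}]. *)
Let H_unit (f : circle R -> R) : measurable_fun setT f ->
  (forall z, 0 <= f z <= 1) -> H (fun z => (f z)%:C).
Proof.
move=> mf f01.
pose A n k := [set z | k.+1%:R <= n.+1%:R * f z].
have mA n k : measurable (A n k).
  rewrite (_ : A n k = f @^-1` `[k.+1%:R / n.+1%:R, +oo[%classic).
    by rewrite -[X in measurable X]setTI; exact: mf.
  by apply/seteqP; split=> z; rewrite /A /= in_itv /= andbT ler_pdivrMr ?ltr0n// mulrC.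
pose s n z : R := n.+1%:R^-1 * \sum_(k < n.+1) (k.+1%:R <= n.+1%:R * f z :> R)%:R.
have sE n : (fun z => (s n z)%:C) = fun z => (n.+1%:R^-1 : R)%:C * \sum_(k < n.+1) indC (A n k) z.
  apply/funext => z; rewrite /s rmorphM rmorph_sum; congr (_ * _).
  apply: eq_bigr => k _; rewrite /indC indicE /A; congr ((nat_of_bool _)%:R%:C).
  by apply/idP/idP => [h|/set_mem//]; rewrite mem_set.
have sd n z : `|s n z - f z| <= n.+1%:R^-1.
  have -> : s n z - f z = n.+1%:R^-1 * (\sum_(k < n.+1) (k.+1%:R <= n.+1%:R * f z :> R)%:R - n.+1%:R * f z).
    by rewrite mulrBr mulrA mulVf ?mul1r ?pnatr_eq0.
  rewrite normrM gtr0_norm ?invr_gt0// -[leRHS]mulr1; apply: ler_wpM2l => //.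
  apply: count_dist; have /andP[h0 h1] := f01 z.
  by rewrite mulr_ge0//= ler_piMr.
apply: (H_lim (F := fun n z => (s n z)%:C)).
  move=> n; rewrite sE; apply: H_scale.
  by apply: (@H_sum n.+1 (fun k => indC (A n k))) => k; exact: H_ind.
split.
  exists 2 => n z; rewrite cabsR -[s n z](subrK (f z)).
  apply: le_trans (ler_normD _ _) _.
  have h := sd n z; have /andP[h0 h1] := f01 z; rewrite (ger0_norm h0).
  have n1 : n.+1%:R^-1 <= 1 :> R by rewrite invf_le1 ?ler1n.
  by rewrite -[2]/(1 + 1); apply: lerD => //; exact: le_trans h n1.
move=> z; apply: (@squeeze_cvgr _ _ _ _ (fun=> 0) (@harmonic R)).
- by apply: nearW => n; rewrite -rmorphB cabsR normr_ge0 sd.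
- exact: cvg_cst.
- exact: cvg_harmonic.
Qed.

Let H_real (f : circle R -> R) (M : R) : measurable_fun setT f ->
  (forall z, `|f z| <= M) -> H (fun z => (f z)%:C).
Proof.
move=> mf fM.
have M0 : 0 <= M by exact: le_trans (normr_ge0 _) (fM (circle_one R)).
have M1 : 0 < M + 1 by rewrite ltr_wpDl.
have h : H (fun z => ((f z + M) / (2 * (M + 1)))%:C).
  apply: H_unit.
    apply: measurable_funM; last exact: measurable_cst.
    by apply: measurable_funD => //; exact: measurable_cst.
  move=> z; have := fM z; rewrite ler_norml => /andP[h1 h2].
  rewrite divr_ge0 ?mulr_ge0 ?(ltW M1)//=; last by rewrite -lerBlDr sub0r.
  rewrite ler_pdivrMr ?mulr_gt0//; lra.
have h1 : H (fun z => 1).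
  have := H_ind (@measurableT _ (circle R)); congr (H _).
  by apply/funext => z; rewrite /indC indicT.
have := H_add (H_scale (2 * (M + 1))%:C h) (H_scale (- M)%:C h1).
congr (H _); apply/funext => z; rewrite mulr1 -rmorphM -rmorphD; congr (_%:C).
by field; rewrite gt_eqF.
Qed.

Lemma bounded_in_system f (M : R) : measC f -> (forall z, cabs (f z) <= M) -> H f.
Proof.
move=> [mr mi] fM.
have hr := H_real mr (fun z => le_trans (Re_le_cabs _) (fM z)).
have hi := H_real mi (fun z => le_trans (Im_le_cabs _) (fM z)).
have := H_add hr (H_scale 'i%C hi); congr (H _).
by apply/funext => z; rewrite -complexE.
Qed.

End bounded_functions.

End borel_circle.

(** * Dominated convergence for real, complex and [L^2]-valued limits *)

Section convergence_theorems.
Context {R : realType} (mu : probability (circle R) R).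
Implicit Types (f g h : circle R -> R[i]).

Lemma rint_dct (F : nat -> circle R -> R) (f g : circle R -> R) :
  (forall n, measurable_fun setT (F n)) ->
  (forall z, F n z @[n --> \oo] --> f z) ->
  (forall n z, `|F n z| <= g z) -> rintegrable mu g ->
  rintegrable mu f /\ (\int[mu]_z F n z)%R @[n --> \oo] --> (\int[mu]_z f z)%R.
Proof.
move=> mF Ff Fg ig.
have mf : measurable_fun setT f.
  by apply: (measurable_fun_cvg mF) => z _; exact: Ff.
have [||||| fi _ cv] := @dominated_convergence _ _ _ mu _ measurableT
  (fun n => EFin \o F n) (EFin \o f) (EFin \o g).
- by move=> n; exact/measurable_EFinP.
- exact/measurable_EFinP.
- by apply: aeW => z _; apply: cvg_EFin; [exact: nearW|exact: Ff].
- exact: ig.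
- by apply: aeW => z n _ /=; rewrite lee_fin.
split=> //.
have E (u : circle R -> R) : rintegrable mu u ->
    (\int[mu]_z (EFin \o u) z)%E = ((\int[mu]_z u z)%R)%:E.
  by move=> iu; rewrite /Rintegral fineK//; exact: integrable_fin_num iu.
have iF n : rintegrable mu (F n) by exact: rintegrable_le (mF n) (Fg n) ig.
move: cv; rewrite E// => /fine_cvg; apply: cvg_trans; apply: near_eq_cvg.
by apply: nearW => n; rewrite /= E.
Qed.

Lemma cvgC_cabs2 (u : nat -> R[i]) s : cvgC u s ->
  cabs (u n - s) ^+ 2 @[n --> \oo] --> (0 : R).
Proof.
move=> us; under eq_fun do rewrite expr2.
have -> : (0 : R) = 0 * 0 by rewrite mulr0.
exact: cvgM.
Qed.

Lemma measC_cvg (F : nat -> circle R -> R[i]) f : (forall n, measC (F n)) ->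
  (forall z, cvgC (F ^~ z) (f z)) -> measC f.
Proof.
move=> mF Ff; split.
- apply: (@measurable_fun_cvg _ _ _ _ (fun n z => Re (F n z))) => [m|z _].
    by case: (mF m).
  exact: (cvgC_Re (Ff z)).
- apply: (@measurable_fun_cvg _ _ _ _ (fun n z => Im (F n z))) => [m|z _].
    by case: (mF m).
  exact: (cvgC_Im (Ff z)).
Qed.

Lemma nsq_dct (F : nat -> circle R -> R[i]) f (g : circle R -> R) :
  (forall n, measC (F n)) -> (forall z, cvgC (F ^~ z) (f z)) ->
  (forall n z, cabs (F n z) ^+ 2 <= g z) -> rintegrable mu g ->
  L2 mu f /\ nsq mu (fun z => F n z - f z) @[n --> \oo] --> (0 : R).
Proof.
move=> mF Ff Fg ig; have mf := measC_cvg mF Ff.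
have fg z : cabs (f z) ^+ 2 <= g z by exact: (cvgC_shift_le (Ff z)).
have lf : L2 mu f.
  apply/L2P; split=> //; apply: rintegrable_le ig; first exact: measC_cabs2.
  by move=> z; rewrite ger0_norm ?sqr_ge0.
split=> //.
have [||||_ ] := @rint_dct (fun n z => cabs (F n z - f z) ^+ 2) (fun=> 0) (fun z => 4 * g z).
- by move=> n; apply: measC_cabs2; exact: measCB.
- by move=> z; apply: cvgC_cabs2.
- move=> n z; rewrite ger0_norm ?sqr_ge0//.
  apply: le_trans (cabs2D _ _) _; rewrite cabsN.
  by have := Fg n z; have := fg z; lra.
- exact: rintegrableZ.
by rewrite Rintegral_cst// mul0r.
Qed.

Lemma rintE (u : circle R -> R) : rintegrable mu u ->
  (\int[mu]_z (u z)%:E)%E = ((\int[mu]_z u z)%R)%:E.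
Proof. by move=> iu; rewrite /Rintegral fineK//; exact: integrable_fin_num iu. Qed.

End convergence_theorems.

(** * Rational and polynomial closures *)

Section closures.
Context {R : realType} (mu : probability (circle R) R).
Implicit Types (f g h : circle R -> R[i]).

Section subspace.
Variable S : set (circle R -> R[i]).
Hypotheses (S_L2 : forall f, S f -> L2 mu f)
  (S_add : forall f g, S f -> S g -> S (fun z => f z + g z))
  (S_scale : forall c f, S f -> S (fun z => c * f z)).
Local Notation M := (L2closure mu S).

Lemma closure_L2 f : M f -> L2 mu f. Proof. by case. Qed.

Lemma closure_sub f : S f -> M f.
Proof.
move=> Sf; apply/(L2closureP _ S_L2); split=> [|e e0]; first exact: S_L2.
exists f => //; rewrite /nsq (_ : (fun z => _) = fun=> 0); first by rewrite Rintegral_cst// mul0r.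
by apply/funext => z; rewrite subrr cabs0 expr0n.
Qed.

Lemma closure_closed f : L2 mu f ->
  (forall e : R, 0 < e -> exists2 g, M g & nsq mu (fun z => f z - g z) <= e) -> M f.
Proof.
move=> lf h; apply/(L2closureP _ S_L2); split=> // e e0.
(* The triangle inequality for squared norms costs a factor 2, and [2 (e/8 + e/8) < e]. *)
have e8 : 0 < e / 8 by rewrite divr_gt0.
have [g Mg fg] := h _ e8.
move/(L2closureP _ S_L2): Mg => [lg /(_ _ e8)[k Sk gk]].
exists k => //; have := nsq_triangle lf lg (S_L2 Sk); lra.
Qed.

Lemma closure_add f g : M f -> M g -> M (fun z => f z + g z).
Proof.
move=> /(L2closureP _ S_L2)[lf hf] /(L2closureP _ S_L2)[lg hg].
apply/(L2closureP _ S_L2); split=> [|e e0]; first exact: L2D.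
have e8 : 0 < e / 8 by rewrite divr_gt0.
have [f' Sf ff] := hf _ e8; have [g' Sg gg] := hg _ e8.
exists (fun z => f' z + g' z); first exact: S_add.
have := nsqD_le (L2B lf (S_L2 Sf)) (L2B lg (S_L2 Sg)).
rewrite (_ : (fun z => f z - f' z + _) = fun z => f z + g z - (f' z + g' z)); first by lra.
by apply/funext => z; rewrite opprD addrACA.
Qed.

(** Multiplication by a bounded function is continuous in [L^2], so invariance has to be checked on
    the generators only. *)
Lemma closure_mul h (C : R) : measC h -> (forall z, cabs (h z) <= C) ->
  (forall f, S f -> M (fun z => h z * f z)) -> forall f, M f -> M (fun z => h z * f z).
Proof.
move=> mh hC hS f Mf; have lf := closure_L2 Mf.
have lhf g : L2 mu g -> L2 mu (fun z => h z * g z) by exact: L2M_bounded mh hC.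
apply: closure_closed; first exact: lhf.
move=> e e0; have c0 : 0 < C ^+ 2 + 1 by rewrite ltr_wpDl ?sqr_ge0.
have e1 : 0 < e / (C ^+ 2 + 1) by rewrite divr_gt0.
move/(L2closureP _ S_L2): (Mf) => [_ /(_ _ e1)[g Sg fg]].
exists (fun z => h z * g z); first exact: hS.
apply: (@le_trans _ _ (C ^+ 2 * nsq mu (fun z => f z - g z))).
  have /L2P[_ i1] := L2B lf (S_L2 Sg).
  have /L2P[_ i2] := L2B (lhf _ lf) (lhf _ (S_L2 Sg)).
  rewrite /nsq -RintegralZl//; apply: le_Rintegral => //; first exact: rintegrableZ.
  move=> z _; rewrite -mulrBr cabsM exprMn; apply: ler_wpM2r; rewrite ?sqr_ge0//.
  by rewrite -ler_cabs_sqr//; exact: le_trans (cabs_ge0 _) (hC z).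
apply: (@le_trans _ _ (C ^+ 2 * (e / (C ^+ 2 + 1)))).
  by apply: ler_wpM2l; rewrite ?sqr_ge0// ltW.
rewrite mulrCA ler_piMr ?(ltW e0)// ler_pdivrMr// mul1r lerDl//.
Qed.

Lemma closure_scale c f : M f -> M (fun z => c * f z).
Proof.
apply: (@closure_mul (fun=> c) (cabs c)); [exact: measC_cst|by []|].
by move=> g Sg; apply: closure_sub; exact: S_scale.
Qed.

Lemma closure_sum n (F : nat -> circle R -> R[i]) : (forall k, M (F k)) ->
  M (fun z => \sum_(k < n) F k z).
Proof.
move=> MF; elim: n => [|n IH].
  under eq_fun do rewrite big_ord0; have := closure_scale 0 (MF 0%N).
  by under eq_fun do rewrite mul0r.
by under eq_fun do rewrite big_ord_recr /=; exact: closure_add.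
Qed.

Lemma closure_lincomb F c n : (forall k, M (F k)) -> M (lincomb F c n).
Proof. by move=> MF; apply: (@closure_sum n (fun k z => c k * F k z)) => k; exact: closure_scale. Qed.

Lemma closure_cvg (F : nat -> circle R -> R[i]) f : (forall n, M (F n)) -> L2 mu f ->
  nsq mu (fun z => F n z - f z) @[n --> \oo] --> (0 : R) -> M f.
Proof.
move=> MF lf Ff; apply: closure_closed => // e e0.
have /cvgrPdist_le/(_ _ e0)[N _ /(_ N (leqnn N))] := Ff.
by rewrite sub0r normrN ger0_norm ?nsq_ge0// => h; exists (F N); rewrite // nsqC.
Qed.

Hypotheses (M_1 : M (fun=> 1))
  (M_z : forall f, M f -> M (fun z => circle_val z * f z))
  (M_zJ : forall f, M f -> M (fun z => (circle_val z)^*%C * f z)).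

(** The bounded elements of [M] are stable under bounded pointwise limits and under [z] and
    [conj z], so they contain the indicators, then all bounded functions. A general [f] is the limit
    of its restrictions to the sets [|f| <= n]. *)
Lemma closure_full f : L2 mu f -> M f.
Proof.
pose H f := M f /\ exists C : R, forall z, cabs (f z) <= C.
have Hadd g k : H g -> H k -> H (fun z => g z + k z).
  move=> [Mg [C gC]] [Mk [D kD]]; split; first exact: closure_add.
  by exists (C + D) => z; rewrite (le_trans (cabsD _ _))// lerD.
have Hscale c g : H g -> H (fun z => c * g z).
  move=> [Mg [C gC]]; split; first exact: closure_scale.
  by exists (cabs c * C) => z; rewrite cabsM ler_wpM2l ?cabs_ge0.
have Hlim (F : nat -> circle R -> R[i]) g : (forall n, H (F n)) -> bplim F g -> H g.
  move=> HF [[C FC] Fg].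
  have gC z : cabs (g z) <= C.
    have C0 : 0 <= C by exact: le_trans (cabs_ge0 _) (FC 0%N z).
    rewrite ler_cabs_sqr//; apply: (cvgC_shift_le (Fg z)) => n.
    by rewrite -ler_cabs_sqr.
  split; last by exists C.
  have [||||lg cg] := @nsq_dct _ mu F g (fun=> C ^+ 2).
  - by move=> n; apply: L2_meas; apply: closure_L2; case: (HF n).
  - exact: Fg.
  - by move=> n z; rewrite -ler_cabs_sqr//; exact: le_trans (cabs_ge0 _) (FC 0%N z).
  - exact: rintegrable_cst.
  by apply: closure_cvg lg cg => n; case: (HF n).
have Hind A : measurable A -> H (indC A).
  apply: indC_in_system => //.
  - by move=> g [].
  - by split=> //; exists 1 => z; rewrite cabs1.
  - move=> g [Mg [C gC]]; split; first exact: M_z.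
    by exists C => z; rewrite cabsM cabs_circle mul1r.
  - move=> g [Mg [C gC]]; split; first exact: M_zJ.
    by exists C => z; rewrite cabsM cabsJ cabs_circle mul1r.
have Hbnd g (C : R) : measC g -> (forall z, cabs (g z) <= C) -> M g.
  by move=> mg gC; have [] := bounded_in_system Hlim Hadd Hscale Hind mg gC.
move=> lf; have mf := L2_meas lf.
pose A n := [set z | cabs (f z) <= n%:R].
have mA n : measurable (A n).
  rewrite (_ : A n = (fun z => cabs (f z)) @^-1` `]-oo, n%:R]%classic).
    by rewrite -[X in measurable X]setTI; exact: measC_cabs.
  by apply/seteqP; split=> z; rewrite /A /= in_itv.
pose F n z := indC (A n) z * f z.
have mF n : measC (F n) by apply: measCM => //; exact: measC_indC.
have FE n z : F n z = if `[< A n z >] then f z else 0.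
  rewrite /F /indC indicE; case: asboolP => h; first by rewrite mem_set// mul1r.
  by rewrite memNset// mul0r.
have [||||_ cf] := @nsq_dct _ mu F f (fun z => cabs (f z) ^+ 2) => //.
- move=> z; apply: cvg_near_cst; exists (Num.truncn (cabs (f z))).+1 => // n /= hn.
  rewrite FE asboolT ?subrr ?cabs0// /A /=.
  by rewrite (le_trans (ltW (truncnS_gt _)))// ler_nat.
- by move=> n z; rewrite FE; case: ifP => // _; rewrite cabs0 expr0n sqr_ge0.
- by case/L2P: lf.
apply: closure_cvg lf cf => n; apply: (Hbnd _ n%:R) => // z.
by rewrite FE; case: asboolP => //; rewrite cabs0.
Qed.

End subspace.

Definition polyfun : set (circle R -> R[i]) :=
  [set f | exists p : {poly R[i]}, f = on_circle (horner p)].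

Lemma measC_poly (p : {poly R[i]}) : measC (on_circle (horner p)).
Proof.
elim/poly_ind: p => [|p c IH].
  by rewrite (_ : on_circle _ = fun=> 0); [exact: measC_cst|apply/funext => z; rewrite /on_circle horner0].
rewrite (_ : on_circle _ = fun z => on_circle (horner p) z * circle_val z + c).
  by apply: measCD; [apply: measCM => //; exact: measC_id|exact: measC_cst].
by apply/funext => z; rewrite /on_circle !hornerE.
Qed.

Lemma poly_bounded (p : {poly R[i]}) : exists C : R, forall z : circle R, cabs p.[z] <= C.
Proof.
elim/poly_ind: p => [|p c [C IH]].
  by exists 0 => z; rewrite horner0 cabs0.
exists (C + cabs c) => z; rewrite !hornerE (le_trans (cabsD _ _))// lerD//.
by rewrite cabsM cabs_circle mulr1.
Qed.

Lemma polyfun_L2 f : polyfun f -> L2 mu f.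
Proof.
move=> [p ->]; have [C pC] := poly_bounded p.
exact: L2_bounded (measC_poly p) pC.
Qed.

Lemma polyfun_add f g : polyfun f -> polyfun g -> polyfun (fun z => f z + g z).
Proof.
by move=> [p ->] [q ->]; exists (p + q); apply/funext => z; rewrite /on_circle hornerD.
Qed.

Lemma polyfun_scale c f : polyfun f -> polyfun (fun z => c * f z).
Proof.
by move=> [p ->]; exists (c *: p); apply/funext => z; rewrite /on_circle hornerZ.
Qed.

Lemma polyfun_mul f g : polyfun f -> polyfun g -> polyfun (fun z => f z * g z).
Proof.
by move=> [p ->] [q ->]; exists (p * q); apply/funext => z; rewrite /on_circle hornerM.
Qed.

Local Notation P := (poly_closure mu).

Lemma poly_closure_1 : P (fun=> 1).
Proof.
apply: (closure_sub polyfun_L2); exists 1%:P.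
by apply/funext => z; rewrite /on_circle hornerC.
Qed.

Lemma poly_closure_z f : P f -> P (fun z => circle_val z * f z).
Proof.
apply: (closure_mul polyfun_L2 (h := fun z => circle_val z) (C := 1)).
- exact: measC_id.
- by move=> z; rewrite cabs_circle.
- move=> g Sg; apply: (closure_sub polyfun_L2); apply: polyfun_mul => //.
  by exists 'X; apply/funext => z; rewrite /on_circle hornerX.
Qed.

(** For a polynomial [p], [conj z p] is the element [conj z] of [P] multiplied by [p], which
    preserves [P]; [closure_mul] does the rest. *)
Lemma poly_closure_zJ : P (fun z => (circle_val z)^*%C) ->
  forall f, P f -> P (fun z => (circle_val z)^*%C * f z).
Proof.
move=> PJ; have mJ : measC (fun z : circle R => (circle_val z)^*%C) by apply: measCJ; exact: measC_id.
have J1 (z : circle R) : cabs (circle_val z)^*%C <= 1 by rewrite cabsJ cabs_circle.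
apply: (closure_mul polyfun_L2 (h := fun z => (circle_val z)^*%C) (C := 1)) => // f Sf.
have [p fE] := Sf; have [C pC] := poly_bounded p.
rewrite (_ : (fun z => _) = fun z => p.[circle_val z] * (circle_val z)^*%C).
  apply: (closure_mul polyfun_L2 (h := on_circle (horner p)) (C := C)) PJ => //.
  - exact: measC_poly.
  - by move=> g Sg; apply: (closure_sub polyfun_L2); apply: polyfun_mul => //; exists p.
by apply/funext => z; rewrite fE mulrC.
Qed.

Lemma poly_closure_full : P (fun z => (circle_val z)^*%C) <-> P = L2 mu.
Proof.
split=> [PJ|->]; last first.
  by apply: (@L2_bounded _ _ _ 1) => [|z]; [apply: measCJ; exact: measC_id|rewrite cabsJ cabs_circle].
apply/seteqP; split=> f; first by case.
apply: (closure_full polyfun_L2 polyfun_add polyfun_scale).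
- exact: poly_closure_1.
- exact: poly_closure_z.
- exact: poly_closure_zJ.
Qed.

Variables (alpha : nat -> R[i]) (r : R).
Hypotheses (r_lt1 : r < 1) (alpha_le : forall n, cabs (alpha n) <= r).

Let r_ge0 : 0 <= r. Proof. exact: le_trans (cabs_ge0 _) (alpha_le 0). Qed.

Lemma cabs_varpi n (z : circle R) : 1 - r <= cabs (varpi alpha n z).
Proof.
have := cabs_dist 1 ((alpha n)^*%C * z); rewrite cabs1 cabsM cabsJ cabs_circle mulr1.
move=> h; apply: le_trans h; apply: le_trans (ler_norm _).
by rewrite lerB.
Qed.

Lemma varpi_neq0 n (z : circle R) : varpi alpha n z != 0.
Proof.
have := cabs_varpi n z; apply: contraTneq => ->; rewrite cabs0 -ltNge.
by rewrite subr_gt0.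
Qed.

Lemma circle_mulJ (z : circle R) : (circle_val z)^*%C * circle_val z = 1.
Proof. by rewrite -cabs2C cabs_circle expr1n. Qed.

Lemma cabs_zeta n (z : circle R) : cabs (zeta alpha n z) = 1.
Proof.
have h : varpi_star alpha n z = circle_val z * (varpi alpha n z)^*%C.
  rewrite /varpi_star /varpi conjB conjM conjcK mulrBr.
  have -> : (1 : R[i])^*%C = 1 by apply: ext_complex; rewrite /= ?oppr0.
  by rewrite mulr1 mulrCA [circle_val z * _]mulrC circle_mulJ mulr1.
rewrite /zeta h !cabsM cabs_circle cabsJ cabsV mul1r divff//.
by apply: contra_neq (varpi_neq0 n z); exact: cabs_eq0.
Qed.

Lemma blaschkeS n z : blaschke alpha n.+1 z = zeta alpha n.+1 z * blaschke alpha n z.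
Proof. by rewrite /blaschke big_nat_recr//= mulrC. Qed.

Lemma blaschke0 z : blaschke alpha 0 z = 1.
Proof. by rewrite /blaschke big_geq. Qed.

Lemma cabs_blaschke n (z : circle R) : cabs (blaschke alpha n z) = 1.
Proof.
elim: n => [|n IH]; first by rewrite blaschke0 cabs1.
by rewrite blaschkeS cabsM cabs_zeta IH mulr1.
Qed.

Let geo n k (z : circle R) := \sum_(j < k) ((alpha n)^*%C * circle_val z) ^+ j.

Let geoE n k (z : circle R) : (varpi alpha n z)^-1 - geo n k z =
  ((alpha n)^*%C * circle_val z) ^+ k * (varpi alpha n z)^-1.
Proof.
have h : varpi alpha n z * geo n k z = 1 - ((alpha n)^*%C * circle_val z) ^+ k.
  by rewrite /geo /varpi -[1 - _]opprB mulNr -subrX1 opprB.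
apply: (mulfI (varpi_neq0 n z)); rewrite mulrBr h divff ?varpi_neq0// subKr.
by rewrite mulrCA divff ?varpi_neq0// mulr1.
Qed.

Let geo_dist n k (z : circle R) : cabs ((varpi alpha n z)^-1 - geo n k z) <= (1 - r)^-1 * r ^+ k.
Proof.
rewrite geoE cabsM cabsX cabsM cabsJ cabs_circle mulr1 cabsV mulrC.
apply: ler_pM; rewrite ?invr_ge0 ?exprn_ge0 ?cabs_ge0//.
- by rewrite lef_pV2 ?posrE ?subr_gt0 ?cabs_varpi// (lt_le_trans _ (cabs_varpi n z))// subr_gt0.
- by rewrite lerXn2r// nnegrE cabs_ge0.
Qed.

Let geo_poly n k : exists p : {poly R[i]}, geo n k = on_circle (horner p).
Proof.
elim: k => [|k [p IH]].
  by exists 0; apply/funext => z; rewrite /geo big_ord0 /on_circle horner0.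
exists (p + ((alpha n)^*%C *: 'X) ^+ k); apply/funext => z.
rewrite /geo big_ord_recr /= -/(geo n k z) IH /on_circle.
by rewrite hornerD horner_exp hornerZ hornerX.
Qed.

Let geo_cvg n (z : circle R) : cvgC (geo n ^~ z) (varpi alpha n z)^-1.
Proof.
apply: (@squeeze_cvgr _ _ _ _ (fun=> 0) (fun k => (1 - r)^-1 * r ^+ k)).
- by apply: nearW => k; rewrite cabs_ge0 cabsB geo_dist.
- exact: cvg_cst.
- have -> : (0 : R) = (1 - r)^-1 * 0 by rewrite mulr0.
  apply: cvgM; first exact: cvg_cst.
  by apply: cvg_expr; rewrite ger0_norm.
Qed.

Lemma measC_varpiV n : measC (fun z : circle R => (varpi alpha n z)^-1).
Proof.
apply: (measC_cvg (F := geo n)) => [k|z]; last exact: geo_cvg.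
by have [p ->] := geo_poly n k; exact: measC_poly.
Qed.

Lemma measC_blaschke n : measC (on_circle (blaschke alpha n)).
Proof.
elim: n => [|n IH].
  rewrite (_ : on_circle _ = fun=> 1); first exact: measC_cst.
  by apply/funext => z; rewrite /on_circle blaschke0.
rewrite (_ : on_circle _ = fun z => (circle_val z - alpha n.+1) * (varpi alpha n.+1 z)^-1 *
    on_circle (blaschke alpha n) z).
  apply: measCM => //; apply: measCM; last exact: measC_varpiV.
  by apply: measCB; [exact: measC_id|exact: measC_cst].
by apply/funext => z; rewrite /on_circle blaschkeS.
Qed.

Lemma L2_blaschke n : L2 mu (on_circle (blaschke alpha n)).
Proof.
by apply: (@L2_bounded _ _ _ 1) => [|z]; [exact: measC_blaschke|rewrite /on_circle cabs_blaschke].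
Qed.

Lemma poly_closure_varpiV n f : P f -> P (fun z => (varpi alpha n z)^-1 * f z).
Proof.
have Vle (z : circle R) : cabs (varpi alpha n z)^-1 <= (1 - r)^-1.
  rewrite cabsV lef_pV2 ?posrE ?subr_gt0 ?cabs_varpi//.
  by rewrite (lt_le_trans _ (cabs_varpi n z))// subr_gt0.
apply: (closure_mul polyfun_L2 (measC_varpiV n) Vle) => g Sg.
have lg := polyfun_L2 Sg; have [p gE] := Sg; have [C pC] := poly_bounded p.
(* The dominating constant: a geometric sum lies within [1/(1 - r)] of [1/varpi_n], itself of
   modulus at most [1/(1 - r)]. *)
have [||||lV cV] := @nsq_dct _ mu (fun k z => geo n k z * g z) (fun z => (varpi alpha n z)^-1 * g z)
  (fun=> (((1 - r)^-1 * 2) * C) ^+ 2).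
- move=> k; apply: measCM; last exact: (L2_meas lg).
  by have [q ->] := geo_poly n k; exact: measC_poly.
- by move=> z; under eq_fun do rewrite mulrC; rewrite mulrC; apply: cvgCZ; exact: geo_cvg.
- move=> k z.
  have C0 : 0 <= C by exact: le_trans (cabs_ge0 _) (pC z).
  have V0 : 0 <= (1 - r)^-1 by rewrite invr_ge0 subr_ge0 ltW.
  rewrite -ler_cabs_sqr; last by rewrite !mulr_ge0.
  rewrite cabsM gE; apply: ler_pM; rewrite ?cabs_ge0//; last exact: pC.
  have := cabs_dist (geo n k z) (varpi alpha n z)^-1; rewrite cabsB => h.
  have h1 := le_trans (le_trans (ler_norm _) h) (geo_dist n k z).
  have rk : (1 - r)^-1 * r ^+ k <= (1 - r)^-1 by rewrite ler_piMr// exprn_ile1// ltW.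
  have := Vle z; lra.
- exact: rintegrable_cst.
apply: (closure_cvg polyfun_L2) lV cV => k; apply: (closure_sub polyfun_L2).
by apply: polyfun_mul => //; have [q ->] := geo_poly n k; exists q.
Qed.

Lemma poly_closure_blaschke n : P (on_circle (blaschke alpha n)).
Proof.
elim: n => [|n IH].
  rewrite (_ : on_circle _ = fun=> 1); first exact: poly_closure_1.
  by apply/funext => z; rewrite /on_circle blaschke0.
rewrite (_ : on_circle _ = fun z => (varpi alpha n.+1 z)^-1 *
    (circle_val z * on_circle (blaschke alpha n) z + (- alpha n.+1) * on_circle (blaschke alpha n) z)).
  apply: poly_closure_varpiV; apply: (closure_add polyfun_L2 polyfun_add).
    exact: poly_closure_z.
  exact: (closure_scale polyfun_L2 polyfun_scale).
by apply/funext => z; rewrite /on_circle blaschkeS /zeta /varpi_star; ring.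
Qed.

Local Notation Bf := (fun n => on_circle (blaschke alpha n)).
Local Notation SB := (Defs.span Bf).
Local Notation L := (rat_closure alpha mu).

Lemma span_L2 F f : (forall n, L2 mu (F n)) -> Defs.span F f -> L2 mu f.
Proof. by move=> LF [n _ [c ->]]; exact: L2_lincomb. Qed.

Lemma span_scale (F : nat -> circle R -> R[i]) c f :
  Defs.span F f -> Defs.span F (fun z => c * f z).
Proof.
move=> [n _ [d ->]]; exists n => //; exists (fun k => c * d k).
by apply/funext => z; rewrite /lincomb mulr_sumr; apply: eq_bigr => k _; rewrite mulrA.
Qed.

Lemma lincomb_widen (F : nat -> circle R -> R[i]) (c : nat -> R[i]) m n : (m <= n)%N ->
  lincomb F c m = lincomb F (fun k => if (k < m)%N then c k else 0) n.
Proof.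
move=> mn; apply/funext => z; rewrite /lincomb -(subnKC mn) big_split_ord /=.
rewrite [X in _ + X]big1 ?addr0 => [|k _]; last by rewrite ltnNge leq_addr mul0r.
by apply: eq_bigr => k _; rewrite ltn_ord.
Qed.

Lemma span_add (F : nat -> circle R -> R[i]) f g :
  Defs.span F f -> Defs.span F g -> Defs.span F (fun z => f z + g z).
Proof.
move=> [m _ [c ->]] [n _ [d ->]]; exists (maxn m n) => //.
rewrite (lincomb_widen F c (leq_maxl m n)) (lincomb_widen F d (leq_maxr m n)).
exists (fun k => (if (k < m)%N then c k else 0) + (if (k < n)%N then d k else 0)).
apply/funext => z; rewrite /lincomb -big_split /=.
by apply: eq_bigr => k _; rewrite mulrDl.
Qed.

Lemma span_mem (F : nat -> circle R -> R[i]) n : Defs.span F (F n).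
Proof.
exists n.+1 => //; exists (fun k => (k == n)%:R); apply/funext => z.
rewrite /lincomb big_ord_recr /= eqxx mul1r big1 ?add0r// => k _.
by rewrite (ltn_eqF (ltn_ord k)) mul0r.
Qed.

Let SB_L2 f : SB f -> L2 mu f. Proof. exact: span_L2 L2_blaschke. Qed.

Let LB n : L (on_circle (blaschke alpha n)).
Proof. by apply: (closure_sub SB_L2); exact: (span_mem Bf). Qed.

Let LD f g : L f -> L g -> L (fun z => f z + g z).
Proof. exact: (closure_add SB_L2 (@span_add _)). Qed.

Let LZ c f : L f -> L (fun z => c * f z).
Proof. exact: (closure_scale SB_L2 (@span_scale _)). Qed.

(* Solving [z (1 + conj alpha zeta) = zeta + alpha] for [z B_n]. *)
Let zB n (z : circle R) : circle_val z * blaschke alpha n z =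
  blaschke alpha n.+1 z + alpha n.+1 * blaschke alpha n z -
  (alpha n.+1)^*%C * (circle_val z * blaschke alpha n.+1 z).
Proof.
rewrite blaschkeS /zeta /varpi_star.
have := varpi_neq0 n.+1 z; rewrite /varpi => v0.
by field.
Qed.

(** Each use of [zB] raises the index of the term not yet known to lie in [L] and multiplies its
    coefficient by [- conj(alpha)], of modulus at most [r]. *)
Let zB_iter N n : exists g c, [/\ L g, cabs c <= r ^+ N &
  forall z : circle R, circle_val z * blaschke alpha n z =
    g z + c * (circle_val z * blaschke alpha (n + N) z)].
Proof.
elim: N => [|N [g [c [Lg cr E]]]].
  exists (fun=> 0), 1; split; [|by rewrite cabs1|by move=> z; rewrite addn0 add0r mul1r].
  by have := LZ 0 (LB 0); under eq_fun do rewrite mul0r.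
exists (fun z => g z + c * (blaschke alpha (n + N).+1 z + alpha (n + N).+1 * blaschke alpha (n + N) z)).
exists (- c * (alpha (n + N).+1)^*%C); split.
- apply: LD => //; apply: LZ; apply: LD; first exact: LB.
  by apply: LZ; exact: LB.
- rewrite cabsM cabsN cabsJ exprSr; apply: ler_pM; rewrite ?cabs_ge0//.
- by move=> z; rewrite E zB addnS; ring.
Qed.

Lemma rat_closure_z f : L f -> L (fun z => circle_val z * f z).
Proof.
have z1 (z : circle R) : cabs (circle_val z) <= 1 by rewrite cabs_circle.
apply: (closure_mul SB_L2 measC_id z1) => _ [n _ [c ->]].
have LzB k : L (fun z => circle_val z * blaschke alpha k z).
  apply: (closure_closed SB_L2).
    by apply: (L2M_bounded measC_id z1); exact: L2_blaschke.
  move=> e e0.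
  have : r ^+ N @[N --> \oo] --> (0 : R) by apply: cvg_expr; rewrite ger0_norm.
  have se : 0 < Num.sqrt e by rewrite sqrtr_gt0.
  move=> /cvgrPdist_le/(_ _ se)[N _ /(_ N (leqnn N))].
  rewrite sub0r normrN ger0_norm ?exprn_ge0// => rN.
  have [g [d [Lg dr E]]] := zB_iter N k; exists g => //.
  (* As [z] and the Blaschke products are unimodular on the circle, the remainder has constant
     modulus [|d| <= r^N]. *)
  rewrite /nsq (_ : (fun z => _) = fun=> cabs d ^+ 2).
    rewrite Rintegral_cst//.
    rewrite [X in fine X]probability_setT mulr1 -(sqr_sqrtr (ltW e0)).
    by rewrite -ler_cabs_sqr ?(ltW se)// (le_trans dr).
  apply/funext => z; rewrite E addrAC subrr add0r !cabsM cabs_circle cabs_blaschke.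
  by rewrite !mulr1.
rewrite (_ : (fun z => _) = lincomb (fun k z => circle_val z * blaschke alpha k z) c n).
  exact: (closure_lincomb SB_L2 (@span_add _) (@span_scale _)).
by apply/funext => z; rewrite /lincomb mulr_sumr; apply: eq_bigr => k _; rewrite mulrCA.
Qed.

Lemma rat_poly_closure : L = P.
Proof.
apply/seteqP; split=> f [lf h].
- apply: (closure_closed polyfun_L2) => // e e0.
  have se : 0 < Num.sqrt e by rewrite sqrtr_gt0.
  have [g [n _ [c gE]] hg] := h _ se; exists g.
    rewrite gE; apply: (closure_lincomb polyfun_L2 polyfun_add polyfun_scale) => k.
    exact: poly_closure_blaschke.
  have lg : L2 mu g by rewrite gE; exact: L2_lincomb L2_blaschke.
  by move: hg; rewrite norm2sqE; [rewrite lte_fin sqr_sqrtr ?(ltW e0)//; exact: ltW|exact: L2B].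
- apply: (closure_closed SB_L2) => // e e0.
  have se : 0 < Num.sqrt e by rewrite sqrtr_gt0.
  have [g [p gE] hg] := h _ se; exists g.
    rewrite gE; elim/poly_ind: p {gE} => [|p c IH].
      have := LZ 0 (LB 0); congr (L _); apply/funext => z.
      by rewrite mul0r /on_circle horner0.
    have := LD (rat_closure_z IH) (LZ c (LB 0)); congr (L _); apply/funext => z.
    by rewrite /on_circle !hornerE blaschke0 mulr1 mulrC.
  have lg : L2 mu g by apply: polyfun_L2; exists p.
  by move: hg; rewrite norm2sqE; [rewrite lte_fin sqr_sqrtr ?(ltW e0)//; exact: ltW|exact: L2B].
Qed.

Lemma norm2sq_mulz f : norm2sq mu (mulz f) = norm2sq mu f.
Proof. by apply: eq_integral => z _; rewrite /mulz cabsM cabs_circle mul1r. Qed.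

End closures.

(** * Szego's theorem *)

Section haar_moments.
Context {R : realType}.
Local Notation m := (@haar R).

Lemma haar_rint (f : circle R -> R) (h F : R -> R) :
  measurable_fun setT f -> (forall z, `|f z| <= 1) -> (forall t, f (expi t) = h t) ->
  (forall t : R, is_derive t (1 : R) F (h t)) -> continuous h ->
  (\int[m]_z f z)%R = (2 * pi)^-1 * (F (2 * pi) - F 0).
Proof.
move=> mf f1 fh dF ch.
have intf : rintegrable m f by exact: rintegrable_bounded mf f1.
have int1 := rintegrable_cst m 1.
(* Adding 1 makes the integrand nonnegative, as the transfer to [[0, 2 pi]] requires; the constant
   cancels at the end. *)
have e1 : (\int[m]_z (1 + f z)%:E)%E = (1 + (\int[m]_z f z)%R)%:E.
  rewrite (rintE (rintegrableD int1 intf)) RintegralD// Rintegral_cst//.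
  by rewrite [X in fine X]probability_setT mulr1.
have mh : measurable_fun setT h by exact: continuous_measurable_fun.
have f0 z : 0 <= 1 + f z by have := f1 z; rewrite ler_norml => /andP[]; lra.
have e2 : (\int[m]_z (1 + f z)%:E)%E = ((2 * pi)^-1 * (2 * pi + F (2 * pi) - F 0))%:E.
  rewrite ge0_integral_distribution; last 2 first.
  - by apply/measurable_EFinP; apply: measurable_funD.
  - by move=> z; rewrite lee_fin.
  under eq_integral do rewrite /= fh.
  rewrite integral_uniform; last 2 first.
  - by apply/measurable_EFinP; apply: measurable_funD.
  - by move=> t; rewrite lee_fin -fh.
  rewrite subr0.
  pose G t : R := t + F t.
  have dG (t : R) : is_derive t (1 : R) G (1 + h t) by exact: is_deriveD.
  rewrite (@continuous_FTC2 _ (fun t => 1 + h t) G).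
  - by rewrite -EFinB -EFinM /G add0r.
  - exact: two_pi_gt0.
  - by apply: continuous_subspaceT => t; apply: cvgD; [exact: cvg_cst|exact: ch].
  - have cG : continuous G.
      by move=> t; apply: differentiable_continuous; apply/derivable1_diffP; exact: (@ex_derive _ _ _ _ _ _ _ (dG t)).
    split.
    + by move=> t _; exact: (@ex_derive _ _ _ _ _ _ _ (dG t)).
    + by apply: cvg_at_right_filter; exact: cG.
    + by apply: cvg_at_left_filter; exact: cG.
  - by move=> t _; rewrite derive1E; exact: (@derive_val _ _ _ _ _ _ _ (dG t)).
have := etrans (esym e1) e2 => -[].
have pi0 : 2 * pi != 0 :> R by rewrite gt_eqF// two_pi_gt0.
by move=> e; apply: (addrI 1); rewrite e -addrA mulrDr mulVf.
Qed.

Lemma expiX n (t : R) : circle_val (expi t) ^+ n = cos (t *+ n) +i* sin (t *+ n).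
Proof.
elim: n => [|n IH]; first by rewrite expr0 mulr0n cos0 sin0.
rewrite exprS IH mulrS cosD sinD; apply: ext_complex; rewrite ?ReCM ?ImCM //=.
by rewrite addrC [X in _ + X]mulrC.
Qed.

Lemma cabs_circleX n (z : circle R) : cabs (circle_val z ^+ n) = 1.
Proof. by rewrite cabsX cabs_circle expr1n. Qed.

Lemma measC_circleX n : measC (fun z : circle R => circle_val z ^+ n).
Proof.
have := @measC_poly R 'X^n; congr measC; apply/funext => z.
by rewrite /on_circle hornerXn.
Qed.

Let is_derive_mulrn (n : nat) (t : R) : is_derive t 1 (fun x => x *+ n) (n%:R).
Proof.
rewrite (_ : (fun x => x *+ n) = n%:R \*: id).
  by have := is_deriveZ n%:R (is_derive_id t 1); rewrite /GRing.scale /= mulr1.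
by apply/funext => x /=; rewrite /GRing.scale /= mulr_natl.
Qed.

Lemma haar_moment n : integralC m (fun z => circle_val z ^+ n) = (n == 0)%:R.
Proof.
case: n => [|n].
  rewrite /integralC; under [X in Rintegral _ _ X]eq_fun do rewrite expr0 /=.
  under [X in _ +i* Rintegral _ _ X]eq_fun do rewrite expr0 /=.
  by rewrite !Rintegral_cst// mul0r mul1r [X in fine X]probability_setT.
have [mr mi] := measC_circleX n.+1.
have n0 : n.+1%:R != 0 :> R by rewrite pnatr_eq0.
have twopi : 2 * pi *+ n.+1 = pi *+ 2 *+ n.+1 :> R by rewrite mulr_natl.
have cX : continuous (fun x : R => x *+ n.+1) by move=> t; apply: cvgMn; exact: cvg_id.
have dS (t : R) : is_derive t (1 : R) (fun t => n.+1%:R^-1 * sin (t *+ n.+1)) (cos (t *+ n.+1)).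
  have d1 := @is_derive1_comp _ sin (fun x => x *+ n.+1) t _ _ (is_derive_sin _) (is_derive_mulrn n.+1 t).
  by have := is_deriveZ n.+1%:R^-1 d1; rewrite /GRing.scale /= mulrC mulfK.
have dC (t : R) : is_derive t (1 : R) (fun t => - n.+1%:R^-1 * cos (t *+ n.+1)) (sin (t *+ n.+1)).
  have d1 := @is_derive1_comp _ cos (fun x => x *+ n.+1) t _ _ (is_derive_cos _) (is_derive_mulrn n.+1 t).
  have <- : - n.+1%:R^-1 * (- sin (t *+ n.+1) * n.+1%:R) = sin (t *+ n.+1).
    by rewrite [- sin _ * _]mulNr mulNr mulrN opprK mulrC mulfK.
  exact: (is_deriveZ (- n.+1%:R^-1) d1).
apply: ext_complex; rewrite /integralC /=.
- rewrite (haar_rint mr _ _ dS).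
  + rewrite mul0rn sin0 mulr0 subr0 twopi -[pi *+ 2 *+ n.+1]add0r.
    by rewrite periodicn ?sin0 ?mulr0//; exact: sinD2pi.
  + by move=> z; rewrite -(cabs_circleX n.+1 z) Re_le_cabs.
  + by move=> t; rewrite expiX.
  + by move=> t; apply: (@continuous_comp _ _ _ (fun x => x *+ n.+1) cos); [exact: cX|exact: continuous_cos].
- rewrite (haar_rint mi _ _ dC).
  + rewrite mul0rn cos0 twopi -[pi *+ 2 *+ n.+1]add0r.
    by rewrite periodicn ?cos0 ?subrr ?mulr0//; exact: cosD2pi.
  + by move=> z; rewrite -(cabs_circleX n.+1 z) Im_le_cabs.
  + by move=> t; rewrite expiX.
  + by move=> t; apply: (@continuous_comp _ _ _ (fun x => x *+ n.+1) sin); [exact: cX|exact: continuous_sin].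
Qed.

Lemma integrableC_bounded (mu : probability (circle R) R) f (C : R) :
  measC f -> (forall z, cabs (f z) <= C) -> integrableC mu f.
Proof.
by move=> mf fC; apply: (integrableC_le mf fC); exact: rintegrable_cst.
Qed.

Lemma haar_poly (p : {poly R[i]}) : integralC m (on_circle (horner p)) = p.[0].
Proof.
rewrite -{1}[p]coefK horner_coef0.
have h n : integralC m (fun z => \sum_(i < n) p`_i * circle_val z ^+ i) =
    \sum_(i < n) p`_i * (i == 0 :> nat)%:R.
  elim: n => [|n IH].
    rewrite big_ord0 /integralC; apply: ext_complex => /=.
    + by under [X in Rintegral _ _ X]eq_fun do rewrite big_ord0; rewrite Rintegral_cst// mul0r.
    + by under [X in Rintegral _ _ X]eq_fun do rewrite big_ord0; rewrite Rintegral_cst// mul0r.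
  rewrite big_ord_recr /= -IH -haar_moment -integralCZ; last first.
    by apply: (@integrableC_bounded _ _ 1) => [|z]; [exact: measC_circleX|rewrite cabs_circleX].
  rewrite -integralCD.
  - by congr integralC; apply/funext => z; rewrite big_ord_recr.
  - have [C hC] := poly_bounded (\poly_(i < n) p`_i).
    apply: (@integrableC_bounded _ _ C) => [|z].
      have := measC_poly (\poly_(i < n) p`_i); congr measC; apply/funext => z.
      by rewrite /on_circle horner_poly.
    by have := hC z; rewrite horner_poly.
  - apply: (@integrableC_bounded _ _ (cabs p`_n)) => [|z].
      by apply: measCZ; exact: measC_circleX.
    by rewrite cabsM cabs_circleX mulr1.
transitivity (integralC m (fun z => \sum_(i < size p) p`_i * circle_val z ^+ i)).
  by congr integralC; apply/funext => z; rewrite /on_circle horner_poly.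
rewrite h; case: (size p) (size_poly_leq0 p) => [|n] sp.
  by rewrite big_ord0; move: sp; rewrite leqnn => /esym/eqP ->; rewrite coef0.
rewrite big_ord_recl /= mulr1 big1 ?addr0// => k _.
by rewrite mulr0.
Qed.

(* Cauchy-Schwarz against 1. *)
Lemma haar_poly_le (p : {poly R[i]}) : cabs p.[0] ^+ 2 <= nsq m (on_circle (horner p)).
Proof.
have lp : L2 m (on_circle (horner p)) by apply: polyfun_L2; exists p.
have := inner_CS (L2_cst m 1) lp.
have -> : inner m (fun=> 1) (on_circle (horner p)) = p.[0].
  rewrite innerE -haar_poly; congr integralC; apply/funext => z.
  have -> : (1 : R[i])^*%C = 1 by apply: ext_complex; rewrite /= ?oppr0.
  by rewrite mul1r.
have -> : nsq m (fun=> 1 : R[i]) = 1.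
  rewrite /nsq; under [X in Rintegral _ _ X]eq_fun do rewrite cabs1 expr1n.
  by rewrite Rintegral_cst// mul1r [X in fine X]probability_setT.
by rewrite mul1r.
Qed.

End haar_moments.

(** * Bounded functions as iterated limits of trigonometric polynomials *)

Section trigonometric_class.
Context {R : realType}.
Implicit Types (f g : circle R -> R[i]) (H : set (circle R -> R[i])).

Definition trig f : Prop :=
  exists p q : {poly R[i]}, f = fun z => p.[circle_val z] + (q.[circle_val z])^*%C.

Definition bp_closed H : Prop :=
  forall (F : nat -> circle R -> R[i]) f, (forall n, H (F n)) -> bplim F f -> H f.

(* The smallest class that contains the trigonometric polynomials and is closed
   under bounded pointwise limits. *)
Let E f : Prop := forall H, trig `<=` H -> bp_closed H -> H f.

Let E_trig f : trig f -> E f. Proof. by move=> tf H tH _; exact: tH. Qed.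

Let E_lim : bp_closed E.
Proof.
move=> F f EF Ff H tH cH; apply: (cH F) => // n; exact: EF.
Qed.

Let trig_add f g : trig f -> trig g -> trig (fun z => f z + g z).
Proof.
move=> [p [q ->]] [p' [q' ->]]; exists (p + p'), (q + q'); apply/funext => z.
by rewrite !hornerD conjD addrACA.
Qed.

Let trig_scale c f : trig f -> trig (fun z => c * f z).
Proof.
move=> [p [q ->]]; exists (c *: p), (c^*%C *: q); apply/funext => z.
by rewrite !hornerZ conjM conjcK mulrDr.
Qed.

(** For [q = q' X + c], the relation [z conj z = 1] gives [z conj(q z) = conj(q' z) + conj(c) z] at
    each point [z], where [q z] and [q' z] are values. *)
Let trig_z f : trig f -> trig (fun z => circle_val z * f z).
Proof.
move=> [p [q ->]]; have [q' [c qE]] : exists q' c, q = q' * 'X + c%:P.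
  elim/poly_ind: q => [|q c _]; [|by exists q, c].
  by exists 0, 0; rewrite mul0r add0r; exact/esym/polyC0.
exists (p * 'X + (c^*%C *: 'X)), q'; apply/funext => z.
rewrite qE !hornerE /= conjD conjM.
have := circle_mulJ z; set w := circle_val z => ww.
rewrite mulrDr mulrDr [w * (_ * _)]mulrCA [w * w^*%C]mulrC ww mulr1.
by ring.
Qed.

Let trig_J f : trig f -> trig (fun z => (f z)^*%C).
Proof.
by move=> [p [q ->]]; exists q, p; apply/funext => z; rewrite conjD conjcK addrC.
Qed.

Let trig_zJ f : trig f -> trig (fun z => (circle_val z)^*%C * f z).
Proof.
move=> /trig_J/trig_z/trig_J; congr trig; apply/funext => z.
by rewrite conjM conjcK.
Qed.

Let bplimD (F G : nat -> circle R -> R[i]) f g : bplim F f -> bplim G g ->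
  bplim (fun n z => F n z + G n z) (fun z => f z + g z).
Proof.
move=> [[C FC] Ff] [[D GD] Gg]; split; last by move=> z; exact: cvgCD.
by exists (C + D) => n z; rewrite (le_trans (cabsD _ _))// lerD.
Qed.

Let bplimM (F : nat -> circle R -> R[i]) f h (C : R) : (forall z, cabs (h z) <= C) ->
  bplim F f -> bplim (fun n z => h z * F n z) (fun z => h z * f z).
Proof.
move=> hC [[D FD] Ff]; split; last by move=> z; exact: cvgCZ.
by exists (C * D) => n z; rewrite cabsM ler_pM ?cabs_ge0.
Qed.

Let bplim_bounded (F : nat -> circle R -> R[i]) f : bplim F f ->
  exists C : R, forall z, cabs (f z) <= C.
Proof.
move=> [[C FC] Ff]; exists C => z.
have C0 : 0 <= C by exact: le_trans (cabs_ge0 _) (FC 0%N z).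
rewrite ler_cabs_sqr//; apply: (cvgC_shift_le (Ff z)) => n.
by rewrite -ler_cabs_sqr.
Qed.

Let E_bounded f : E f -> exists C : R, forall z, cabs (f z) <= C.
Proof.
move=> Ef; apply: (Ef (fun f => exists C : R, forall z, cabs (f z) <= C)) => [g [p [q ->]]|F g _];
  last exact: bplim_bounded.
have [C pC] := poly_bounded p; have [D qD] := poly_bounded q.
by exists (C + D) => z; rewrite (le_trans (cabsD _ _))// lerD// cabsJ.
Qed.

Let bplim_cst f : (exists C : R, forall z, cabs (f z) <= C) -> bplim (fun=> f) f.
Proof. by move=> [C fC]; split; [exists C|move=> z; exact: cvgC_cst]. Qed.

Let E_mul h (C : R) : (forall z, cabs (h z) <= C) ->
  (forall f, trig f -> trig (fun z => h z * f z)) -> forall f, E f -> E (fun z => h z * f z).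
Proof.
move=> hC ht f Ef; apply: (Ef (fun f => E (fun z => h z * f z))).
- by move=> g tg; apply: E_trig; exact: ht.
- by move=> F g EF Fg; apply: (E_lim EF); exact: bplimM hC Fg.
Qed.

(** Minimality of [E] allows induction on one argument at a time: here on [g] with [f]
    trigonometric, then in [E_add] on [f] with [g] in [E]. *)
Let E_add_trig f g : trig f -> E g -> E (fun z => f z + g z).
Proof.
move=> tf Eg; apply: (Eg (fun g => E (fun z => f z + g z))).
- by move=> k tk; apply: E_trig; exact: trig_add.
- move=> F k EF Fk; apply: (E_lim EF).
  by apply: bplimD => //; apply: bplim_cst; apply: E_bounded; exact: E_trig.
Qed.

Let E_add f g : E f -> E g -> E (fun z => f z + g z).
Proof.
move=> Ef Eg; apply: (Ef (fun f => E (fun z => f z + g z))).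
- by move=> k tk; exact: E_add_trig.
- by move=> F k EF Fk; apply: (E_lim EF); apply: bplimD => //; apply: bplim_cst; exact: E_bounded.
Qed.

(** All the linearity is established for the minimal class [E], which lies inside [H]. This suits
    classes [H] cut out by an inequality that is not linear in [f]. *)
Lemma bounded_in_trig_class H f (C : R) : trig `<=` H -> bp_closed H ->
  measC f -> (forall z, cabs (f z) <= C) -> H f.
Proof.
move=> tH cH mf fC.
have E1 : E (fun=> 1).
  apply: E_trig; exists 1, 0; apply/funext => z; rewrite !hornerE.
  by apply: ext_complex; rewrite /= ?oppr0 ?addr0.
have EZ c g : E g -> E (fun z => c * g z).
  by apply: (E_mul (h := fun=> c) (C := cabs c)) => // k; exact: trig_scale.
have Ez g : E g -> E (fun z => circle_val z * g z).
  apply: (E_mul (h := fun z => circle_val z) (C := 1)); last exact: trig_z.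
  by move=> z; rewrite cabs_circle.
have EzJ g : E g -> E (fun z => (circle_val z)^*%C * g z).
  apply: (E_mul (h := fun z => (circle_val z)^*%C) (C := 1)); last exact: trig_zJ.
  by move=> z; rewrite cabsJ cabs_circle.
have Eind A : measurable A -> E (indC A).
  exact: (indC_in_system E_bounded E_lim E_add EZ E1 Ez EzJ).
by have := bounded_in_system E_lim E_add EZ Eind mf fC; apply.
Qed.

End trigonometric_class.

(** * A lower bound for integrals of exponentials *)

Section exponential_class.
Context {R : realType}.
Local Notation m := (@haar R).
Implicit Types (f : circle R -> R[i]) (v g : circle R -> R).

Lemma integralC_dct (nu : probability (circle R) R) (F : nat -> circle R -> R[i]) f g :
  (forall n, measC (F n)) -> (forall z, cvgC (F ^~ z) (f z)) ->
  (forall n z, cabs (F n z) <= g z) -> rintegrable nu g ->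
  cvgC (fun n => integralC nu (F n)) (integralC nu f).
Proof.
move=> mF Ff Fg ig; apply: cvgC_ReIm => /=.
- have [||||_] := @rint_dct _ nu (fun n z => Re (F n z)) (fun z => Re (f z)) g => //.
  + by move=> n; have [] := mF n.
  + by move=> z; apply: cvgC_Re (Ff z).
  + by move=> n z; exact: le_trans (Re_le_cabs _) (Fg n z).
- have [||||_] := @rint_dct _ nu (fun n z => Im (F n z)) (fun z => Im (f z)) g => //.
  + by move=> n; have [] := mF n.
  + by move=> z; apply: cvgC_Im (Ff z).
  + by move=> n z; exact: le_trans (Im_le_cabs _) (Fg n z).
Qed.

(** With [w = A / 2n] and the power [n], it bounds [|1 + A/2n|^(2n)] by [e^(Re A)] times
    [e^(|A|^2 / 4n)]. *)
Lemma cabs2_1D (w : R[i]) : cabs (1 + w) ^+ 2 <= expR (2 * Re w + cabs w ^+ 2).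
Proof.
apply: le_trans (expR_ge1Dx _); rewrite !cabs2 ReCD ImCD /=.
by rewrite le_eqVlt; apply/orP; left; apply/eqP; ring.
Qed.

Lemma cvg_invn (c : R) : c / n.+1%:R @[n --> \oo] --> (0 : R).
Proof.
have -> : (0 : R) = c * 0 by rewrite mulr0.
by apply: cvgM; [exact: cvg_cst|exact: cvg_harmonic].
Qed.

Lemma le_rint (nu : probability (circle R) R) v g : rintegrable nu v -> rintegrable nu g ->
  (forall z, v z <= g z) -> (\int[nu]_z v z <= \int[nu]_z g z)%R.
Proof. by move=> iv ig vg; apply: le_Rintegral. Qed.

Variables (nu : probability (circle R) R) (g : circle R -> R) (C d : R).
Hypotheses (mg : measurable_fun setT g) (g_ge0 : forall z, 0 <= g z)
  (g_le : forall z, g z <= C)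
  (gd : forall q : {poly R[i]}, q.[0] = 1 ->
    d <= (\int[nu]_z (g z * cabs q.[circle_val z] ^+ 2))%R).

Let H f := [/\ measC f, exists M : R, forall z, cabs (f z) <= M &
  d * expR (\int[m]_z Re (f z))%R <= (\int[nu]_z (g z * expR (Re (f z))))%R].

Let intg v (M : R) : measurable_fun setT v -> (forall z, v z <= M) ->
  rintegrable nu (fun z => g z * expR (v z)).
Proof.
move=> mv vM; apply: (@rintegrable_bounded _ _ _ (C * expR M)).
  by apply: measurable_funM => //; apply: measurableT_comp.
move=> z; rewrite ger0_norm ?mulr_ge0 ?expR_ge0//.
by rewrite ler_pM ?expR_ge0// ler_expR.
Qed.

Let H_trig : @trig R `<=` H.
Proof.
move=> f [p [q fE]].
have [C1 pC] := poly_bounded p; have [C2 qC] := poly_bounded q.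
have mf : measC f.
  by rewrite fE; apply: measCD; [exact: measC_poly|apply: measCJ; exact: measC_poly].
have fC z : cabs (f z) <= C1 + C2.
  by rewrite fE; apply: le_trans (cabsD _ _) _; rewrite cabsJ lerD.
split=> //; first by exists (C1 + C2).
(* [f] has the real part of the analytic polynomial [p + q], whose mean is its value [c] at 0;
   removing [c] gives the test polynomials the value 1 at 0. *)
pose c := (p + q).[0]; pose A := p + q - c%:P.
have A0 : A.[0] = 0 by rewrite /A hornerD hornerN hornerC subrr.
have [K AK] := poly_bounded A.
have ReA z : Re (f z) = Re A.[circle_val z] + Re c.
  by rewrite fE /A !hornerE !ReCD ReCJ ReCN subrK.
have -> : (\int[m]_z Re (f z))%R = Re c.
  transitivity (Re (integralC m (on_circle (horner (p + q))))).
    by rewrite /integralC /=; apply: eq_Rintegral => z _; rewrite fE /on_circle hornerD !ReCD ReCJ.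
  by rewrite haar_poly.
have mRe : measurable_fun setT (fun z => Re (f z)) by case: mf.
have fRe z : Re (f z) <= C1 + C2 by apply: le_trans (ler_norm _) (le_trans (Re_le_cabs _) (fC z)).
set I := (\int[nu]_z _)%R.
(* The factor [e^(K^2/(n+1))] generously covers the second-order error [|A|^2 / (4 (n + 1))] of the
   test polynomial and tends to 1. *)
have key n : d * expR (Re c) <= expR (K ^+ 2 / n.+1%:R) * I.
  pose w (z : R[i]) := (n.+1%:R^-1 / 2 : R)%:C * A.[z].
  pose Q := (1 + (n.+1%:R^-1 / 2 : R)%:C *: A) ^+ n.+1.
  have QE z : Q.[z] = (1 + w z) ^+ n.+1 by rewrite /Q horner_exp hornerD hornerZ -[X in X.[z] + _]polyC1 hornerC.
  have Q0 : Q.[0] = 1 by rewrite QE /w A0 mulr0 addr0 expr1n.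
  have n0 : n.+1%:R != 0 :> R by rewrite pnatr_eq0.
  have QB (z : circle R) : cabs Q.[circle_val z] ^+ 2 <= expR (K ^+ 2 / n.+1%:R - Re c) * expR (Re (f z)).
    rewrite QE cabsX -exprM mulnC exprM -expRD.
    apply: (@le_trans _ _ (expR (2 * Re (w z) + cabs (w z) ^+ 2) ^+ n.+1)).
      by apply: lerXn2r; rewrite ?nnegrE ?sqr_ge0 ?expR_ge0//; exact: cabs2_1D.
    rewrite -expRM_natl ler_expR ReA /w ReCM /= mul0r subr0 cabsM cabsR exprMn real_normK ?num_real//.
    have h : cabs A.[circle_val z] ^+ 2 <= K ^+ 2.
      by apply: lerXn2r; rewrite ?nnegrE ?cabs_ge0//; exact: le_trans (cabs_ge0 _) (AK z).
    have -> : n.+1%:R * (2 * (n.+1%:R^-1 / 2 * Re A.[circle_val z]) +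
        (n.+1%:R^-1 / 2) ^+ 2 * cabs A.[circle_val z] ^+ 2) =
        Re A.[circle_val z] + (4 * n.+1%:R)^-1 * cabs A.[circle_val z] ^+ 2 by field.
    have h1 : (4 * n.+1%:R)^-1 * cabs A.[circle_val z] ^+ 2 <= K ^+ 2 / n.+1%:R.
      rewrite mulrC ler_pM ?sqr_ge0//.
      have p0 : 0 < n.+1%:R :> R by rewrite ltr0n.
      by rewrite lef_pV2 ?posrE ?mulr_gt0//; move: p0; lra.
    by move: h1; set X := _^-1 * _; set Y := K ^+ 2 / _; lra.
  have intQ : rintegrable nu (fun z => g z * cabs Q.[circle_val z] ^+ 2).
    have [D QD] := poly_bounded Q.
    apply: (@rintegrable_bounded _ _ _ (C * D ^+ 2)).
      apply: measurable_funM => //.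
      exact: (measC_cabs2 (measC_poly Q)).
    move=> z; rewrite ger0_norm; last by apply: mulr_ge0 => //; exact: sqr_ge0.
    have D0 := le_trans (cabs_ge0 _) (QD z).
    apply: ler_pM => //; first exact: sqr_ge0.
    by apply: lerXn2r; rewrite ?nnegrE//; exact: cabs_ge0.
  have intf := intg mRe fRe.
  have := gd Q0; set J := Rintegral _ _ _ => dJ.
  have JI : J <= expR (K ^+ 2 / n.+1%:R - Re c) * I.
    rewrite /I -RintegralZl//; apply: le_rint => //; first exact: rintegrableZ.
    by move=> z; rewrite [leRHS]mulrCA; apply: ler_wpM2l.
  rewrite mulrC -ler_pdivlMl ?expR_gt0//.
  apply: le_trans dJ (le_trans JI _).
  by rewrite expRD expRN mulrA [_ * expR _]mulrC.
have I0 : 0 <= I by apply: Rintegral_ge0 => z _; rewrite mulr_ge0 ?expR_ge0.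
have -> : I = expR 0 * I by rewrite expR0 mul1r.
have cv : expR (K ^+ 2 / n.+1%:R) * I @[n --> \oo] --> expR 0 * I.
  apply: cvgM; last exact: cvg_cst.
  by apply: continuous_cvg; [exact: continuous_expR|exact: cvg_invn].
rewrite -(cvg_lim _ cv)//; apply: limr_ge; first by apply/cvg_ex; eexists; exact: cv.
exact: nearW.
Qed.

Let H_lim : bp_closed H.
Proof.
move=> F f HF [[M FM] Ff].
have mF n : measC (F n) by have [] := HF n.
have M0 : 0 <= M by exact: le_trans (cabs_ge0 _) (FM 0%N (circle_one R)).
have mf : measC f by exact: measC_cvg Ff.
have fM z : cabs (f z) <= M.
  by rewrite ler_cabs_sqr//; apply: (cvgC_shift_le (Ff z)) => n; rewrite -ler_cabs_sqr.
split=> //; first by exists M.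
have mR n : measurable_fun setT (fun z => Re (F n z)) by have [] := mF n.
have [||||_ c1] := @rint_dct _ m (fun n z => Re (F n z)) (fun z => Re (f z)) (fun=> M).
- exact: mR.
- by move=> z; exact: cvgC_Re (Ff z).
- by move=> n z; exact: le_trans (Re_le_cabs _) (FM n z).
- exact: rintegrable_cst.
have [||||_ c2] := @rint_dct _ nu (fun n z => g z * expR (Re (F n z)))
    (fun z => g z * expR (Re (f z))) (fun=> C * expR M).
- by move=> n; apply: measurable_funM => //; exact: measurableT_comp.
- move=> z; apply: cvgM; first exact: cvg_cst.
  by apply: continuous_cvg; [exact: continuous_expR|exact: cvgC_Re (Ff z)].
- move=> n z; rewrite ger0_norm ?mulr_ge0 ?expR_ge0//.
  rewrite ler_pM ?expR_ge0// ler_expR.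
  exact: le_trans (ler_norm _) (le_trans (Re_le_cabs _) (FM n z)).
- exact: rintegrable_cst.
have c3 : d * expR (\int[m]_z Re (F n z))%R @[n --> \oo] --> d * expR (\int[m]_z Re (f z))%R.
  apply: cvgM; first exact: cvg_cst.
  by apply: continuous_cvg; [exact: continuous_expR|exact: c1].
rewrite -(cvg_lim _ c3)// -(cvg_lim _ c2)//; apply: ler_lim.
- by apply/cvg_ex; eexists; exact: c3.
- by apply/cvg_ex; eexists; exact: c2.
- by apply: nearW => n; have [] := HF n.
Qed.

(* For a trigonometric polynomial [v = Re A] with [A 0 = 0] test the hypothesis with
   [q = (1 + A / 2n) ^ n], whose modulus squared is asymptotically at most [e^v]. *)
Lemma exp_lower_bound v (M : R) : measurable_fun setT v -> (forall z, `|v z| <= M) ->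
  d * expR (\int[m]_z v z)%R <= (\int[nu]_z (g z * expR (v z)))%R.
Proof.
move=> mv vM.
have [_ _] : H (fun z => (v z)%:C).
  apply: (bounded_in_trig_class (C := M) H_trig H_lim).
    by split=> //=; exact: measurable_cst.
  by move=> z; rewrite cabsR.
by [].
Qed.

End exponential_class.

(** * Integration against the Lebesgue decomposition *)

Section density.
Context {R : realType} (mu : probability (circle R) R).
Local Notation m := (@haar R).
Implicit Types (f : circle R -> R[i]) (A : set (circle R)).
Variables (w : circle R -> R) (N : set (circle R)).
Hypotheses (mw : measurable_fun setT w) (w_ge0 : forall z, 0 <= w z)
  (mN : measurable N) (N0 : m N = 0%E)
  (muE : forall A, measurable A ->
    (mu A = \int[m]_(z in A) (w z)%:E + mu (A `&` N))%E).

Lemma density_le A : measurable A -> (\int[m]_(z in A) (w z)%:E <= 1)%E.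
Proof.
move=> mA; apply: le_trans (probability_le1 mu mA).
by rewrite [leRHS]muE// leeDl.
Qed.

Lemma density_integrable : rintegrable m w.
Proof.
apply/integrableP; split; first exact/measurable_EFinP.
under eq_integral do rewrite /= ger0_norm//.
exact: le_lt_trans (density_le measurableT) (ltry _).
Qed.

Lemma density_int_le1 : (\int[m]_z w z <= 1)%R.
Proof. by rewrite -lee_fin -rintE ?density_le//; exact: density_integrable. Qed.

Let H f := [/\ measC f, exists C : R, forall z, cabs (f z) <= C &
  integralC mu f = integralC m (fun z => (w z)%:C * f z) +
    integralC mu (fun z => indC N z * f z)].

Let intC_w f (C : R) : measC f -> (forall z, cabs (f z) <= C) ->
  integrableC m (fun z => (w z)%:C * f z).
Proof.
move=> mf fC; apply: (@integrableC_le _ _ _ (fun z => C * w z)).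
- by apply: measCM => //; split=> //=; exact: measurable_cst.
- by move=> z; rewrite cabsM cabsR ger0_norm// mulrC ler_wpM2r.
- exact: rintegrableZ density_integrable.
Qed.

Let intC_N f (C : R) : measC f -> (forall z, cabs (f z) <= C) ->
  integrableC mu (fun z => indC N z * f z).
Proof.
move=> mf fC; apply: (@integrableC_bounded _ _ _ C).
  by apply: measCM => //; exact: measC_indC.
move=> z; rewrite cabsM cabsR indicE; case: (z \in N).
  by rewrite normr1 mul1r.
by rewrite normr0 mul0r (le_trans (cabs_ge0 _) (fC z)).
Qed.

Let H_add f g : H f -> H g -> H (fun z => f z + g z).
Proof.
move=> [mf [C fC] ef] [mg [D gD] eg]; split.
- exact: measCD.
- by exists (C + D) => z; rewrite (le_trans (cabsD _ _))// lerD.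
rewrite integralCD; [|exact: integrableC_bounded fC|exact: integrableC_bounded gD].
rewrite ef eg addrACA -!integralCD.
- by congr (integralC _ _ + integralC _ _); apply/funext => z; rewrite mulrDr.
- exact: intC_N fC.
- exact: intC_N gD.
- exact: intC_w fC.
- exact: intC_w gD.
Qed.

Let H_scale c f : H f -> H (fun z => c * f z).
Proof.
move=> [mf [C fC] ef]; split.
- exact: measCZ.
- by exists (cabs c * C) => z; rewrite cabsM ler_wpM2l ?cabs_ge0.
rewrite integralCZ; last exact: integrableC_bounded fC.
rewrite ef mulrDr -!integralCZ; [|exact: intC_N fC|exact: intC_w fC].
by congr (integralC _ _ + integralC _ _); apply/funext => z; rewrite mulrCA.
Qed.

Let H_lim (F : nat -> circle R -> R[i]) f : (forall n, H (F n)) -> bplim F f -> H f.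
Proof.
move=> HF [[M FM] Ff].
have mF n : measC (F n) by have [] := HF n.
have M0 : 0 <= M by exact: le_trans (cabs_ge0 _) (FM 0%N (circle_one R)).
have mf : measC f by exact: measC_cvg Ff.
split=> //.
  exists M => z; rewrite ler_cabs_sqr//; apply: (cvgC_shift_le (Ff z)) => n.
  by rewrite -ler_cabs_sqr.
have c1 := integralC_dct mF Ff FM (rintegrable_cst mu M).
have c2 : cvgC (fun n => integralC m (fun z => (w z)%:C * F n z))
    (integralC m (fun z => (w z)%:C * f z)).
  apply: (integralC_dct (g := fun z => M * w z)).
  - by move=> n; apply: measCM => //; split=> //=; exact: measurable_cst.
  - by move=> z; exact: cvgCZ.
  - by move=> n z; rewrite cabsM cabsR ger0_norm// mulrC ler_wpM2r.
  - exact: rintegrableZ density_integrable.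
have c3 : cvgC (fun n => integralC mu (fun z => indC N z * F n z))
    (integralC mu (fun z => indC N z * f z)).
  apply: (integralC_dct (g := fun=> M)).
  - by move=> n; apply: measCM => //; exact: measC_indC.
  - by move=> z; exact: cvgCZ.
  - move=> n z; rewrite cabsM cabsR indicE; case: (z \in N).
      by rewrite normr1 mul1r.
    by rewrite normr0 mul0r.
  - exact: rintegrable_cst.
apply: (cvgC_unique c1); have := cvgCD c2 c3; congr cvgC; apply/funext => n.
by have [_ _ ->] := HF n.
Qed.

Let H_ind A : measurable A -> H (indC A).
Proof.
move=> mA; split; first exact: measC_indC.
  by exists 1 => z; rewrite cabsR indicE; case: (z \in A); rewrite ?normr1// normr0.
have indE B (nu : probability (circle R) R) : measurable B ->
    (\int[nu]_z \1_B z)%R = fine (nu B).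
  by move=> mB; rewrite /Rintegral integral_indic// setIT.
have -> : integralC mu (indC A) = (fine (mu A))%:C.
  by apply: ext_complex; rewrite /integralC /= ?Rintegral_cst ?mul0r// indE.
have -> : integralC mu (fun z => indC N z * indC A z) = (fine (mu (A `&` N)))%:C.
  have -> : (fun z => indC N z * indC A z) = indC (A `&` N).
    by apply/funext => z; rewrite /indC indicI -rmorphM /= mulrC.
  by apply: ext_complex; rewrite /integralC /= ?Rintegral_cst ?mul0r// indE//; exact: measurableI.
have -> : integralC m (fun z => (w z)%:C * indC A z) = (fine (\int[m]_(z in A) (w z)%:E)%E)%:C.
  have -> : (fun z => (w z)%:C * indC A z) = (fun z => (w z * \1_A z)%:C).
    by apply/funext => z; rewrite /indC rmorphM.
  apply: ext_complex; rewrite /integralC /= ?Rintegral_cst ?mul0r//.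
  rewrite /Rintegral [in RHS]integral_mkcond; congr fine; apply: eq_integral => z _.
  by rewrite /patch indicE; case: ifP => _; rewrite ?mulr1// mulr0.
rewrite muE// fineD ?rmorphD//.
- rewrite ge0_fin_numE; first exact: le_lt_trans (density_le mA) (ltry _).
  by apply: integral_ge0 => z _; rewrite lee_fin.
- by apply: fin_num_measure; exact: measurableI.
Qed.

(** On indicators the identity is [muE]; both sides are linear and follow bounded pointwise limits,
    the first term on the right being dominated by a multiple of [w]. *)
Lemma density_formula f (C : R) : measC f -> (forall z, cabs (f z) <= C) ->
  integralC mu f = integralC m (fun z => (w z)%:C * f z) +
    integralC mu (fun z => indC N z * f z).
Proof.
move=> mf fC; have [] // : H f by exact: (bounded_in_system H_lim H_add H_scale H_ind mf fC).
Qed.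

Lemma density_rint (f : circle R -> R) (C : R) : measurable_fun setT f ->
  (forall z, `|f z| <= C) ->
  (\int[mu]_z f z)%R = (\int[m]_z (w z * f z))%R + (\int[mu]_z (\1_N z * f z))%R.
Proof.
move=> mf fC.
have mfC : measC (fun z => (f z)%:C) by split=> //=; exact: measurable_cst.
have := @density_formula (fun z => (f z)%:C) C mfC.
have fC' (z : circle R) : cabs (f z)%:C <= C by rewrite cabsR.
move=> /(_ fC') /(congr1 (@complex.Re R)); rewrite ReCD /integralC /= => ->.
by congr (_ + _); apply: eq_Rintegral => z _; rewrite mul0r subr0.
Qed.

End density.

(** * The two estimates of Szego's theorem *)

Section szego.
Context {R : realType} (mu : probability (circle R) R).
Local Notation m := (@haar R).
Variables (w : circle R -> R) (N : set (circle R)).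
Hypotheses (mw : measurable_fun setT w) (w_ge0 : forall z, 0 <= w z)
  (mN : measurable N) (N0 : m N = 0%E)
  (muE : forall A, measurable A ->
    (mu A = \int[m]_(z in A) (w z)%:E + mu (A `&` N))%E).

Let ie n : R := n.+1%:R^-1.
Let u n z := Num.max (ie n) (Num.min (w z) 1).

Let ie_gt0 n : 0 < ie n. Proof. by rewrite invr_gt0 ltr0n. Qed.
Let ie_le1 n : ie n <= 1. Proof. by rewrite invf_le1 ?ltr0n// ler1n. Qed.

Let u_gt0 n z : 0 < u n z. Proof. by rewrite lt_max ie_gt0. Qed.
Let u_le1 n z : u n z <= 1. Proof. by rewrite ge_max ie_le1 ge_min lexx orbT. Qed.
Let u_ge n z : ie n <= u n z. Proof. by rewrite le_max lexx. Qed.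
Let u_geW n z : Num.min (w z) 1 <= u n z. Proof. by rewrite le_max lexx orbT. Qed.
Let u_le n z : u n z <= ie n + w z.
Proof.
rewrite ge_max lerDl w_ge0/=; apply: le_trans (_ : w z <= _); first by rewrite ge_min lexx.
by rewrite lerDr ltW.
Qed.

Let mu_ n : measurable_fun setT (u n).
Proof.
apply: measurable_maxr; first exact: measurable_cst.
by apply: measurable_minr => //; exact: measurable_cst.
Qed.

Let lnu_le0 n z : ln (u n z) <= 0. Proof. by apply: ln_le0; exact: u_le1. Qed.

Let lnu_bnd n z : `|ln (u n z)| <= - ln (ie n).
Proof. by rewrite ler0_norm// lerN2 ler_ln ?posrE. Qed.

Let mlnu n : measurable_fun setT (fun z => ln (u n z)).
Proof. by apply: (measurableT_comp (f := @ln R)); [exact: measurable_ln|exact: mu_]. Qed.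

Let lne_max z : (lne (w z)%:E)%E = if w z <= 0 then -oo%E else (ln (w z))%:E.
Proof. by []. Qed.

Lemma measurable_lne_density : measurable_fun setT (fun z => lne (w z)%:E).
Proof.
apply: (measurable_fun_ifT (f := fun z => w z <= 0) (g := fun=> -oo%E) (h := fun z => (ln (w z))%:E)).
- exact: measurable_fun_ler.
- exact: measurable_cst.
- by apply/measurable_EFinP; apply: (measurableT_comp (f := @ln R)) mw; exact: measurable_ln.
Qed.

Let abs_lne_ge n z : ((- ln (u n z))%:E <= `|lne (w z)%:E|)%E.
Proof.
rewrite lne_max; case: ifPn => [_|]; first exact: leey.
rewrite -ltNge => w0; rewrite lee_fin -ler0_norm//.
have [w1|w1] := leP (w z) 1.
  rewrite !ler0_norm ?ln_le0// lerN2 ler_ln ?posrE//.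
  by apply: le_trans (u_geW n z); rewrite le_min lexx.
have -> : u n z = 1.
  by apply/eqP; rewrite eq_le u_le1/= (le_trans _ (u_geW n z))// le_min lexx ltW.
by rewrite ln1 normr0.
Qed.

Let rint_cst (nu : probability (circle R) R) (c : R) : (\int[nu]_z c)%R = c.
Proof. by rewrite Rintegral_cst// [X in fine X]probability_setT mulr1. Qed.

(* The density is truncated to [u_n = max(1/(n+1), min(w, 1))]. *)
Lemma szego_lower_bound : m.-integrable setT (fun z => lne (w z)%:E) ->
  exists2 c : R, 0 < c & forall q : {poly R[i]}, q.[0] = 1 -> c <= nsq mu (on_circle (horner q)).
Proof.
move=> ilne.
pose L := fine (\int[m]_z `|lne (w z)%:E|)%E.
have LE : (\int[m]_z `|lne (w z)%:E| = L%:E)%E.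
  rewrite fineK// ge0_fin_numE; first by have /integrableP[] := ilne.
  exact: integral_ge0.
exists (expR (- L)); first exact: expR_gt0.
move=> q q0; set X := nsq _ _.
have [D qD] := poly_bounded q.
have D0 : 0 <= D by exact: le_trans (cabs_ge0 _) (qD (circle_one R)).
have mq : measurable_fun setT (fun z : circle R => cabs q.[circle_val z] ^+ 2).
  exact: (measC_cabs2 (measC_poly q)).
have q_ge0 (z : circle R) : 0 <= cabs q.[circle_val z] ^+ 2 by exact: sqr_ge0.
have q_le (z : circle R) : cabs q.[circle_val z] ^+ 2 <= D ^+ 2.
  by apply: lerXn2r; rewrite ?nnegrE//; exact: cabs_ge0.
(* The hypothesis of [exp_lower_bound] for [nu = m], [g = |q|^2] and [d = 1]: the product [q p] also
   takes the value 1 at 0. *)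
have q1 (p : {poly R[i]}) : p.[0] = 1 ->
    1 <= (\int[m]_z (cabs q.[circle_val z] ^+ 2 * cabs p.[circle_val z] ^+ 2))%R.
  move=> p0; have := haar_poly_le (q * p).
  rewrite hornerM q0 p0 mulr1 cabs1 expr1n /nsq; congr (_ <= _).
  by apply: eq_Rintegral => z _; rewrite /on_circle hornerM cabsM exprMn.
have iw := density_integrable mw w_ge0 muE.
have iqw : rintegrable m (fun z => w z * cabs q.[circle_val z] ^+ 2).
  apply: (@rintegrable_le _ _ _ (fun z => D ^+ 2 * w z)).
  - exact: measurable_funM.
  - by move=> z; rewrite ger0_norm; [rewrite [leRHS]mulrC; apply: ler_wpM2l|exact: mulr_ge0].
  - exact: rintegrableZ.
(* With [v = ln u_n] the right-hand integral is that of [|q|^2 u_n], and [u_n <= 1/(n+1) + w]. On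
   the left, [- ln u_n] is dominated by [|log w|]. *)
have step n : expR (- L) <= D ^+ 2 / n.+1%:R + X.
  have := exp_lower_bound mq q_ge0 q_le q1 (@mlnu n) (@lnu_bnd n).
  rewrite mul1r => h; apply: le_trans (le_trans h _).
    rewrite ler_expR lerNl -lee_fin -LE.
    have iu : rintegrable m (fun z => ln (u n z)) by exact: rintegrable_bounded (mlnu n) (lnu_bnd n).
    have -> : - (\int[m]_z ln (u n z))%R = (\int[m]_z (- ln (u n z)))%R.
      by rewrite -mulN1r -RintegralZl//; apply: eq_Rintegral => z _; rewrite mulN1r.
    rewrite -rintE; last first.
      by have := rintegrableZ (-1) iu; congr rintegrable; apply/funext => z; rewrite mulN1r.
    apply: ge0_le_integral => //.
    - by move=> z _; rewrite lee_fin oppr_ge0.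
    - by apply/measurable_EFinP; exact: measurableT_comp.
    - by apply: measurableT_comp => //; exact: measurable_lne_density.
  have iX : (\int[m]_z (w z * cabs q.[circle_val z] ^+ 2))%R <= X.
    rewrite /X /nsq (density_rint mw w_ge0 mN muE (C := D ^+ 2))//; last first.
      by move=> z; rewrite ger0_norm; [exact: q_le|exact: q_ge0].
    rewrite lerDl; apply: Rintegral_ge0 => z _; apply: mulr_ge0; last exact: q_ge0.
    by rewrite indicE ler0n.
  apply: le_trans (lerD (lexx _) iX).
  rewrite -[D ^+ 2 / _](rint_cst m) -RintegralD//; last exact: rintegrable_cst.
  apply: le_rint.
  - apply: (@rintegrable_bounded _ _ _ (D ^+ 2 * 1)).
      by apply: measurable_funM => //; apply: measurableT_comp.
    move=> z; rewrite ger0_norm; last by apply: mulr_ge0 => //; exact: expR_ge0.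
    rewrite lnK ?posrE//.
    by apply: ler_pM => //; exact: ltW.
  - by apply: rintegrableD => //; exact: rintegrable_cst.
  - move=> z; rewrite lnK ?posrE//; apply: le_trans (ler_wpM2l (q_ge0 z) (u_le n z)) _.
    rewrite mulrDr [_ * w z]mulrC lerD2r.
    by apply: ler_wpM2r; [exact: ltW|exact: q_le].
have cv : D ^+ 2 / n.+1%:R + X @[n --> \oo] --> 0 + X.
  by apply: cvgD; [exact: cvg_invn|exact: cvg_cst].
rewrite -[X]add0r -(cvg_lim _ cv)//; apply: limr_ge; first by apply/cvg_ex; eexists; exact: cv.
exact: nearW.
Qed.

(* [v_n = - ln u_n] off [N] and 0 on [N], which makes [int e^(v_n) dmu] at most 3. *)
Lemma szego_upper_bound (d : R) : 0 < d ->
  (forall q : {poly R[i]}, q.[0] = 1 -> d <= nsq mu (on_circle (horner q))) ->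
  m.-integrable setT (fun z => lne (w z)%:E).
Proof.
move=> d0 dq.
have iw := density_integrable mw w_ge0 muE.
pose v n z := - ln (u n z) * \1_(~` N) z.
have mv n : measurable_fun setT (v n).
  apply: measurable_funM; first by apply: measurable_funN; exact: mlnu.
  by apply: measurable_indic; exact: measurableC.
have v_bnd n z : `|v n z| <= - ln (ie n).
  rewrite /v normrM normrN indicE; case: (_ \in _).
    by rewrite normr1 mulr1.
  by rewrite normr0 mulr0 (le_trans (normr_ge0 _) (lnu_bnd n z)).
have bound n : (\int[m]_z (- ln (u n z)))%R <= ln (3 / d).
  have dq1 (q : {poly R[i]}) : q.[0] = 1 -> d <= (\int[mu]_z (1 * cabs q.[circle_val z] ^+ 2))%R.
    by move=> /dq; congr (_ <= _); apply: eq_Rintegral => z _; rewrite mul1r.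
  have := exp_lower_bound (@measurable_cst _ _ _ R setT (1 : R)) (fun=> ler01) (fun=> lexx 1) dq1 (@mv n) (@v_bnd n).
  (* The cut on [N] is invisible to [m], while it keeps [e^(v_n)] equal to 1 on the set carrying the
     singular part. *)
  have -> : (\int[m]_z v n z)%R = (\int[m]_z (- ln (u n z)))%R.
    congr fine; apply: ae_eq_integral => //.
    - exact/measurable_EFinP.
    - by apply/measurable_EFinP; exact: measurableT_comp.
    - exists N; split=> // z /= h; apply: contrapT => Nz; apply: h => _.
      by rewrite /v indicE mem_set// mulr1.
  have ev_le z : expR (v n z) <= (ie n)^-1.
    by rewrite -[(ie n)^-1]lnK ?posrE ?invr_gt0// ler_expR lnV ?posrE// (le_trans (ler_norm _) (v_bnd n z)).
  have mev : measurable_fun setT (fun z => expR (v n z)) by exact: measurableT_comp.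
  have -> : (\int[mu]_z (cst 1 z * expR (v n z)))%R = (\int[mu]_z expR (v n z))%R.
    by apply: eq_Rintegral => z _; rewrite /cst mul1r.
  rewrite (density_rint mw w_ge0 mN muE (C := (ie n)^-1))//; last first.
    by move=> z; rewrite ger0_norm ?expR_ge0.
  (* Off [N] the integrand is [w / u_n]: at most 1 where [w <= 1], and equal to [w] elsewhere
     because [u_n = 1] there. *)
  have h1 : (\int[m]_z (w z * expR (v n z)))%R <= 2.
    apply: (@le_trans _ _ (\int[m]_z (1 + w z))%R).
      have wle z : w z * expR (v n z) <= 1 + w z.
        rewrite /v indicE; case: (_ \in _); last by rewrite mulr0 expR0 mulr1 lerDr.
        rewrite mulr1 expRN lnK ?posrE// ler_pdivrMr//.
        have [w1|w1] := leP (w z) 1.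
          have wu : w z <= u n z by apply: le_trans (u_geW n z); rewrite le_min lexx.
          by apply: le_trans wu _; rewrite ler_peMl ?lerDl// ltW.
        have -> : u n z = 1.
          by apply/eqP; rewrite eq_le u_le1/= (le_trans _ (u_geW n z))// le_min lexx ltW.
        by rewrite mulr1 lerDr.
      apply: le_rint => //.
      - apply: (@rintegrable_le _ _ _ (fun z => 1 + w z)).
        + exact: measurable_funM.
        + by move=> z; rewrite ger0_norm ?mulr_ge0 ?expR_ge0.
        + by apply: rintegrableD => //; exact: rintegrable_cst.
      - by apply: rintegrableD => //; exact: rintegrable_cst.
    rewrite RintegralD//; last exact: rintegrable_cst.
    by rewrite rint_cst; have := density_int_le1 mw w_ge0 muE; lra.
  have h2 : (\int[mu]_z (\1_N z * expR (v n z)))%R <= 1.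
    rewrite -[leRHS](rint_cst mu); apply: le_rint; last first.
    - move=> z; rewrite /v !indicE in_setC; case: (z \in N); last by rewrite mul0r.
      by rewrite /= mulr0 expR0 mulr1.
    - exact: rintegrable_cst.
    - apply: (@rintegrable_bounded _ _ _ (ie n)^-1).
        by apply: measurable_funM => //; exact: measurable_indic.
      move=> z; rewrite ger0_norm ?mulr_ge0 ?expR_ge0// indicE; case: (_ \in _).
        by rewrite mul1r.
      by rewrite mul0r invr_ge0 ltW.
  move=> h; rewrite -ler_expR lnK ?posrE ?divr_gt0//.
  rewrite ler_pdivlMr// mulrC; apply: le_trans h _.
  by move: h1 h2; set X := Rintegral _ _ _; set Y := Rintegral _ _ _; lra.
pose G n z := (- ln (u n z))%:E.
have G0 n z : (0 <= G n z)%E by rewrite lee_fin oppr_ge0.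
have mG n : measurable_fun setT (G n).
  by apply/measurable_EFinP; exact: measurableT_comp.
have Gnd z : nondecreasing_seq (G ^~ z).
  move=> i j ij; rewrite /G lee_fin lerN2 ler_ln ?posrE//.
  rewrite ge_max u_geW andbT; apply: le_trans (u_ge i z).
  by rewrite lef_pV2 ?posrE ?ltr0n// ler_nat.
(* The increasing limit is [- ln (min (w, 1))], infinite where [w] vanishes; monotone convergence
   keeps the bound [ln (3 / d)]. *)
pose S z := limn (G ^~ z).
have GS n z : (G n z <= S z)%E.
  apply: lime_ge; first exact: ereal_nondecreasing_is_cvgn.
  by exists n => // k /= nk; exact: Gnd.
have intS : (\int[m]_z S z <= (ln (3 / d))%:E)%E.
  rewrite (monotone_convergence _ measurableT mG (fun n z _ => G0 n z) (fun z _ => Gnd z)).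
  apply: lime_le.
    apply: ereal_nondecreasing_is_cvgn => i j ij; apply: ge0_le_integral => // z _.
    exact: Gnd.
  apply: nearW => n; rewrite rintE ?lee_fin//.
  by apply: (@rintegrable_bounded _ _ _ (- ln (ie n))); [exact: measurableT_comp|move=> z; rewrite normrN].
have S_ge z (y : R) : 0 <= y -> w z <= expR (- y) -> (y%:E <= S z)%E.
  (* This [n] makes [1/(n+1) <= e^(-y)], so that the floor of the truncation does not prevent
     [u_n <= e^(-y)]. *)
  move=> y0 wy; pose n := Num.truncn (expR y).
  have iy : ie n <= expR (- y).
    by rewrite expRN lef_pV2 ?posrE ?ltr0n ?expR_gt0// ltW// truncnS_gt.
  apply: le_trans (GS n z); rewrite /G lee_fin lerNr -[- y]expRK ler_ln ?posrE ?expR_gt0//.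
  by rewrite ge_max iy/= ge_min wy.
have S0 z : (0 <= S z)%E by exact: le_trans (G0 0%N z) (GS 0%N z).
have mS : measurable_fun setT S.
  by apply: (emeasurable_fun_cvg G S mG) => z _; exact: ereal_nondecreasing_is_cvgn.
(* [S] controls the negative part of the logarithm; the positive part is below [w], whose integral
   is at most 1. *)
have lneS z : (`|lne (w z)%:E| <= S z + (w z)%:E)%E.
  rewrite lne_max; case: ifPn => [w0|].
    suff -> : S z = +oo%E by [].
    apply/eqyP => y y0; apply: S_ge; first exact: ltW.
    exact: le_trans w0 (expR_ge0 _).
  rewrite -ltNge => w0; have [w1|w1] := leP (w z) 1.
    apply: (@le_trans _ _ (S z)); last by rewrite leeDl// lee_fin.
    rewrite /= ler0_norm ?ln_le0//; apply: S_ge; first by rewrite oppr_ge0 ln_le0.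
    by rewrite opprK lnK.
  apply: (@le_trans _ _ (w z)%:E); last by rewrite leeDr.
  have l0 : 0 <= ln (w z) by apply: ln_ge0; exact: ltW.
  by rewrite [leLHS]/= (ger0_norm l0) lee_fin; apply: ltW; exact: ln_sublinear.
apply/integrableP; split; first exact: measurable_lne_density.
have mwE : measurable_fun setT (fun z => (w z)%:E) by exact/measurable_EFinP.
apply: (@le_lt_trans _ _ (\int[m]_z (S z + (w z)%:E))%E).
  apply: ge0_le_integral => //.
  - by apply: measurableT_comp => //; exact: measurable_lne_density.
  - exact: emeasurable_funD.
rewrite ge0_integralD//; last by move=> z _; rewrite lee_fin.
apply: (@le_lt_trans _ _ ((ln (3 / d))%:E + 1)%E); last by rewrite -EFinD ltry.
by apply: (leeD intS); exact: (density_le muE measurableT).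
Qed.

End szego.

(** * The distance from [conj z] to the polynomials *)

Section szego_polynomials.
Context {R : realType} (mu : probability (circle R) R).

Lemma poly_split (p : {poly R[i]}) : exists q c, p = q * 'X + c%:P.
Proof.
elim/poly_ind: p => [|q c _]; last by exists q, c.
by exists 0, 0; rewrite mul0r add0r; exact/esym/polyC0.
Qed.

Lemma nsq_one_sub_zq (q : {poly R[i]}) : nsq mu (on_circle (horner (1 - q * 'X))) =
  nsq mu (fun z => (circle_val z)^*%C - q.[circle_val z]).
Proof.
apply: eq_Rintegral => z _; rewrite /on_circle; congr (_ ^+ 2).
rewrite -[RHS]mul1r -(cabs_circle z) -cabsM mulrBr [circle_val z * _^*%C]mulrC circle_mulJ.
by rewrite hornerD hornerN hornerM hornerX -[X in X.[_] - _]polyC1 hornerC [circle_val z * _]mulrC.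
Qed.

(** A polynomial with value 1 at 0 has the form [1 - z q], and its modulus on the circle is that of
    [conj z - q]. *)
Lemma conj_in_poly_closureP :
  poly_closure mu (fun z => (circle_val z)^*%C) <->
  forall e : R, 0 < e -> exists2 q : {poly R[i]}, q.[0] = 1 & nsq mu (on_circle (horner q)) < e.
Proof.
have LJ : L2 mu (fun z => (circle_val z)^*%C).
  by apply: (@L2_bounded _ _ _ 1) => [|z]; [exact/measCJ/measC_id|rewrite cabsJ cabs_circle].
split=> [|h].
  move/L2closureP => /(_ (@polyfun_L2 _ _))[_ h] e e0.
  have [_ [q ->] qe] := h e e0; exists (1 - q * 'X); last by rewrite nsq_one_sub_zq.
  by rewrite hornerD hornerN hornerM hornerX mulr0 subr0 -polyC1 hornerC.
apply/L2closureP; first exact: polyfun_L2.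
split=> // e e0; have [p p0 pe] := h e e0.
have [q [c pE]] := poly_split p.
exists (on_circle (horner (- q))); first by exists (- q).
rewrite -(nsq_one_sub_zq (- q)); move: pe; congr (_ < _); congr (nsq _ (on_circle (horner _))).
move: p0; rewrite pE hornerD hornerM hornerX mulr0 add0r hornerC => ->.
by rewrite mulNr opprK addrC polyC1.
Qed.

Theorem szego : poly_closure mu = L2 mu <-> ~ log_density_integrable mu.
Proof.
(* [ac_density mu] is the function picked by this very choice, so the two bounds apply to it
   directly. *)
have [mw w0 [N [mN N0] muE]] := svalP (cid (lebesgue_decomposition mu)).
rewrite -poly_closure_full conj_in_poly_closureP; split.
- move=> h /(szego_lower_bound mw w0 mN muE)[c c0 cq].
  by have [q /cq] := h c c0; rewrite leNgt => /negP.
- move=> nlog e e0; apply: contrapT => ne; apply: nlog.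
  apply: (szego_upper_bound mw w0 mN N0 muE e0) => q q0.
  by rewrite leNgt; apply/negP => qe; apply: ne; exists q.
Qed.

End szego_polynomials.

(** * Orthogonal rational functions *)

Section orf_matrix.
Context {R : realType} (mu : probability (circle R) R).
Variables (alpha a : nat -> R[i]) (phi : nat -> R[i] -> R[i]) (r : R).
Hypotheses (r_lt1 : r < 1) (alpha_le : forall n, cabs (alpha n) <= r)
  (a_0 : a 0%N = 1) (orf : is_orf alpha mu phi a).
Local Notation et := (etaR alpha).
Local Notation H := (hessenberg a).
Local Notation F := (fun n => on_circle (phi n)).
Local Notation zF := (fun n (z : circle R) => circle_val z * phi n z).
Local Notation L := (rat_closure alpha mu).

Let a_lt1 n : (0 < n)%N -> `|a n| < 1. Proof. by case: orf => _ _ _ h _; exact: h. Qed.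

Let oF : Defs.orthonormal mu F. Proof. by case: orf. Qed.

Let et0 n : (et n)%:C != 0 :> R[i].
Proof. by rewrite fmorph_eq0 gt_eqF// (etaR_gt0 r_lt1 alpha_le). Qed.

Let rho0 n : (rhoR a n.+1)%:C != 0 :> R[i].
Proof. by rewrite fmorph_eq0 gt_eqF// (rhoR_gt0 a_lt1). Qed.

Lemma orf_eE n : orf_e alpha a n.+1 = (et n.+1 / (et n * rhoR a n.+1))%:C.
Proof.
have vE k : varpi alpha k (alpha k) = (et k ^+ 2)%:C.
  rewrite (etaR2 r_lt1 alpha_le) /varpi -cabs2C.
  by rewrite rmorphB rmorph1.
have p0 : 0 <= et n.+1 / (et n * rhoR a n.+1).
  by rewrite divr_ge0 ?mulr_ge0 ?ltW ?(etaR_gt0 r_lt1 alpha_le) ?(rhoR_gt0 a_lt1).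
have -> : et n.+1 / (et n * rhoR a n.+1) = Num.sqrt ((et n.+1 / (et n * rhoR a n.+1)) ^+ 2).
  by rewrite sqrtr_sqr ger0_norm.
rewrite -sqrtCR ?sqr_ge0// /orf_e !vE -cabsE -rmorphXn -(rmorph1 (@real_complex R)) -rmorphB.
by rewrite -(rhoR2 a_lt1) exprMn exprVn exprMn invfM mulrA [in RHS]rmorphM [in RHS]rmorphM !fmorphV.
Qed.

(** By [orf_eE] this rescaling reduces the prefactor of the recurrence to [1/rho_(n+1)]: what
    remains is the Szego recurrence of orthogonal polynomials with [zeta_n] in place of [z]. *)
Let psi n (z : circle R) : R[i] := varpi alpha n z * phi n z / (et n)%:C.
Let psis n (z : circle R) : R[i] := varpi alpha n z * upper_star alpha n (phi n) z / (et n)%:C.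

Let rec1 n (z : circle R) : (rhoR a n.+1)%:C * psi n.+1 z = zeta alpha n z * psi n z + a n.+1 * psis n z.
Proof.
case: orf => _ _ _ _ /(_ n.+1 z isT) [/= + _]; rewrite /psi /psis orf_eE => ->.
rewrite -[(_ / _)%:C]/(real_complex _ _) !rmorphM fmorphV rmorphM /=.
have := varpi_neq0 r_lt1 alpha_le n.+1 z; have := et0 n; have := et0 n.+1; have := rho0 n.
move: (rhoR a n.+1)%:C (et n.+1)%:C (et n)%:C (varpi alpha n.+1 z) => x y s t x0 y0 s0 t0.
by field; rewrite x0 y0 s0 t0.
Qed.

Let rec2 n (z : circle R) :
  (rhoR a n.+1)%:C * psis n.+1 z = (a n.+1)^*%C * (zeta alpha n z * psi n z) + psis n z.
Proof.
case: orf => _ _ _ _ /(_ n.+1 z isT) [/= _]; rewrite /psi /psis orf_eE => ->.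
rewrite -[(_ / _)%:C]/(real_complex _ _) !rmorphM fmorphV rmorphM /=.
have := varpi_neq0 r_lt1 alpha_le n.+1 z; have := et0 n; have := et0 n.+1; have := rho0 n.
move: (rhoR a n.+1)%:C (et n.+1)%:C (et n)%:C (varpi alpha n.+1 z) => x y s t x0 y0 s0 t0.
by field; rewrite x0 y0 s0 t0.
Qed.

(** Eliminating [zeta_n psi_n] between [rec1] and [rec2] yields [psi*_(n+1) = rho_(n+1) psi*_n +
    conj(a_(n+1)) psi_(n+1)], the conjugate of the recursion of [hstate]. *)
Let psis_state n (z : circle R) : psis n z = (hstate a (fun k => (psi k z)^*%C) n)^*%C.
Proof.
elim: n => [|n IH] /=.
  rewrite conjcK /psis /psi /upper_star /lower_star blaschke0 mul1r.
  case: orf => -> _ _ _ _.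
  by have -> : (1 : R[i])^*%C = 1 by apply: ext_complex; rewrite /= ?oppr0.
rewrite conjD (conjM (rho a n.+1)) (conjM (a n.+1)) conjcK -IH (rhoE a_lt1).
have -> : ((rhoR a n.+1)%:C)^*%C = (rhoR a n.+1)%:C :> R[i].
  by apply: ext_complex; rewrite /= ?oppr0.
apply: (mulfI (rho0 n)); rewrite rec2 mulrDr.
have <- : (rhoR a n.+1)%:C * psi n.+1 z - a n.+1 * psis n z = zeta alpha n z * psi n z.
  by rewrite rec1 addrK.
have r2 : (rhoR a n.+1)%:C * (rhoR a n.+1)%:C = 1 - (a n.+1)^*%C * a n.+1.
  by rewrite -rmorphM /= -expr2 (rhoR2 a_lt1) rmorphB rmorph1 -cabs2C.
rewrite [(rhoR a n.+1)%:C * (_ * psis n z)]mulrA r2.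
by move: (psi n.+1 z) (psis n z) => u v; ring.
Qed.

(* [zeta_n psi_n = rho_(n+1) psi_(n+1) - a_(n+1) psi*_n], where
   [psi*_n] unrolls into the sum of the [rho_n .. rho_(k+1) conj(a_k) psi_k]. *)
Let zeta_psi n (z : circle R) :
  zeta alpha n z * psi n z = \sum_(k < n.+2) H k n * psi k z.
Proof.
have -> : \sum_(k < n.+2) H k n * psi k z = (hadj a (fun k => (psi k z)^*%C) n)^*%C.
  by rewrite /hadj bigC_conj; apply: eq_bigr => k _; rewrite conjM !conjcK.
rewrite (hadjE a_lt1 a_0) conjB !conjM !conjcK -psis_state (rhoE a_lt1).
have -> : ((rhoR a n.+1)%:C)^*%C = (rhoR a n.+1)%:C :> R[i].
  by apply: ext_complex; rewrite /= ?oppr0.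
by rewrite rec1 addrK.
Qed.

(** Substituting [psi_k = (1 - conj(alpha_k) z) phi_k / eta_k] in [zeta_psi], the terms in [z phi_k]
    are collected on the left and those in [phi_k] on the right. *)
Let phi_rel n (z : circle R) :
  lincomb zF (fun k => ((et k)^-1)%:C * ((k == n)%:R + (alpha k)^*%C * H k n)) n.+2 z =
  lincomb F (fun k => ((et k)^-1)%:C * (H k n + imx_diag alpha k n)) n.+2 z.
Proof.
rewrite /lincomb /on_circle.
have v0 := varpi_neq0 r_lt1 alpha_le n z.
have e1 : zeta alpha n z * psi n z = (circle_val z - alpha n) * phi n z * ((et n)^-1)%:C.
  rewrite /zeta /psi /varpi_star fmorphV /=; have := et0 n.
  by move: (et n)%:C (varpi alpha n z) v0 => y t t0 y0; field; rewrite y0 t0.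
have e2 : \sum_(k < n.+2) H k n * psi k z =
    \sum_(k < n.+2) ((et k)^-1)%:C * H k n * (phi k z - (alpha k)^*%C * circle_val z * phi k z).
  apply: eq_bigr => k _; rewrite /psi fmorphV /= /varpi.
  have -> : (1 - Num.conj (alpha k) * circle_val z) = 1 - (alpha k)^*%C * circle_val z by [].
  by ring.
have e3 (f : nat -> R[i]) : \sum_(k < n.+2) (k == n :> nat)%:R * f k = f n.
  rewrite (bigD1 (Ordinal (leqnSn n.+1)))//= eqxx mul1r big1 ?addr0// => k kn.
  have -> : (k == n :> nat) = false by apply/negbTE; move: kn; apply: contra => /eqP kn; apply/eqP/val_inj.
  by rewrite mul0r.
have := etrans (esym e1) (etrans (zeta_psi n z) e2).
rewrite -(e3 (fun k => (circle_val z - alpha k) * phi k z * ((et k)^-1)%:C)) => e.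
apply/eqP; rewrite -subr_eq0 -sumrB; apply/eqP.
move/eqP: e; rewrite -subr_eq0 -sumrB => /eqP e; rewrite -[RHS]e; apply: eq_bigr => k _.
rewrite /imx_diag; case: eqP => _ /=; by ring.
Qed.

Let zM_L2 f : L2 mu f -> L2 mu (fun z => circle_val z * f z).
Proof.
move=> lf; apply: (@L2M_bounded _ _ _ _ 1) => //; first exact: measC_id.
by move=> z; rewrite cabs_circle.
Qed.

Let zJM_L2 f : L2 mu f -> L2 mu (fun z => (circle_val z)^*%C * f z).
Proof.
move=> lf; apply: (@L2M_bounded _ _ _ _ 1) => //; first exact/measCJ/measC_id.
by move=> z; rewrite cabsJ cabs_circle.
Qed.

Let inner_zz f g : inner mu (fun z => circle_val z * f z) (fun z => circle_val z * g z) = inner mu f g.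
Proof.
rewrite !innerE; congr integralC; apply/funext => z.
by rewrite conjM mulrACA circle_mulJ mul1r.
Qed.

Let inner_zJzJ f g :
  inner mu (fun z => (circle_val z)^*%C * f z) (fun z => (circle_val z)^*%C * g z) = inner mu f g.
Proof.
rewrite !innerE; congr integralC; apply/funext => z.
by rewrite conjM conjcK mulrACA [circle_val z * _]mulrC circle_mulJ mul1r.
Qed.

Let inner_zJ f g :
  inner mu f (fun z => circle_val z * g z) = inner mu (fun z => (circle_val z)^*%C * f z) g.
Proof.
rewrite !innerE; congr integralC; apply/funext => z.
by rewrite conjM conjcK mulrCA mulrA.
Qed.

Let ozF : Defs.orthonormal mu zF.
Proof.
split=> [n|i j]; first exact: (zM_L2 (L2F oF n)).
by rewrite (inner_zz (F i) (F j)); case: oF.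
Qed.

Definition orf_matrix i j : R[i] := inner mu (F i) (zF j).
Local Notation V := orf_matrix.

(** Row [i] of [V] consists of the conjugated Fourier coefficients of [conj z phi_i], so [V V^* = 1]
    is a statement about Parseval's identity for these functions. *)
Let VzJ i j : V i j = (coef mu F (fun z => (circle_val z)^*%C * phi i z) j)^*%C.
Proof.
rewrite /orf_matrix (inner_zJ (F i) (F j)).
exact: (inner_conj (L2F oF j) (zJM_L2 (L2F oF i))).
Qed.

Lemma orf_matrix_rel i n :
  \sum_(k < n.+2) V i k * ((et k)^-1)%:C * (((k : nat) == n)%:R + (alpha k)^*%C * H k n) =
  ((et i)^-1)%:C * (H i n + imx_diag alpha i n).
Proof.
have := congr1 (inner mu (F i)) (funext (phi_rel n)).
rewrite (inner_lincomb ozF _ _ (L2F oF i)) (inner_lincomb oF _ _ (L2F oF i)).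
under eq_bigr do rewrite mulrC mulrA.
move=> ->; have [_ oE] := oF.
under eq_bigr do rewrite oE.
have [in2|ni] := ltnP i n.+2.
  rewrite (bigD1 (Ordinal in2))//= eqxx mulr1 big1 ?addr0// => k ki.
  have -> : (i == k :> nat) = false.
    by apply/negbTE; move: ki; apply: contra => /eqP ki; apply/eqP/val_inj.
  by rewrite mulr0.
rewrite big1 => [|k _].
  by rewrite hessenberg_hess// /imx_diag gtn_eqF ?(ltnW ni)// addr0 mulr0.
by rewrite gtn_eqF ?mulr0// (leq_trans (ltn_ord k)).
Qed.

(** Bessel's inequality for [f], the sum of the [x_j z phi_j]: its coefficients are the entries of
    [V x], and its norm is that of [x] because the [z phi_j] are orthonormal. *)
Lemma opb_orf_matrix : opb V 1.
Proof.
split=> // m n x; rewrite expr1n mul1r -(nsq_lincomb ozF).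
have lx : L2 mu (lincomb zF x n) by apply: L2_lincomb; exact: (L2F ozF).
apply: le_trans (bessel oF lx m); rewrite le_eqVlt; apply/orP; left; apply/eqP.
apply: eq_bigr => i _; congr (cabs _ ^+ 2).
by rewrite /coef (inner_lincomb ozF _ _ (L2F oF i)); apply: eq_bigr => j _; rewrite mulrC.
Qed.

Lemma orf_closure : L2closure mu (Defs.span F) = L.
Proof.
congr (L2closure mu _); case: orf => _ sp _ _ _.
have on_span G n f : spanned_by (fun k => @on_circle R (G k)) n f <->
    exists2 g, spanned_by G n g & f = on_circle g.
  split=> [[c ->]|[g [c ->] ->]]; last by exists c.
  by exists (lincomb G c n) => //; exists c.
(* [is_orf] equates the spans of positive length [n.+1]; padding by a zero coefficient brings every
   span to that form. *)
have w (G : nat -> R[i] -> R[i]) n f : spanned_by (fun k => @on_circle R (G k)) n f ->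
    spanned_by (fun k => @on_circle R (G k)) n.+1 f.
  move=> [c ->]; exists (fun k => if (k < n)%N then c k else 0).
  exact: (lincomb_widen _ _ (leqnSn n)).
apply/seteqP; split=> f [n _ /w /on_span [g sg fg]]; exists n.+1 => //.
  by apply/on_span; exists g => //; rewrite -sp.
by apply/on_span; exists g => //; rewrite sp.
Qed.

Let F_L n : L (F n). Proof. by rewrite -orf_closure; apply: closure_sub; [move=> f; exact/span_L2/(L2F oF)|exact: span_mem]. Qed.

(** Parseval applies to [z phi_i], which stays in [L] by invariance. *)
Lemma orf_matrix_isometric : imxM (imx_adj V) V = imx1.
Proof.
apply/funext => i; apply/funext => j; apply: seriesC_hsum.
have [_ oE] := ozF.
rewrite /imx1 -oE; apply: (parseval oF); last exact: (L2F ozF).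
by rewrite orf_closure; apply: (rat_closure_z r_lt1 alpha_le); exact: F_L.
Qed.

(** Parseval for the functions [conj z phi_i], which lie in [L] as soon as [L] is the whole
    space. *)
Lemma orf_matrix_coisometric : poly_closure mu = L2 mu -> imxM V (imx_adj V) = imx1.
Proof.
move=> PL; apply/funext => i; apply/funext => j; apply: seriesC_hsum.
have [_ oE] := oF.
have -> : imx1 i j = inner mu (fun z => (circle_val z)^*%C * phi i z) (fun z => (circle_val z)^*%C * phi j z).
  by rewrite inner_zJzJ oE.
have := parseval oF (f := fun z => (circle_val z)^*%C * phi i z)
  (g := fun z => (circle_val z)^*%C * phi j z).
rewrite orf_closure (rat_poly_closure mu r_lt1 alpha_le) PL.
move=> /(_ (zJM_L2 (L2F oF i)) (zJM_L2 (L2F oF j))); congr hsum; apply/funext => k.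
by rewrite /imx_adj !VzJ conjcK.
Qed.

(** Since [phi_0 = 1], the entry [(0, 0)] of [V V^* = 1] says that the squared Fourier coefficients
    of [conj z] sum to 1, its squared norm; hence [conj z] lies in [L = P]. *)
Lemma poly_closure_of_coisometric : imxM V (imx_adj V) = imx1 -> poly_closure mu = L2 mu.
Proof.
move=> VV; apply/poly_closure_full.
pose zJ (z : circle R) := (circle_val z)^*%C.
have phi0 : phi 0%N = (fun=> 1) by case: orf.
have lzJ : L2 mu zJ.
  by apply: (@L2_bounded _ _ _ 1) => [|z]; [exact/measCJ/measC_id|rewrite cabsJ cabs_circle].
have V0 k : V 0%N k = (coef mu F zJ k)^*%C.
  rewrite VzJ; congr (_^*%C); congr coef; apply/funext => z.
  by rewrite phi0 mulr1.
have [s hs] := hsumM (row_l2 0%N opb_orf_matrix) (col_l2 0%N (opb_adj opb_orf_matrix)).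
have s1 : s = 1.
  by have := congr1 (fun M => M 0%N 0%N) VV; rewrite /imxM (seriesC_hsum hs).
have n1 : nsq mu zJ = 1.
  rewrite /nsq; under [X in Rintegral _ _ X]eq_fun do rewrite /zJ cabsJ cabs_circle expr1n.
  by rewrite Rintegral_cst// mul1r [X in fine X]probability_setT.
rewrite -(rat_poly_closure mu r_lt1 alpha_le) -orf_closure.
apply: (closure_of_coef oF lzJ) => e e0; rewrite n1.
have := cvgC_Re hs; rewrite s1 => /cvgrPdist_lt /(_ e e0) [N _ /(_ N (leqnn N))] /=.
rewrite Re_sum => h; exists N; apply: le_lt_trans h.
apply: le_trans (ler_norm _); rewrite lerD2l lerN2 le_eqVlt; apply/orP; left; apply/eqP.
apply: eq_bigr => k _; rewrite /imx_adj V0 conjcK.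
by rewrite -cabs2C.
Qed.

End orf_matrix.

Local Close Scope complex_scope.

Theorem theorem4p1 (R : realType) (alpha a : nat -> R[i])
    (mu : probability (circle R) R) (phi : nat -> R[i] -> R[i])
    (alpha_0 : alpha 0%N = 0)
    (alpha_compact : exists2 r : R, r < 1 & forall n, cabs (alpha n) <= r)
    (mu_infinite : infinite_set (supp mu))
    (a_0 : a 0%N = 1)
    (orf : is_orf alpha mu phi a) :
  let phiT := fun n => on_circle (phi n) in
  let L := rat_closure alpha mu in
  let P := poly_closure mu in
  let A := imx_diag alpha in
  let H := hessenberg a in
  let V := moebius A H in
  [/\ (forall f, L f -> L (mulz f)),
      (forall f, L f -> norm2sq mu (mulz f) = norm2sq mu f),
      moebius_dom A H &
      represents mu (@mulz R) L phiT V] /\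
  isometric_imx V /\
  [<-> represents mu (@mulz R) (L2 mu) phiT V;
       L = L2 mu;
       P = L2 mu;
       ~ log_density_integrable mu;
       ~ l2seq (fun n => a n.+1);
       unitary_imx V].
Proof.
move=> phiT L P A H V.
have [r r_lt1 alpha_le] := alpha_compact.
have a_lt1 n : (0 < n)%N -> `|a n| < 1 by case: orf => _ _ _ h _; exact: h.
have opH := opb_hessenberg a_lt1 a_0.
have opV := opb_orf_matrix orf.
have relV := orf_matrix_rel r_lt1 alpha_le a_0 orf.
have VE : V = orf_matrix mu phi.
  by apply: (moebius_eval r_lt1 alpha_le opH opV _ relV) => k n; exact: hessenberg_hess.
clearbody V.
have LP : L = P by exact: (rat_poly_closure mu r_lt1 alpha_le).
have bV : bounded_imx V by rewrite VE; apply/bounded_imxP; exists 1.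
have VV : imxM (imx_adj V) V = imx1 by rewrite VE; exact: orf_matrix_isometric r_lt1 alpha_le orf.
have basisE := orf_closure orf.
have oF : Defs.orthonormal mu phiT by case: orf.
have repr M : L = M -> represents mu (@mulz R) M phiT V.
  by move=> <-; split; [split|move=> i j; rewrite VE].
split; [split|split].
- by move=> f; exact: (rat_closure_z r_lt1 alpha_le).
- by move=> f _; exact: norm2sq_mulz.
- exact: (moebius_domP r_lt1 alpha_le opH).
- exact: repr.
- by split.
tfae.
(* Representing the full operator requires a basis of all of [L^2], whereas the [phi_n] span a dense
   subspace of [L] exactly. *)
- by move=> [[_ +] _]; rewrite basisE.
- by rewrite LP.
- by move/szego.
(* The passage from the density to [a] goes back through [P = L^2] and coisometry. *)
- move=> /szego PL; rewrite l2seqP.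
  apply: (not_l2_of_coisometry a_lt1 a_0 r_lt1 alpha_le opV relV).
  exact: orf_matrix_coisometric r_lt1 alpha_le orf PL.
- rewrite l2seqP => na; split; [exact: bV|exact: VV|rewrite VE].
  apply: (coisometry_of_not_l2 a_lt1 a_0 r_lt1 alpha_le opV relV na).
  by rewrite -VE.
- move=> [_ _ VVa]; apply: repr; rewrite LP.
  by apply: (poly_closure_of_coisometric r_lt1 alpha_le orf); rewrite -VE.
Qed.
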